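(* Consider the hybrid optimal control problem with reach time to the target set $\Gamma$ described in the context (all listed standing assumptions are in force), with value function $V$. If $V$ is continuous, then $V$ is the unique solution, in the viscosity sense, of the quasi-variational inequality $$\begin{cases} V(x,q)-MV(x,q)=0 & (x,q)\in A\times I,\\ \max\{V(x,q)-NV(x,q),\;V(x,q)+H(x,q,D_xV(x,q))\}=0 & (x,q)\in C\times I,\\ V(x,q)+H(x,q,D_xV(x,q))=0 & (x,q)\in \big(\Omega\setminus(A\cup C\cup\Gamma)\big)\times I,\\ V(x,q)-h(x)=0 & (x,q)\in\partial\Gamma\times\{j\}.\end{cases}$$
   Context: State space and data. Let $I=\{1,2,\dots\}$. $U$ and $V_1$ are compact metric spaces (continuous and discrete control sets), and $\mathcal U$ is the set of measurable functions $u:[0,\infty)\to U$. For each $i\in I$, $\Omega_i\subset\mathbb R^{d_i}$ is the closure of a connected open set, and $A_i,C_i,D_i\subset\Omega_i$ are closed sets (autonomous jump set, controlled jump set, jump destination set); $\Omega,A,C,D$ denote the (disjoint) unions over $i\in I$ of $\Omega_i,A_i,C_i,D_i$. Pairs $(x,q)$ are always understood with $x\in\Omega_q$ (so $(x,q)\in A\times I$ means $x\in A_q$, etc.); $(x_n,q_n)\to(x,q)$ means $q_n=q$ eventually and $x_n\to x$ in $\mathbb R^{d_q}$. $d(S,T)$ denotes the Euclidean distance between sets. Assumptions on the system. - $\partial A_i,\partial C_i$ are $C^2$, and $\partial A_i\supseteq\partial\Omega_i$, for every $i$. - The transition map $g=\{g_i\}$, with $g_i:A_i\times V_1\to D_j$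 for some $j=j(i)\in I$ (written $g(x,i,v)=g_i(x,v)$), is bounded and Lipschitz with constant $G$. - The vector fields $f_i:\Omega_i\times U\to\mathbb R^{d_i}$ are Lipschitz in $x$ with constant $L$, uniformly continuous in $u$, and $|f_i(x,u)|\le F$ for all $i$, $x\in\Omega_i$, $u\in U$; write $f(x,q,u)=f_q(x,u)$. - (Transversality) For every $i$, $A_i$ is compact and there is a constant $\xi_0>0$ with $f_i(x_0,u)\cdot\eta(x_0)\le-2\xi_0$ for all $x_0\in\partial A_i$, $u\in U$, where $\eta(x_0)$ is the outward unit normal to $\partial A_i$ at $x_0$; the analogous condition is assumed for the sets $C_i$. - For some $\beta>0$: $\inf_i d(A_i,C_i)\ge\beta$ and $\inf_i d(A_i,D_i)\ge\beta$. Target set. For some fixed $j\in I$, $\Gamma\subset\Omega_j$ is closed, $\partial\Gamma$ is compact ($C^2$, like $\partial A_i$), $d(\Gamma,D_j)\ge\beta$, $d(\Gamma,A_j)\ge\beta$, $d(\Gamma,C_j)\ge\beta$, and the transversality condition holds on $\Gamma$: $f_j(x_0,u)\cdot\eta_\Gamma(x_0)\le-2\xi_0$ for all $x_0\in\partial\Gamma$, $u\in U$, for some $\xi_0>0$, with $\eta_\Gamma$ the outward unit normal to $\partial\Gamma$. Dynamics. From an initial state $(x,q)$, the state $(y_x(t,u),q(t))$ evolves by $\dot y(t)=f_{q(t)}(y(t),u(t))$, $y(0)=x$, with $q(t)=i$ while $y(t)\in\Omega_i$, between jumps (trajectories are left-continuous). When the trajectory hits $A$, at times $\tau_1,\tau_2,\dots$,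 in states $(x_k,q_k)$, it must jump to $g(x_k,q_k,v_k)\in D$ with a discrete control $v_k\in V_1$, and $q$ becomes the index of the component containing the new point. When the trajectory is in $C$, the controller may (but need not) jump; the times at which it chooses to jump are denoted $\xi_1,\xi_2,\dots$, and the state $(y(\xi_k),q(\xi_k))$, with $y(\xi_k)\in C_{q(\xi_k)}$, is then moved to a chosen state $(y(\xi_k)',q(\xi_k)')$ with $y(\xi_k)'\in D_{q(\xi_k)'}$. After each jump the continuous evolution resumes with the control $u$. The evolution stops when $\Gamma$ is reached: $t_x(u)=\min\{t\ge 0: y_x(t,u)\in\Gamma\}$, and $t_x(u)=+\infty$ if this set is empty. Costs. $\lambda>0$ is a constant. - $K:\Omega\times I\times U\to\mathbb R$ is Lipschitz in $x$, uniformly continuous in $u$, and $|K|\le K_0$. - $C_a:A\times I\times V_1\to\mathbb R$ and $C_c:C\times I\times D\times I\to\mathbb R$ are uniformly continuous and bounded below by a constant $C'>0$; $C_a$ is Lipschitz in $x$ and $|C_a|\le C_0$; and $C_c(x,q,y,q')<C_c(x,q,z,q')+C_c(z,q',y,q')$ for all $x\in C_q$, $z\in D\cap C_{q'}$, $y\in D_{q'}$. - $h:\Gamma\to\mathbb R$ is continuous and $h\ge0$. Cost functional and value function. For a control $\theta=(u,(v_k),(\xi_k),(y(\xi_k)'))$, $$J(x,q,\theta)=\int_0^{t_x(u)}K(y_x(t,u),q(t),u(t))e^{-\lambda t}dt+\sum_{\tau_k<t_x(u)}C_a(x_k,q_k,v_k)e^{-\lambda\tau_k}+\sum_{\xi_k<t_x(u)}C_c(y(\xi_k),q(\xi_k),y(\xi_k)',q(\xi_k)')e^{-\lambda\xi_k}+e^{-\lambda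 t_x(u)}h(y_x(t_x(u),u)),$$ the last term being $0$ if $t_x(u)=+\infty$, and $V(x,q)=\inf_\theta J(x,q,\theta)$. In particular $V(x,j)=h(x)$ for $x\in\partial\Gamma$. Operators. For a function $W$ of $(x,q)$: $$MW(x,q)=\inf_{v\in V_1}\{W(g(x,q,v),q')+C_a(x,q,v)\}\quad(x\in A_q),$$ where $q'$ is the index of the component containing $g(x,q,v)$; $$NW(x,q)=\inf_{q'\in I,\,x'\in D_{q'}}\{W(x',q')+C_c(x,q,x',q')\}\quad (x\in C_q);$$ $$H(x,q,p)=\sup_{u\in U}\frac{-K(x,q,u)-f(x,q,u)\cdot p}{\lambda}\quad(p\in\mathbb R^{d_q}).$$ Viscosity solutions. Solutions are bounded continuous functions $W$ on $\{(x,q): x\in\overline{\Omega_q\setminus\Gamma}\}$. $W$ is a viscosity subsolution (respectively supersolution) of the system if: $W-MW\le0$ (resp. $\ge0$) at every $x\in A_q$; $W\le h$ (resp. $\ge h$) on $\partial\Gamma\times\{j\}$; and for every $q$, every $C^1$ function $\varphi$ and every local maximum (resp. minimum) point $x$ of $W(\cdot,q)-\varphi$ one has $\max\{W(x,q)-NW(x,q),W(x,q)+H(x,q,D\varphi(x))\}\le0$ (resp. $\ge0$) if $x\in C_q$, and $W(x,q)+H(x,q,D\varphi(x))\le0$ (resp. $\ge0$) if $x\in\Omega_q\setminus(A_q\cup C_q\cup\Gamma)$. A viscosity solution is a function that is both a subsolution and a supersolution. *)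

(* Defs.v *)
From HB Require Import structures.
From mathcomp Require Import all_boot all_order all_algebra.
From mathcomp Require Import all_classical all_reals all_analysis.

Set Implicit Arguments.
Unset Strict Implicit.
Unset Printing Implicit Defensive.

Import Order.TTheory GRing.Theory Num.Theory.
Import numFieldNormedType.Exports.

Local Open Scope classical_set_scope.
Local Open Scope ring_scope.

(** * Euclidean geometry of R^n *)
(* The library norm on ['rV_n] is the sup norm.  It gives the right topology;
   wherever constants or angles matter, the Euclidean norm below is used. *)
Section Euclidean.
Variables (R : realType) (n : nat).
Implicit Types (x y : 'rV[R]_n) (S T : set 'rV[R]_n) (phi : 'rV[R]_n -> R).

Definition dot x y : R := \sum_k x 0 k * y 0 k.

Definition enorm x : R := Num.sqrt (dot x x).

Definition set_dist S T : \bar R :=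
  ereal_inf [set (enorm (p.1 - p.2))%:E | p in S `*` T].

Definition bdry S : set 'rV[R]_n := closure S `\` interior S.

Definition grad phi x : 'rV[R]_n := \row_k 'D_(delta_mx 0 k) phi x.

Definition C1_on (N : set 'rV[R]_n) phi : Prop :=
  forall x, N x -> differentiable phi x /\
    forall k, {for x, continuous (fun y => grad phi y 0 k)}.

Definition C2_on (N : set 'rV[R]_n) phi : Prop :=
  C1_on N phi /\ forall k, C1_on N (fun y => grad phi y 0 k).

(* Near [x0], [S] is the sublevel set [rho <= 0] of a C^2 function with
   nonvanishing gradient. *)
Definition C2_defining_function S (x0 : 'rV[R]_n) (rho : 'rV[R]_n -> R) :=
  exists N : set 'rV[R]_n,
    [/\ open_nbhs x0 N, C2_on N rho, grad rho x0 != 0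
      & forall x, N x -> (S x <-> rho x <= 0)].

Definition C2_boundary S : Prop :=
  forall x0, bdry S x0 -> exists rho, C2_defining_function S x0 rho.

Definition outward_unit_normal S (x0 eta : 'rV[R]_n) : Prop :=
  exists2 rho, C2_defining_function S x0 rho
             & eta = (enorm (grad rho x0))^-1 *: grad rho x0.

End Euclidean.

(** * Data of the hybrid control problem *)
(* Discrete modes are indexed by [nat].  The maps are total functions; only
   their values on the sets where the problem uses them matter.  The target
   and the terminal cost are families over all modes, of which only the member
   of index [tgt] counts: [Gamma i] is empty for the other modes [i]. *)
Record hybrid_data (R : realType) (U V1 : metricType R) := HybridData {
  sdim : nat -> nat;
  Omega : forall i, set 'rV[R]_(sdim i);
  A : forall i, set 'rV[R]_(sdim i);
  C : forall i, set 'rV[R]_(sdim i);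
  D : forall i, set 'rV[R]_(sdim i);
  dest : nat -> nat;
  g : forall i, 'rV[R]_(sdim i) -> V1 -> 'rV[R]_(sdim (dest i));
  f : forall i, 'rV[R]_(sdim i) -> U -> 'rV[R]_(sdim i);
  tgt : nat;
  Gamma : forall i, set 'rV[R]_(sdim i);
  K : forall i, 'rV[R]_(sdim i) -> U -> R;
  Ca : forall i, 'rV[R]_(sdim i) -> V1 -> R;
  Cc : forall i i', 'rV[R]_(sdim i) -> 'rV[R]_(sdim i') -> R; (* x, then x' *)
  h : forall i, 'rV[R]_(sdim i) -> R;
  lambda : R }.

Arguments Omega {R U V1} h i _ : rename.
Arguments A {R U V1} h i _ : rename.
Arguments C {R U V1} h i _ : rename.
Arguments D {R U V1} h i _ : rename.
Arguments g {R U V1} h i _ _ : rename.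
Arguments f {R U V1} h i _ _ : rename.
Arguments Gamma {R U V1} h i _ : rename.
Arguments K {R U V1} h i _ _ : rename.
Arguments Ca {R U V1} h i _ _ : rename.
Arguments Cc {R U V1} h i i' _ _ : rename.
Arguments h {R U V1} h i _ : rename.

Section Assumptions.
Variables (R : realType) (U V1 : metricType R) (S : hybrid_data U V1).

Definition transversal i (B : set 'rV[R]_(sdim S i)) : Prop :=
  exists2 xi0 : R, 0 < xi0 & forall x0 eta u,
    bdry B x0 -> outward_unit_normal B x0 eta ->
    dot (f S i x0 u) eta <= - 2 * xi0.

Definition control_sets_ok : Prop :=
  [/\ compact [set: U], [set: U] !=set0,
      compact [set: V1] & [set: V1] !=set0].

Definition domains_ok : Prop := forall i,
  (exists O, [/\ open O, connected O & Omega S i = closure O]) /\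
  [/\ closed (A S i), closed (C S i), closed (D S i),
      A S i `<=` Omega S i & C S i `<=` Omega S i /\ D S i `<=` Omega S i] /\
  [/\ C2_boundary (A S i), C2_boundary (C S i)
    & bdry (Omega S i) `<=` bdry (A S i)].

Definition transition_ok : Prop :=
  [/\ forall i x v, A S i x -> D S (dest S i) (g S i x v),
      exists B : R, forall i x v, A S i x -> enorm (g S i x v) <= B
    & exists G : R, forall i x x' v v', A S i x -> A S i x' ->
        enorm (g S i x v - g S i x' v') <= G * (enorm (x - x') + mdist v v')].

Definition vector_fields_ok : Prop :=
  [/\ exists L : R, forall i x x' u, Omega S i x -> Omega S i x' ->
        enorm (f S i x u - f S i x' u) <= L * enorm (x - x'),
      forall i (e : R), 0 < e -> exists2 del : R, 0 < del &
        forall x u u', Omega S i x -> mdist u u' < del ->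
          enorm (f S i x u - f S i x u') < e
    & exists F : R, forall i x u, Omega S i x -> enorm (f S i x u) <= F].

Definition transversality_ok : Prop := forall i,
  [/\ compact (A S i), transversal (A S i) & transversal (C S i)].

Definition target_ok : Prop :=
  [/\ forall i, i != tgt S -> Gamma S i = set0,
      closed (Gamma S (tgt S)) /\ Gamma S (tgt S) `<=` Omega S (tgt S),
      compact (bdry (Gamma S (tgt S))), C2_boundary (Gamma S (tgt S))
    & transversal (Gamma S (tgt S))].

Definition separation_ok : Prop := exists2 beta : R, 0 < beta &
  (forall i, (beta%:E <= set_dist (A S i) (C S i))%E /\
             (beta%:E <= set_dist (A S i) (D S i))%E) /\
  [/\ (beta%:E <= set_dist (Gamma S (tgt S)) (D S (tgt S)))%E,
      (beta%:E <= set_dist (Gamma S (tgt S)) (A S (tgt S)))%E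
    & (beta%:E <= set_dist (Gamma S (tgt S)) (C S (tgt S)))%E].

Definition running_cost_ok : Prop :=
  [/\ exists L : R, forall i x x' u, Omega S i x -> Omega S i x' ->
        `|K S i x u - K S i x' u| <= L * enorm (x - x'),
      forall e : R, 0 < e -> exists2 del : R, 0 < del &
        forall i x u u', Omega S i x -> mdist u u' < del ->
          `|K S i x u - K S i x u'| < e
    & exists K0 : R, forall i x u, Omega S i x -> `|K S i x u| <= K0].

Definition switching_costs_ok : Prop :=
  [/\ forall e : R, 0 < e -> exists2 del : R, 0 < del &
        forall i x x' v v', A S i x -> A S i x' ->
          enorm (x - x') < del -> mdist v v' < del ->
          `|Ca S i x v - Ca S i x' v'| < e,
      forall e : R, 0 < e -> exists2 del : R, 0 < del &
        forall i i' x x' y y', C S i x -> C S i x' -> D S i' y -> D S i' y' ->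
          enorm (x - x') < del -> enorm (y - y') < del ->
          `|Cc S i i' x y - Cc S i i' x' y'| < e,
      exists2 c : R, 0 < c &
        (forall i x v, A S i x -> c <= Ca S i x v) /\
        (forall i i' x y, C S i x -> D S i' y -> c <= Cc S i i' x y),
      (exists L : R, forall i x x' v, A S i x -> A S i x' ->
        `|Ca S i x v - Ca S i x' v| <= L * enorm (x - x')) /\
      (exists C0 : R, forall i x v, A S i x -> `|Ca S i x v| <= C0)
    & forall i i' x y z, C S i x -> D S i' z -> C S i' z -> D S i' y ->
        Cc S i i' x y < Cc S i i' x z + Cc S i' i' z y].

Definition terminal_cost_ok : Prop :=
  {within Gamma S (tgt S), continuous (h S (tgt S))} /\
  (forall x, Gamma S (tgt S) x -> 0 <= h S (tgt S) x).

Record standing_assumptions : Prop := StandingAssumptions {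
  sa_control_sets : control_sets_ok;
  sa_domains : domains_ok;
  sa_transition : transition_ok;
  sa_vector_fields : vector_fields_ok;
  sa_transversality : transversality_ok;
  sa_target : target_ok;
  sa_separation : separation_ok;
  sa_running_cost : running_cost_ok;
  sa_switching_costs : switching_costs_ok;
  sa_terminal_cost : terminal_cost_ok;
  sa_lambda : 0 < lambda S }.

End Assumptions.

(** * Controls, trajectories, value function *)
Section Dynamics.
Variables (R : realType) (U V1 : metricType R) (S : hybrid_data U V1).

Definition state : Type := {i : nat & 'rV[R]_(sdim S i)}.
Definition mkstate i (x : 'rV[R]_(sdim S i)) : state :=
  existT (fun i => 'rV[R]_(sdim S i)) i x.

(* [ct_time k = +oo] means that there is no k-th controlled jump. *)
Record control := Control {
  ct_u : R -> U;
  ct_v : nat -> V1;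
  ct_time : nat -> \bar R;
  ct_dest : nat -> state;
  ct_measurable : forall O : set U, open O ->
    measurable ([set t : R | 0 <= t] `&` ct_u @^-1` O) }.

(* A trajectory is a sequence of phases separated by jumps.  Phase [n] lasts
   from [tr_time n] to [tr_time n.+1], in mode [tr_mode n], along the arc
   [tr_arc n]; [tr_auto n] tells whether the jump that ends it is autonomous
   (otherwise it is controlled); [tr_time n = +oo] means that there is no such
   phase.  A phase may have length zero, so that successive jumps can take
   place at the same time.  [tr_stop] is the reach time of the target. *)
Record trajectory := Trajectory {
  tr_time : nat -> \bar R;
  tr_mode : nat -> nat;
  tr_arc : forall n, R -> 'rV[R]_(sdim S (tr_mode n));
  tr_auto : nat -> bool;
  tr_stop : \bar R }.

Implicit Types (th : control) (e : trajectory).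

Definition n_auto e n : nat := (\sum_(m < n) tr_auto e m)%N.
Definition n_ctrl e n : nat := (\sum_(m < n) ~~ tr_auto e m)%N.

Definition jump_time e n : R := fine (tr_time e n.+1).
Definition pre_jump e n : 'rV[R]_(sdim S (tr_mode e n)) :=
  tr_arc e n (jump_time e n).
Definition post_jump e n : state := mkstate (tr_arc e n.+1 (jump_time e n)).

(* The left-continuous state (y(t), q(t)); [phase_at e 0 = 0]. *)
Definition phase_at e (t : R) : nat :=
  xget 0%N [set n | (tr_time e n < t%:E)%E /\ (t%:E <= tr_time e n.+1)%E].
Definition mode_at e t : nat := tr_mode e (phase_at e t).
Definition pos_at e t : 'rV[R]_(sdim S (mode_at e t)) :=
  tr_arc e (phase_at e t) t.

(* Phase [n] solves the (Caratheodory) state equation, in integral form, and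
   avoids the autonomous jump set before its end. *)
Definition flows th e n : Prop := forall t : R,
  (tr_time e n <= t%:E)%E -> (t%:E <= tr_time e n.+1)%E ->
  (t%:E <= tr_stop e)%E ->
  let q := tr_mode e n in let y := tr_arc e n in
  let a := fine (tr_time e n) in
  [/\ Omega S q (y t),
      (t%:E < tr_time e n.+1)%E -> ~ A S q (y t)
    & forall k,
      let F s := f S q (y s) (ct_u th s) 0 k in
      lebesgue_measure.-integrable `[a, t] (EFin \o F) /\
      y t 0 k = y a 0 k + \int[lebesgue_measure]_(s in `[a, t]) F s].

Definition jumps th e n : Prop := (tr_time e n.+1 < +oo)%E ->
  if tr_auto e n then
    A S (tr_mode e n) (pre_jump e n) /\
    post_jump e n =
      mkstate (g S (tr_mode e n) (pre_jump e n) (ct_v th (n_auto e n)))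
  else
    [/\ C S (tr_mode e n) (pre_jump e n),
        tr_time e n.+1 = ct_time th (n_ctrl e n),
        D S (projT1 (ct_dest th (n_ctrl e n)))
            (projT2 (ct_dest th (n_ctrl e n)))
      & post_jump e n = ct_dest th (n_ctrl e n)].

(* [tr_stop] is the least time at which the state is in the target, or [+oo]
   if there is none; the evolution ends there. *)
Definition stops e : Prop :=
  [/\ (0 <= tr_stop e)%E,
      forall t : R, 0 <= t -> (t%:E < tr_stop e)%E ->
        ~ Gamma S (mode_at e t) (pos_at e t),
      forall t : R, tr_stop e = t%:E -> Gamma S (mode_at e t) (pos_at e t)
    & forall n, (tr_time e n.+1 < +oo)%E -> (tr_time e n.+1 < tr_stop e)%E].

Definition trajectory_of th q (x : 'rV[R]_(sdim S q)) e : Prop :=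
  [/\ tr_time e 0 = 0%E /\ mkstate (tr_arc e 0%N 0) = mkstate x,
      (forall n, (tr_time e n <= tr_time e n.+1)%E) /\
      (forall M : R, exists n, (M%:E < tr_time e n)%E),
      forall n, flows th e n /\ jumps th e n,
      (* no prescribed controlled jump is skipped *)
      forall n, (tr_time e n < +oo)%E ->
        (mine (tr_time e n.+1) (tr_stop e) <= ct_time th (n_ctrl e n))%E
    & stops e].

Definition cost th e : \bar R :=
  (\int[lebesgue_measure]_(t in [set t : R | (0 <= t)%R /\ t%:E <= tr_stop e])
     (K S (mode_at e t) (pos_at e t) (ct_u th t) * expR (- lambda S * t))%R%:E
   + \sum_(n <oo | tr_auto e n && (tr_time e n.+1 < tr_stop e))
     (Ca S (tr_mode e n) (pre_jump e n) (ct_v th (n_auto e n))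
        * expR (- lambda S * jump_time e n))%R%:E
   + \sum_(n <oo | ~~ tr_auto e n && (tr_time e n.+1 < tr_stop e))
     (Cc S (tr_mode e n) (projT1 (ct_dest th (n_ctrl e n)))
        (pre_jump e n) (projT2 (ct_dest th (n_ctrl e n)))
        * expR (- lambda S * jump_time e n))%R%:E
   + (if tr_stop e is EFin s
      then expR (- lambda S * s) * h S (mode_at e s) (pos_at e s) else 0)%R%:E)%E.

Definition value q (x : 'rV[R]_(sdim S q)) : \bar R :=
  ereal_inf [set r | exists th e, trajectory_of th x e /\ r = cost th e].

End Dynamics.

Arguments value {R U V1} S q x.

(** * The quasi-variational inequality *)
Section QVI.
Variables (R : realType) (U V1 : metricType R) (S : hybrid_data U V1).

Definition dom q : set 'rV[R]_(sdim S q) := closure (Omega S q `\` Gamma S q).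
Arguments dom : clear implicits.

Implicit Type W : forall q, 'rV[R]_(sdim S q) -> R.

(* The infima are taken in the extended reals since [D] may be empty. *)
Definition Mop W q (x : 'rV[R]_(sdim S q)) : \bar R :=
  ereal_inf [set (W (dest S q) (g S q x v) + Ca S q x v)%:E | v in [set: V1]].

Definition Nop W q (x : 'rV[R]_(sdim S q)) : \bar R :=
  ereal_inf [set r | exists q' x', D S q' x' /\
                       r = (W q' x' + Cc S q q' x x')%:E].

Definition Ham q (x p : 'rV[R]_(sdim S q)) : R :=
  sup [set (- K S q x u - dot (f S q x u) p) / lambda S | u in [set: U]].

Definition continuation_set q : set 'rV[R]_(sdim S q) :=
  Omega S q `\` (A S q `|` C S q `|` Gamma S q).

Definition viscosity_subsolution W : Prop :=
  [/\ forall q x, A S q x -> ((W q x)%:E - Mop W x <= 0)%E,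
      forall x, bdry (Gamma S (tgt S)) x -> W (tgt S) x <= h S (tgt S) x
    & forall q (phi : 'rV[R]_(sdim S q) -> R) x,
        C1_on setT phi -> dom q x ->
        (\forall y \near x, dom q y -> W q y - phi y <= W q x - phi x) ->
        (C S q x -> (maxe ((W q x)%:E - Nop W x)
                          (W q x + Ham x (grad phi x))%:E <= 0)%E) /\
        (continuation_set x -> W q x + Ham x (grad phi x) <= 0)].

Definition viscosity_supersolution W : Prop :=
  [/\ forall q x, A S q x -> (0 <= (W q x)%:E - Mop W x)%E,
      forall x, bdry (Gamma S (tgt S)) x -> h S (tgt S) x <= W (tgt S) x
    & forall q (phi : 'rV[R]_(sdim S q) -> R) x,
        C1_on setT phi -> dom q x ->
        (\forall y \near x, dom q y -> W q x - phi x <= W q y - phi y) ->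
        (C S q x -> (0 <= maxe ((W q x)%:E - Nop W x)
                               (W q x + Ham x (grad phi x))%:E)%E) /\
        (continuation_set x -> 0 <= W q x + Ham x (grad phi x))].

Definition viscosity_solution W : Prop :=
  [/\ exists B : R, forall q x, dom q x -> `|W q x| <= B,
      forall q, {within dom q, continuous (W q)},
      viscosity_subsolution W & viscosity_supersolution W].

End QVI.

Arguments dom {R U V1} S q.

(* Main.v *)
Require Import Defs.
From HB Require Import structures.
From mathcomp Require Import all_boot all_order all_algebra.
From mathcomp Require Import all_classical all_reals all_analysis.
From mathcomp Require Import measurable_realfun.
From mathcomp Require Import ring lra.
Set Implicit Arguments.
Unset Strict Implicit.
Unset Printing Implicit Defensive.
Import Order.TTheory GRing.Theory Num.Theory.
Import numFieldNormedType.Exports.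
Local Open Scope classical_set_scope.
Local Open Scope ring_scope.

(** The theorem has two halves: the value function solves the quasi-variational
    inequality, and no other bounded continuous function does.

    Uniqueness follows from a comparison principle, [comparison]: a subsolution
    [W1] lies below a supersolution [W2].  Jumps are dealt with by scaling.  If
    [W1] exceeded [W2] somewhere, then so would [mu * W1 - k] for [mu] slightly
    below 1 and a suitable small [k].  Every jump costs at least [c > 0], so the
    scaled subsolution satisfies the jump conditions with a slack [(1 - mu) * c];
    where the gap to [W2] is nearly maximal a jump would lead to a state at which
    the gap is larger than its supremum.  On the target the boundary condition and
    [h >= 0] make the gap nonpositive.  Nearly maximal points are therefore points
    at which both functions satisfy the Hamilton-Jacobi inequality, and there the
    classical doubling of variables, localised by a small quadratic term because
    the domains need not be bounded, gives a contradiction ([scaled_gap]).  The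
    inequality [W1 <= N W1], which the definition of a subsolution asserts only at
    points touched by test functions, is first extended to all of [C]
    ([subsolution_C_le]).

    That the value function is a solution is dynamic programming.  The relation
    [tail_of] says that one trajectory is what remains of another after an initial
    piece, and [cost_tail] is the corresponding identity between costs.  Pieces of
    flow and single jumps can be cut off from a trajectory or put in front of it,
    which bounds the value from below ([first_piece], [autonomous_start]) and from
    above ([value_flow], [value_jump]).  Expanding these bounds over a short time
    yields the viscosity inequalities ([value_subsolution_at],
    [value_supersolution_at]): away from [A] and the target a short flow meets no
    constraint, and at a point of [C] where the value is below its obstacle a nearly
    optimal trajectory cannot jump at once.

    All this requires the value to be finite and bounded ([value_bounded]).  It is
    bounded below because jump and terminal costs are nonnegative.  For the upper
    bound a constant control is applied and only forced jumps are made: flows exist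
    by Picard iteration for a Lipschitz extension of the field ([flow_exists]), and
    because [D] is at a positive distance from [A] and speeds are bounded, the
    jumps are separated by a fixed lapse of time and their discounted costs are
    summable ([auto_cost_bound]). *)

(** * Euclidean norm and gradients *)

Section EuclideanNorm.
Variables (R : realType) (n : nat).
Implicit Types (x y z : 'rV[R]_n) (S T : set 'rV[R]_n).

Lemma dotC x y : dot x y = dot y x.
Proof. by apply: eq_bigr => k _; rewrite mulrC. Qed.

Lemma dotDl x y z : dot (x + y) z = dot x z + dot y z.
Proof. by rewrite /dot -big_split; apply: eq_bigr => k _; rewrite mxE mulrDl. Qed.

Lemma dotZl a x y : dot (a *: x) y = a * dot x y.
Proof. by rewrite /dot mulr_sumr; apply: eq_bigr => k _; rewrite mxE mulrA. Qed.

Lemma dotNl x y : dot (- x) y = - dot x y.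
Proof. by rewrite -scaleN1r dotZl mulN1r. Qed.

Lemma dotDr x y z : dot z (x + y) = dot z x + dot z y.
Proof. by rewrite ![dot z _]dotC dotDl. Qed.

Lemma dotZr a x y : dot y (a *: x) = a * dot y x.
Proof. by rewrite ![dot y _]dotC dotZl. Qed.

Lemma dotNr x y : dot y (- x) = - dot y x.
Proof. by rewrite ![dot y _]dotC dotNl. Qed.

Lemma dot_ge0 x : 0 <= dot x x.
Proof. by apply: sumr_ge0 => k _; rewrite -expr2 sqr_ge0. Qed.

Lemma enorm_ge0 x : 0 <= enorm x. Proof. exact: sqrtr_ge0. Qed.

Lemma enorm_sq x : enorm x ^+ 2 = dot x x.
Proof. by rewrite sqr_sqrtr // dot_ge0. Qed.

Lemma coord_le_norm x k : `|x 0 k| <= `|x|.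
Proof.
rewrite [leRHS]mx_normrE.
exact: (le_bigmax _ (fun ij : 'I_1 * 'I_n => `|x ij.1 ij.2|) (0, k)).
Qed.

Lemma norm_le_coord x c : 0 <= c -> (forall k, `|x 0 k| <= c) -> `|x| <= c.
Proof.
move=> c0 h; rewrite [leLHS]mx_normrE; apply: bigmax_le => // -[i k] _ /=.
by rewrite ord1.
Qed.

Lemma coord_le_enorm x k : `|x 0 k| <= enorm x.
Proof.
rewrite -sqrtr_sqr ler_wsqrtr // /dot (bigD1 k) //= -expr2 lerDl.
by apply: sumr_ge0 => j _; rewrite -expr2 sqr_ge0.
Qed.

Lemma norm_le_enorm x : `|x| <= enorm x.
Proof.
by apply: norm_le_coord => [|k]; [exact: enorm_ge0|exact: coord_le_enorm].
Qed.

Lemma enorm_eq0 x : enorm x = 0 -> x = 0.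
Proof.
move=> x0; apply/rowP => k; rewrite mxE; apply/eqP.
by rewrite -normr_eq0 eq_le normr_ge0 -x0 coord_le_enorm.
Qed.

Lemma enorm0 : enorm (0 : 'rV[R]_n) = 0.
Proof. by rewrite /enorm -[X in dot X _](scale0r 0) dotZl mul0r sqrtr0. Qed.

Lemma enormZ a x : enorm (a *: x) = `|a| * enorm x.
Proof. by rewrite /enorm dotZl dotZr mulrA -expr2 sqrtrM ?sqr_ge0 // sqrtr_sqr. Qed.

Lemma enormN x : enorm (- x) = enorm x.
Proof. by rewrite /enorm dotNl dotNr opprK. Qed.

Lemma enormB x y : enorm (x - y) = enorm (y - x).
Proof. by rewrite -enormN opprB. Qed.

Lemma dot_CauchySchwarz x y : `|dot x y| <= enorm x * enorm y.
Proof.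
have [y0|y0] := eqVneq (enorm y) 0.
  by rewrite y0 (enorm_eq0 y0) dotC -(scale0r (0 : 'rV_n)) dotZl mul0r normr0 mulr0.
have yp : 0 < dot y y by rewrite -enorm_sq exprn_gt0 // lt_def y0 enorm_ge0.
rewrite -(@ler_pXn2r _ 2) ?nnegrE ?mulr_ge0 ?enorm_ge0 // exprMn !enorm_sq real_normK ?num_real //.
have := dot_ge0 (dot y y *: x - dot x y *: y).
rewrite !(dotDl, dotDr, dotNl, dotNr, dotZl, dotZr) (dotC y x) => h.
rewrite -(ler_pM2l yp); lra.
Qed.

Lemma dot_le x y : dot x y <= enorm x * enorm y.
Proof. exact: le_trans (ler_norm _) (dot_CauchySchwarz x y). Qed.

Lemma enormD x y : enorm (x + y) <= enorm x + enorm y.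
Proof.
rewrite -(@ler_pXn2r _ 2) ?nnegrE ?addr_ge0 ?enorm_ge0 //.
rewrite enorm_sq sqrrD !enorm_sq dotDl !dotDr (dotC y x).
have := dot_le x y; lra.
Qed.

Lemma enorm_le_norm x : enorm x <= n%:R * `|x|.
Proof.
have h k := coord_le_norm x k.
rewrite -(@ler_pXn2r _ 2) ?nnegrE ?mulr_ge0 ?enorm_ge0 // enorm_sq.
apply: (@le_trans _ _ (\sum_(k < n) `|x| ^+ 2)).
  apply: ler_sum => k _; rewrite -expr2 -real_normK ?num_real //.
  by rewrite ler_pXn2r ?nnegrE.
rewrite sumr_const card_ord -[leLHS]mulr_natl exprMn ler_pM ?sqr_ge0 //.
by rewrite -natrX ler_nat; case: (n) => // m; rewrite expnS leq_pmulr ?expn_gt0.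
Qed.

Lemma enorm_continuous : continuous (@enorm R n).
Proof.
move=> x; apply/(@cvgrPdist_le _ _ _ (nbhs x)) => e e0.
near=> y.
have hxy : n%:R * `|x - y| <= e.
  have n1 : 0 < n%:R + 1 :> R by rewrite ltr_wpDl.
  have : `|x - y| <= e / (n%:R + 1).
    by near: y; apply: cvgr_dist_le => //; rewrite divr_gt0.
  rewrite ler_pdivlMr // => h; apply: le_trans h.
  by rewrite mulrC ler_wpM2l // lerDl.
apply: le_trans hxy; apply: le_trans (enorm_le_norm _).
rewrite ler_norml; apply/andP; split.
  rewrite lerBrDr addrC lerBlDr; have := enormD (y - x) x; rewrite subrK enormB; lra.
have := enormD (x - y) y; rewrite subrK; lra.
Unshelve. all: by end_near.
Qed.

Lemma le_set_dist S T (b : R) x y :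
  (b%:E <= set_dist S T)%E -> S x -> T y -> b <= enorm (x - y).
Proof.
move=> h Sx Ty; rewrite -lee_fin; apply: le_trans h _.
by apply: ereal_inf_lbound; exists (x, y).
Qed.

Lemma grad_additive (phi psi : 'rV[R]_n -> R) x :
  differentiable phi x -> differentiable psi x ->
  grad (fun y => phi y + psi y) x = grad phi x + grad psi x.
Proof.
move=> h1 h2; apply/rowP => k; rewrite !mxE.
by rewrite deriveD //; apply: diff_derivable.
Qed.

Lemma grad_scale (phi : 'rV[R]_n -> R) a x :
  differentiable phi x -> grad (fun y => a * phi y) x = a *: grad phi x.
Proof.
move=> h1; apply/rowP => k; rewrite !mxE.
by rewrite (@deriveZ _ _ _ phi) //; apply: diff_derivable.
Qed.

Definition sqdist (y x : 'rV[R]_n) : R := dot (x - y) (x - y).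

Lemma sqdistE y x : sqdist y x = enorm (x - y) ^+ 2.
Proof. by rewrite enorm_sq. Qed.

Lemma differentiable_sqdist y x : differentiable (sqdist y) x.
Proof.
have -> : sqdist y = \sum_(k < n) (fun z : 'rV[R]_n => (z 0 k - y 0 k) * (z 0 k - y 0 k)).
  by apply/funext => z; rewrite fct_sumE; apply: eq_bigr => k _; rewrite !mxE.
apply: differentiable_sum => k.
have h : differentiable (fun z : 'rV[R]_n => z 0 k - y 0 k) x.
  apply: (@differentiableB _ _ _ (fun z : 'rV[R]_n => z 0 k) (cst (y 0 k))) => //.
  exact: differentiable_coord.
by apply: (differentiableM h h).
Qed.

Lemma grad_sqdist y x : grad (sqdist y) x = 2 *: (x - y).
Proof.
apply/rowP => k; rewrite !mxE.
suff : is_derive x (delta_mx 0 k) (sqdist y) (2 * (x 0 k - y 0 k)) by move=> h; rewrite derive_val.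
have hd j : is_derive x (delta_mx 0 k) (fun z : 'rV[R]_n => z 0 j) ((j == k)%:R : R).
  apply: DeriveDef; first exact/diff_derivable/differentiable_coord.
  rewrite deriveE; last exact: differentiable_coord.
  have @f : {linear 'rV[R]_n -> R}.
    by exists (fun N : 'rV[R]_n => N 0 j); do 2![eexists]; do ?[constructor];
     rewrite ?mxE// => ? *; rewrite ?mxE//; move=> ?; rewrite !mxE.
  rewrite (_ : (fun _ => _) = f) // diff_lin; last exact: coord_continuous.
  by rewrite /f /= mxE eqxx.
have -> : sqdist y = \sum_(k < n) (fun z : 'rV[R]_n => (z 0 k - y 0 k) * (z 0 k - y 0 k)).
  by apply/funext => z; rewrite fct_sumE; apply: eq_bigr => j _; rewrite !mxE.
have hj j : is_derive x (delta_mx 0 k) (fun z : 'rV[R]_n => (z 0 j - y 0 j) * (z 0 j - y 0 j))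
    (2 * (x 0 j - y 0 j) * (j == k)%:R).
  have h := is_deriveB (hd j) (is_derive_cst (y 0 j) x (delta_mx 0 k)).
  apply: is_derive_eq (is_deriveM h h) _.
  by rewrite /= !fctE /GRing.scale /= subr0; ring.
apply: is_derive_eq (is_derive_sum hj) _.
by rewrite (bigD1 k) //= eqxx mulr1 big1 ?addr0 // => j /negbTE ->; rewrite mulr0.
Qed.

Lemma C1_sqdist y : C1_on setT (sqdist y).
Proof.
move=> x _; split=> [|k]; first exact: differentiable_sqdist.
have -> : (fun z => grad (sqdist y) z 0 k) = (fun z : 'rV[R]_n => 2 * (z 0 k - y 0 k)).
  by apply/funext => z; rewrite grad_sqdist !mxE.
apply: (@continuousM _ _ (cst 2) (fun z : 'rV[R]_n => z 0 k - y 0 k)); first exact: cst_continuous.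
apply: (@continuousB _ _ _ (fun z : 'rV[R]_n => z 0 k) (cst (y 0 k))); last exact: cst_continuous.
exact: coord_continuous.
Qed.

Lemma C1_add (phi psi : 'rV[R]_n -> R) :
  C1_on setT phi -> C1_on setT psi -> C1_on setT (fun x => phi x + psi x).
Proof.
move=> h1 h2 x _; split=> [|k]; first by apply: differentiableD; [apply: (h1 x _).1|apply: (h2 x _).1].
have -> : (fun z => grad (fun x => phi x + psi x) z 0 k) = (fun z => grad phi z 0 k + grad psi z 0 k).
  by apply/funext => z; rewrite grad_additive ?mxE //; [apply: (h1 z _).1|apply: (h2 z _).1].
by apply: continuousD; [exact: (h1 x I).2|exact: (h2 x I).2].
Qed.

Lemma C1_scale (phi : 'rV[R]_n -> R) a :
  C1_on setT phi -> C1_on setT (fun x => a * phi x).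
Proof.
move=> h1 x _; split=> [|k].
  by apply: differentiableM; [exact: differentiable_cst|apply: (h1 x _).1].
have -> : (fun z => grad (fun x => a * phi x) z 0 k) = (fun z => a * grad phi z 0 k).
  by apply/funext => z; rewrite grad_scale ?mxE //; apply: (h1 z _).1.
by apply: (@continuousM _ _ (cst a)); [exact: cst_continuous|exact: (h1 x I).2].
Qed.

End EuclideanNorm.

(** * Relative continuity and first-order expansions *)

Section WithinContinuity.
Variables (R : realType) (n : nat).
Implicit Types (e r : R) (x y z : 'rV[R]_n) (Y : set 'rV[R]_n) (W phi : 'rV[R]_n -> R).

Lemma nbhs_enorm x r : 0 < r -> \forall y \near x, enorm (x - y) < r.
Proof.
move=> r0; have /(_ (x - x)) := @enorm_continuous R n.
rewrite subrr /continuous_at enorm0 => h.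
have h2 : (fun y => enorm (x - y)) @ x --> (0 : R).
  apply: (cvg_comp (fun y => x - y) (@enorm R n) _ h).
  have := @cvgB _ _ _ (nbhs x) _ (cst x) id x x (cvg_cst x) (@cvg_id _ (nbhs x)).
  by rewrite subrr; apply; exact: nbhs_filter.
by move/cvgr_lt: h2 => /(_ _ r0).
Qed.

Lemma nbhs_enormP x (P : set 'rV[R]_n) : nbhs x P ->
  exists2 r, 0 < r & forall y, enorm (x - y) < r -> P y.
Proof.
move=> /nbhs_ballP[r /= r0 h]; exists r => // y hy; apply: h.
by rewrite -ball_normE /=; apply: le_lt_trans hy; exact: norm_le_enorm.
Qed.

Lemma within_enorm Y W x e : {within Y, continuous W} -> Y x -> 0 < e ->
  exists2 r, 0 < r & forall y, Y y -> enorm (x - y) < r -> `|W x - W y| < e.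
Proof.
move=> /subspace_continuousP /(_ x) h Yx e0; have {}h := h Yx.
move/cvgr_dist_lt : h => /(_ _ e0); rewrite /prop_near1 /within /= => /nbhs_enormP[r r0 h].
by exists r => // y Yy hy; apply: h.
Qed.

(** Compactness in its near-covering form yields one radius for all points. *)
Lemma uniform_continuity_compact Y W e : compact Y -> {within Y, continuous W} -> 0 < e ->
  exists2 r, 0 < r & forall x y, Y x -> Y y -> enorm (x - y) < r -> `|W x - W y| < e.
Proof.
move=> /compact_near_coveringP cY cW e0.
pose P (r : R) x := Y x -> forall y, Y y -> enorm (x - y) < r -> `|W x - W y| < e.
have := cY R (at_right 0) P _; case.
  move=> x Yx.
  have [r r0 hr] := within_enorm cW Yx (divr_gt0 e0 (ltr0n R 2)).
  have r2 : 0 < r / 2 by rewrite divr_gt0.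
  exists ([set y | enorm (x - y) < r / 2], [set s | s < r / 2]) => /=.
    by split; [exact: nbhs_enorm|exact: nbhs_right_lt].
  move=> [x' s] /= [hx' hs] Yx' y Yy hy.
  have h1 := hr x' Yx' (lt_trans hx' _).
  have h2 : `|W x - W y| < e / 2.
    apply: hr => //; have := enormD (x - x') (x' - y); rewrite addrA subrK; lra.
  have {}h1 : `|W x - W x'| < e / 2 by apply: h1; lra.
  have := ler_normD (W x' - W x) (W x - W y); rewrite addrA subrK (distrC (W x') (W x)) => h3; apply: le_lt_trans h3 _; lra.
move=> r /= r0 h; exists (r / 2); first by rewrite divr_gt0.
move=> x y Yx Yy hxy; apply: (h (r / 2)) => //=; last by rewrite divr_gt0.
by rewrite sub0r normrN gtr0_norm ?divr_gt0 //; lra.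
Qed.

Definition eball x r : set 'rV[R]_n := [set y | enorm (y - x) <= r].

Lemma closed_eball x r : closed (eball x r).
Proof.
rewrite (_ : eball x r = (fun y => enorm (y - x)) @^-1` [set s | s <= r]) //.
apply: closed_comp; last exact: closed_le.
move=> y _; apply: (@continuous_comp _ _ _ (fun y => y - x) (@enorm R n)).
  by apply: (@continuousB _ _ _ id (cst x)); [move=> ?; exact: cvg_id|exact: cst_continuous].
exact: enorm_continuous.
Qed.

Lemma compact_eball x r : compact (eball x r).
Proof.
apply: bounded_closed_compact; last exact: closed_eball.
exists (r + `|x|); split; first exact: num_real.
move=> s hs y; rewrite /eball /= => hy; apply: le_trans (ltW hs).
have := norm_le_enorm (y - x); have := ler_normD (y - x) x; rewrite subrK; lra.
Qed.

Lemma diff_grad phi x v : differentiable phi x -> 'd phi x v = dot (grad phi x) v.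
Proof.
move=> h; rewrite {1}[v]row_sum_delta linear_sum /dot; apply: eq_bigr => k _.
by rewrite linearZ mxE deriveE //= mulrC.
Qed.

Lemma grad_expansion phi x e : differentiable phi x -> 0 < e ->
  exists2 r, 0 < r & forall y, enorm (y - x) < r ->
    `|phi y - phi x - dot (grad phi x) (y - x)| <= e * enorm (y - x).
Proof.
move=> h e0.
have n0 : 0 < n%:R + 1 :> R by rewrite ltr_wpDl.
have := diff_locally h; move/eqaddoP => /(_ e e0).
rewrite /= near_nbhs => /nbhs_enormP[r r0 hr].
exists r => // y hy; have := hr (y - x); rewrite sub0r enormN => /(_ hy) /=.
rewrite !fctE /= subrK diff_grad // opprD addrA => h2; apply: le_trans h2 _.
by rewrite ler_pM2l // norm_le_enorm.
Qed.

End WithinContinuity.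

(** * Geometry of the jump sets, and the Hamiltonian *)

Section Geometry.
Variables (R : realType) (U V1 : metricType R) (S : hybrid_data U V1).
Hypothesis hS : standing_assumptions S.

Lemma closed_Omega q : closed (Omega S q).
Proof. by have [[T [_ _ ->]] _] := sa_domains hS q; exact: closed_closure. Qed.

Lemma closed_A q : closed (A S q).
Proof. by have [_ [[]]] := sa_domains hS q. Qed.

Lemma closed_C q : closed (C S q).
Proof. by have [_ [[]]] := sa_domains hS q. Qed.

Lemma A_Omega q : A S q `<=` Omega S q.
Proof. by have [_ [[]]] := sa_domains hS q. Qed.

Lemma C_Omega q : C S q `<=` Omega S q.
Proof. by have [_ [[_ _ _ _ []]]] := sa_domains hS q. Qed.

Lemma D_Omega q : D S q `<=` Omega S q.
Proof. by have [_ [[_ _ _ _ []]]] := sa_domains hS q. Qed.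

Lemma Gamma_tgt q x : Gamma S q x -> q = tgt S.
Proof.
have [h _ _ _ _] := sa_target hS; have [//|/h ->//] := eqVneq q (tgt S).
Qed.

Lemma closed_Gamma q : closed (Gamma S q).
Proof.
have [h [h2 _] _ _ _] := sa_target hS.
have [->//|/h ->] := eqVneq q (tgt S); exact: closed0.
Qed.

Lemma Gamma_Omega q : Gamma S q `<=` Omega S q.
Proof.
move=> x Gx; have e := Gamma_tgt Gx; subst q.
by have [h [h1 h2] _ _ _] := sa_target hS; apply: h2.
Qed.

Lemma separation_constant : exists2 b : R, 0 < b &
  [/\ forall q x y, A S q x -> C S q y -> b <= enorm (x - y),
      forall q x y, A S q x -> D S q y -> b <= enorm (x - y),
      forall q x y, Gamma S q x -> D S q y -> b <= enorm (x - y),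
      forall q x y, Gamma S q x -> A S q y -> b <= enorm (x - y)
    & forall q x y, Gamma S q x -> C S q y -> b <= enorm (x - y)].
Proof.
have [b b0 [h1 [h2 h3 h4]]] := sa_separation hS; exists b => //; split.
- by move=> q x y; apply: le_set_dist; apply: (h1 q).1.
- by move=> q x y; apply: le_set_dist; apply: (h1 q).2.
- by move=> q x y Gx; have e := Gamma_tgt Gx; subst q; apply: le_set_dist Gx.
- by move=> q x y Gx; have e := Gamma_tgt Gx; subst q; apply: le_set_dist Gx.
- by move=> q x y Gx; have e := Gamma_tgt Gx; subst q; apply: le_set_dist Gx.
Qed.

Lemma A_C_disjoint q x : A S q x -> C S q x -> False.
Proof.
have [b b0 [h _ _ _ _]] := separation_constant => Ax Cx.
by have := h _ _ _ Ax Cx; rewrite subrr enorm0 leNgt b0.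
Qed.

Lemma Gamma_D_disjoint q x : Gamma S q x -> D S q x -> False.
Proof.
have [b b0 [_ _ h _ _]] := separation_constant => Ax Cx.
by have := h _ _ _ Ax Cx; rewrite subrr enorm0 leNgt b0.
Qed.

Lemma Gamma_A_disjoint q x : Gamma S q x -> A S q x -> False.
Proof.
have [b b0 [_ _ _ h _]] := separation_constant => Ax Cx.
by have := h _ _ _ Ax Cx; rewrite subrr enorm0 leNgt b0.
Qed.

Lemma Gamma_C_disjoint q x : Gamma S q x -> C S q x -> False.
Proof.
have [b b0 [_ _ _ _ h]] := separation_constant => Ax Cx.
by have := h _ _ _ Ax Cx; rewrite subrr enorm0 leNgt b0.
Qed.

Lemma dom_Omega q : dom S q `<=` Omega S q.
Proof.
rewrite [X in _ `<=` X](closure_id _).1; last exact: closed_Omega.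
by apply: closure_subset => y [].
Qed.

Lemma Omega_dom q x : Omega S q x -> ~ Gamma S q x -> dom S q x.
Proof. by move=> h1 h2; apply: subset_closure. Qed.

Lemma D_dom q : D S q `<=` dom S q.
Proof.
by move=> x Dx; apply: Omega_dom; [exact: D_Omega|move=> /Gamma_D_disjoint]; exact.
Qed.

Lemma A_dom q : A S q `<=` dom S q.
Proof.
by move=> x Ax; apply: Omega_dom; [exact: A_Omega|move=> /Gamma_A_disjoint]; exact.
Qed.

Lemma C_dom q : C S q `<=` dom S q.
Proof.
by move=> x Ax; apply: Omega_dom; [exact: C_Omega|move=> /Gamma_C_disjoint]; exact.
Qed.

Lemma closed_dom q : closed (dom S q). Proof. exact: closed_closure. Qed.

(** The boundary of [Omega] is part of [A]. *)
Lemma Omega_interior q x : Omega S q x -> ~ A S q x -> interior (Omega S q) x.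
Proof.
move=> Ox nAx; apply: contrapT => nix; apply: nAx.
have [_ [_ [_ _ h]]] := sa_domains hS q.
have : bdry (A S q) x by apply: h; split=> //; apply: subset_closure.
by case; rewrite -(closure_id (A S q)).1 //; exact: closed_A.
Qed.

Lemma dom_Gamma_bdry q x : dom S q x -> Gamma S q x -> bdry (Gamma S q) x.
Proof.
move=> dx Gx; split; first exact: subset_closure.
by move=> /dx [y [[_ ny] /ny]].
Qed.

Lemma bdry_Gamma_sub q : bdry (Gamma S q) `<=` Gamma S q.
Proof.
by move=> x [+ _]; rewrite -(closure_id (Gamma S q)).1 //; exact: closed_Gamma.
Qed.

(** Near such a point neither test functions nor short flows feel a state
    constraint: the boundary of [Omega] is part of [A], and [A] and the target
    are closed. *)
Lemma free_ball q x : Omega S q x -> ~ A S q x -> ~ Gamma S q x ->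
  exists2 r : R, 0 < r & forall y, enorm (y - x) < r ->
    [/\ Omega S q y, ~ A S q y & ~ Gamma S q y].
Proof.
move=> Ox nAx nGx.
have h1 := Omega_interior Ox nAx.
have h2 : nbhs x (~` A S q) by apply: open_nbhs_nbhs; split=> //; apply: closed_openC; exact: closed_A.
have h3 : nbhs x (~` Gamma S q) by apply: open_nbhs_nbhs; split=> //; apply: closed_openC; exact: closed_Gamma.
have [r r0 h] := nbhs_enormP (filterI h1 (filterI h2 h3)).
by exists r => // y; rewrite enormB => /h [? [? ?]].
Qed.

(** The smoothness of its boundary makes [C] the closure of its interior: a
    small step from a boundary point against the gradient of a defining function
    makes that function negative. *)
Lemma C_interior_dense q x (N : set 'rV[R]_(sdim S q)) : C S q x -> nbhs x N ->
  exists2 y, N y & nbhs y (C S q).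
Proof.
move=> Cx Nx.
have [ix|nix] := pselect (interior (C S q) x).
  by exists x => //; exact: nbhs_singleton.
have [_ [_ [_ hC _]]] := sa_domains hS q.
have [|rho [M [[oM Mx] C2 g0 hM]]] := hC x; first by split=> //; apply: subset_closure.
have Mx' : nbhs x M by exact: open_nbhs_nbhs.
have dr z : M z -> differentiable rho z by move=> /C2.1 [].
set p := grad rho x in g0.
have pp : 0 < enorm p.
  by rewrite lt_def enorm_ge0 andbT; apply: contra g0 => /eqP/enorm_eq0 ->.
have [r r0 hr] := grad_expansion (dr _ Mx) (divr_gt0 pp (ltr0n R 2)).
have [r1 r10 hr1] := nbhs_enormP (filterI Nx Mx').
pose s := Num.min r r1 / (2 * enorm p).
have s0 : 0 < s by rewrite divr_gt0 ?mulr_gt0 // lt_min r0.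
pose y := x - s *: p.
have yx : y - x = - (s *: p) by rewrite /y addrC addKr.
have ny : enorm (y - x) = Num.min r r1 / 2.
  rewrite yx enormN enormZ gtr0_norm // /s; field; lra.
have m0 : 0 < Num.min r r1 by rewrite lt_min r0.
have [mr mr1] : Num.min r r1 <= r /\ Num.min r r1 <= r1 by rewrite !ge_min !lexx orbT.
have [Ny My] : N y /\ M y.
  by apply: hr1; rewrite enormB ny; lra.
exists y => //.
have rx : rho x <= 0 by apply/(hM _ Mx).
have ry : rho y < 0.
  have /hr : enorm (y - x) < r by rewrite ny; lra.
  rewrite ny.
  rewrite yx -/p dotNr dotZr -enorm_sq ler_norml => /andP[_ h].
  have e2 : Num.min r r1 / 2 = s * enorm p by rewrite /s; field; lra.
  move: h; rewrite e2.
  have : 0 < s * enorm p ^+ 2 by rewrite mulr_gt0 // exprn_gt0.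
  by rewrite expr2; nra.
have cy : \forall z \near y, rho z < 0.
  have := @differentiable_continuous _ _ _ _ _ (dr _ My).
  by move/cvgr_lt => /(_ _ ry).
have yM : nbhs y M by apply: open_nbhs_nbhs.
by apply: filterS (filterI cy yM) => z [rz Mz]; apply/(hM _ Mz); exact: ltW.
Qed.

Lemma speed_bound : exists2 F : R, 0 < F & forall i (z : 'rV[R]_(sdim S i)) u, Omega S i z -> enorm (f S i z u) <= F.
Proof.
have [_ _ [F hF]] := sa_vector_fields hS; exists (Num.max F 1).
  by rewrite lt_max ltr01 orbT.
by move=> i z u Oz; apply: le_trans (hF i z u Oz) _; rewrite le_max lexx.
Qed.

Lemma running_cost_bound : exists2 K0 : R, 0 <= K0 & forall i (z : 'rV[R]_(sdim S i)) u, Omega S i z -> `|K S i z u| <= K0.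
Proof.
have [_ _ [K0 hK]] := sa_running_cost hS; exists (Num.max K0 0).
  by rewrite le_max lexx orbT.
by move=> i z u Oz; apply: le_trans (hK i z u Oz) _; rewrite le_max lexx.
Qed.

(** The data being bounded, the supremum in [Ham] is finite and can be exchanged
    for statements about single controls. *)
Lemma Ham_has_sup q (x p : 'rV[R]_(sdim S q)) : Omega S q x ->
  has_sup [set (- K S q x u - dot (f S q x u) p) / lambda S | u in [set: U]].
Proof.
move=> Ox; have [_ [u0 _] _ _] := sa_control_sets hS.
have [_ _ [K0 hK]] := sa_running_cost hS.
have [_ _ [F hF]] := sa_vector_fields hS.
split; first by exists ((- K S q x u0 - dot (f S q x u0) p) / lambda S); exists u0.
exists ((K0 + F * enorm p) / lambda S) => _ [u _ <-].
rewrite ler_pM2r ?invr_gt0 ?(sa_lambda hS) //.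
have := hK q x u Ox; rewrite ler_norml => /andP[h1 _].
have := dot_CauchySchwarz (f S q x u) p; rewrite ler_norml => /andP[h2 _].
have : enorm (f S q x u) * enorm p <= F * enorm p.
  by rewrite ler_wpM2r ?enorm_ge0 // hF.
lra.
Qed.

Lemma Ham_ub q (x p : 'rV[R]_(sdim S q)) w : Omega S q x -> w + Ham x p <= 0 ->
  forall u, lambda S * w <= K S q x u + dot (f S q x u) p.
Proof.
move=> Ox h u; have l0 := sa_lambda hS.
have h2 : (- K S q x u - dot (f S q x u) p) / lambda S <= Ham x p.
  by apply: (sup_upper_bound (Ham_has_sup p Ox)); exists u.
have : (- K S q x u - dot (f S q x u) p) / lambda S <= - w by lra.
by rewrite ler_pdivrMr //; lra.
Qed.

Lemma Ham_approx q (x p : 'rV[R]_(sdim S q)) w (e : R) : Omega S q x -> 0 <= w + Ham x p ->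
  0 < e -> exists u, K S q x u + dot (f S q x u) p <= lambda S * w + e.
Proof.
move=> Ox h e0; have l0 := sa_lambda hS.
have el0 : 0 < e / lambda S by rewrite divr_gt0.
have [_ [u _ <-]] := sup_adherent el0 (Ham_has_sup p Ox).
rewrite -/(Ham x p) ltr_pdivlMr // mulrBl divfK ?gt_eqF // => h2.
exists u; have : 0 <= lambda S * (w + Ham x p) by rewrite mulr_ge0 // ltW.
rewrite mulrDr; nra.
Qed.

Lemma Ham_le q (x p : 'rV[R]_(sdim S q)) w : Omega S q x ->
  (forall u, lambda S * w <= K S q x u + dot (f S q x u) p) -> w + Ham x p <= 0.
Proof.
move=> Ox h; have l0 := sa_lambda hS.
suff : Ham x p <= - w by lra.
apply: ge_sup; first by have [] := Ham_has_sup p Ox.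
by move=> _ [u _ <-]; rewrite ler_pdivrMr //; have := h u; lra.
Qed.

Lemma Ham_ge q (x p : 'rV[R]_(sdim S q)) w : Omega S q x ->
  (forall e : R, 0 < e -> exists u, K S q x u + dot (f S q x u) p <= lambda S * w + e) ->
  0 <= w + Ham x p.
Proof.
move=> Ox h; have l0 := sa_lambda hS.
suff : - w <= Ham x p by lra.
apply/ler_addgt0Pr => e e0.
have [u hu] := h (e * lambda S) (mulr_gt0 e0 l0).
have h2 : (- K S q x u - dot (f S q x u) p) / lambda S <= Ham x p.
  by apply: (sup_upper_bound (Ham_has_sup p Ox)); exists u.
have : - w - e <= (- K S q x u - dot (f S q x u) p) / lambda S.
  by rewrite ler_pdivlMr //; lra.
lra.
Qed.

End Geometry.

(** * Comparison of subsolutions and supersolutions *)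

Section ProductContinuity.
Variables (R : realType) (m n : nat).

Lemma within_cvg (T : topologicalType) (X : set T) (w : T -> R) p :
  {within X, continuous w} -> X p -> w x @[x --> within X (nbhs p)] --> w p.
Proof. by move=> /subspace_continuousP; apply. Qed.

Lemma within_fst (X : set 'rV[R]_m) (Y : set 'rV[R]_n) (w : 'rV[R]_m -> R) :
  {within X, continuous w} -> {within X `*` Y, continuous (fun p => w p.1)}.
Proof.
move=> cw; apply/subspace_continuousP => p [/= Xp Yp].
apply: (@cvg_comp _ _ _ fst w _ (within X (nbhs p.1))); last exact: within_cvg.
move=> N /= hN; have := @cvg_fst _ _ (nbhs p.1) (nbhs p.2) _ _ hN.
move=> h; have {}h := h (nbhs_filter _).
apply: (@filterS _ (nbhs p) _ _ _ _ h) => p' /= {}h [Xp' Yp']; exact: h.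
Qed.

Lemma within_snd (X : set 'rV[R]_m) (Y : set 'rV[R]_n) (w : 'rV[R]_n -> R) :
  {within Y, continuous w} -> {within X `*` Y, continuous (fun p => w p.2)}.
Proof.
move=> cw; apply/subspace_continuousP => p [/= Xp Yp].
apply: (@cvg_comp _ _ _ snd w _ (within Y (nbhs p.2))); last exact: within_cvg.
move=> N /= hN; have := @cvg_snd _ _ (nbhs p.1) (nbhs p.2) _ _ hN.
move=> h; have {}h := h (nbhs_filter _).
apply: (@filterS _ (nbhs p) _ _ _ _ h) => p' /= {}h [Xp' Yp']; exact: h.
Qed.

Lemma continuous_sqdist_pair : continuous (fun p : 'rV[R]_n * 'rV[R]_n => sqdist p.2 p.1).
Proof.
move=> p; rewrite (_ : (fun _ => _) = (fun p => enorm (p.1 - p.2) * enorm (p.1 - p.2))); last first.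
  by apply/funext => p'; rewrite sqdistE expr2.
have h : (fun p : 'rV[R]_n * 'rV[R]_n => enorm (p.1 - p.2)) @ p --> enorm (p.1 - p.2).
  apply: (@cvg_comp _ _ _ (fun p : 'rV[R]_n * 'rV[R]_n => p.1 - p.2) (@enorm R n) _ (nbhs (p.1 - p.2))).
    by apply: cvgB; [exact: cvg_fst|exact: cvg_snd].
  exact: enorm_continuous.
exact: cvgM.
Qed.

End ProductContinuity.

(** How the small parameters of the doubling argument are spent: the variation of
    [K], that of [f] against the penalisation, and the gradient of the
    localisation cost at most [lam * gam / 8] each, while [w] keeps seven eighths
    of [gam]. *)
Lemma doubling_budget (R : realType) (lam gam M0 eta T L LK F del a rho e e0 w : R) :
  let s := lam * gam / 8 in
  0 < lam -> 0 < gam -> gam <= M0 -> 0 < T -> 1 <= L -> 1 <= LK -> 1 <= F ->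
  del = s ^+ 2 / (4 * F ^+ 2 * T) -> eta <= gam / 8 -> eta <= s / (2 * L) ->
  rho <= s / LK -> 0 <= e0 -> e <= rho -> a * e ^+ 2 < eta -> del * e0 ^+ 2 < T ->
  M0 - eta < w ->
  LK * e + L * (2 * a * e ^+ 2) + F * (2 * del * e0) < lam * w.
Proof.
move=> s l0 g0 gM T0 L1 LK1 F1 delE eta1 eta2 hrho e00 erho ae de hw.
have s0 : 0 < s by rewrite divr_gt0 // mulr_gt0.
have L0 : 0 < L by exact: lt_le_trans L1.
have LK0 : 0 < LK by exact: lt_le_trans LK1.
have F0 : 0 < F by exact: lt_le_trans F1.
have del0 : 0 < del by rewrite delE divr_gt0 ?exprn_gt0 // !mulr_gt0 // exprn_gt0.
have e1 : LK * e <= s.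
  by rewrite mulrC -ler_pdivlMr // (le_trans erho).
have e2 : L * (2 * a * e ^+ 2) <= s.
  have h1 : 2 * L * eta <= s by rewrite mulrC -ler_pdivlMr ?mulr_gt0.
  have h2 : L * (a * e ^+ 2) <= L * eta by rewrite ler_pM2l // ltW.
  clear - h1 h2; lra.
have e3 : F * (2 * del * e0) <= s.
  rewrite -(@ler_pXn2r _ 2) ?nnegrE ?(ltW s0) //; last first.
    by rewrite !mulr_ge0 // ltW.
  have -> : (F * (2 * del * e0)) ^+ 2 = 4 * F ^+ 2 * del * (del * e0 ^+ 2) by ring.
  have -> : s ^+ 2 = 4 * F ^+ 2 * del * T.
    by rewrite delE; field; rewrite !gt_eqF.
  rewrite ler_pM2l; first by exact: ltW.
  by rewrite !mulr_gt0 ?exprn_gt0.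
have e4 : lam * (gam - eta) < lam * w.
  by rewrite ltr_pM2l //; apply: le_lt_trans hw; rewrite lerD2r.
have e5 : lam * eta <= lam * (gam / 8) by rewrite ler_pM2l.
rewrite /s in e1 e2 e3 s0; clear - e1 e2 e3 e4 e5 s0; lra.
Qed.

Ltac order_lra := repeat match goal with H : ?P |- _ =>
   lazymatch P with is_true (Order.le _ _) => fail | is_true (Order.lt _ _) => fail
   | _ = _ => fail | standing_assumptions _ => fail | _ => clear H end end; lra.

Section Comparison.
Variables (R : realType) (U V1 : metricType R) (S : hybrid_data U V1).
Hypothesis hS : standing_assumptions S.
Implicit Types (W : forall q, 'rV[R]_(sdim S q) -> R).

Lemma within_continuousB q (Y : set 'rV[R]_q) (W1 W2 : 'rV[R]_q -> R) :
  {within Y, continuous W1} -> continuous W2 ->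
  {within Y, continuous (fun z => W1 z - W2 z)}.
Proof.
move=> c1 c2; have {}c2 : {within Y, continuous W2} by exact: continuous_subspaceT.
by move=> z; have := continuousB (c1 z) (c2 z).
Qed.

Lemma compact_closedI2 q (x0 : 'rV[R]_(sdim S q)) r : compact (dom S q `&` eball x0 r).
Proof.
by rewrite setIC; apply: compact_closedI; [exact: compact_eball|exact: closed_dom].
Qed.

Lemma subsolution_A_le W q x v : viscosity_subsolution (S := S) W -> A S q x ->
  W q x <= W _ (g S q x v) + Ca S q x v.
Proof.
move=> [h _ _] Ax; have := h q x Ax.
have hM : (Mop W x <= (W _ (g S q x v) + Ca S q x v)%:E)%E.
  by apply: ereal_inf_lbound; exists v.
move=> h2; rewrite -lee_fin; apply: le_trans hM; move: h2.
case: (Mop W x) => [r| |] //; last by rewrite leey.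
by rewrite -EFinB !lee_fin; lra.
Qed.

Lemma supersolution_A_ge W q x (e : R) : viscosity_supersolution (S := S) W -> A S q x ->
  0 < e -> exists v, W _ (g S q x v) + Ca S q x v <= W q x + e.
Proof.
move=> [h _ _] Ax e0; have := h q x Ax => h1.
have hM : (Mop W x < (W q x + e)%:E)%E.
  move: h1; case: (Mop W x) => [r| |] //=; last by rewrite ltNyr.
  by rewrite -EFinB !lee_fin lte_fin; lra.
by have [_ [v _ <-]] := ereal_inf_lt hM; rewrite lte_fin => /ltW; exists v.
Qed.

Lemma Nop_le W q x q' x' : D S q' x' -> (@Nop _ _ _ S W q x <= (W q' x' + Cc S q q' x x')%:E)%E.
Proof. by move=> Dx; apply: ereal_inf_lbound; exists q', x'. Qed.

Lemma Nop_ge W q x (e : R) : (0 <= (W q x)%:E - Nop W x)%E -> 0 < e ->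
  exists q' x', D S q' x' /\ W q' x' + Cc S q q' x x' <= W q x + e.
Proof.
move=> h1 e0.
have hM : (Nop W x < (W q x + e)%:E)%E.
  move: h1; case: (Nop W x) => [r| |] //=; last by rewrite ltNyr.
  by rewrite -EFinB !lee_fin lte_fin; lra.
have [_ [q' [x' [Dx ->]]]] := ereal_inf_lt hM.
by rewrite lte_fin => /ltW; exists q', x'.
Qed.

(** The obstacle inequality of a subsolution is only required where a test
    function touches.  Steep paraboloids with vertices in the interior of [C],
    which is dense in [C], touch [W] as close to a given point of [C] as needed;
    the inequality then passes to the limit by continuity. *)
Lemma subsolution_C_le W B q y q' x' :
  viscosity_subsolution (S := S) W -> {within dom S q, continuous (W q)} ->
  (forall x, dom S q x -> `|W q x| <= B) ->
  C S q y -> D S q' x' -> W q y <= W q' x' + Cc S q q' y x'.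
Proof.
move=> sW cW hB Cy Dx'; apply/ler_addgt0Pr => e e0.
have e3 : 0 < e / 2 by rewrite divr_gt0.
have [r1 r10 h1] := within_enorm cW (C_dom hS Cy) e3.
have [_ uC _ _ _] := sa_switching_costs hS.
have [r2 r20 h2] := uC _ e3.
have r0 : 0 < Num.min r1 r2 by rewrite lt_min r10.
have [mr1 mr2] : Num.min r1 r2 <= r1 /\ Num.min r1 r2 <= r2 by rewrite !ge_min !lexx orbT.
have [y0 hy0 ny0] := C_interior_dense hS Cy (nbhs_enorm y r0).
have [r3 r30 h3] := nbhs_enormP ny0.
pose r := Num.min r3 (Num.min r1 r2 - enorm (y - y0)) / 2.
have rp : 0 < r by rewrite divr_gt0 // lt_min r30 subr_gt0.
have [rr3 rr4] : r < r3 /\ r < Num.min r1 r2 - enorm (y - y0).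
  have [] : Num.min r3 (Num.min r1 r2 - enorm (y - y0)) <= r3 /\
    Num.min r3 (Num.min r1 r2 - enorm (y - y0)) <= (Num.min r1 r2 - enorm (y - y0)).
    by rewrite !ge_min !lexx orbT.
  by rewrite /r in rp *; lra.
pose X := eball y0 r.
have XC z : X z -> C S q z.
  by move=> Xz; apply: h3; rewrite enormB; exact: le_lt_trans rr3.
have Xy0 : X y0 by rewrite /X /eball /= subrr enorm0 ltW.
pose a := (2 * B + 1) / r ^+ 2.
have B0 : 0 <= B by apply: le_trans (hB _ (C_dom hS Cy)).
have cF : {within X, continuous (fun z => W q z - a * sqdist y0 z)}.
  apply: within_continuousB; first by apply: continuous_subspaceW cW => z /XC; exact: C_dom.
  by move=> z; apply: differentiable_continuous; exact: (C1_scale a (@C1_sqdist _ _ y0) (x:=z) I).1.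
have [z1 z1X hz1] := EVT_max_rV (ex_intro _ y0 Xy0) (@compact_eball _ _ y0 r) cF.
rewrite inE in z1X.
have z1r : enorm (z1 - y0) < r.
  rewrite lt_def z1X andbT; apply/negP => /eqP e1.
  have := hz1 y0; rewrite inE => /(_ Xy0).
  rewrite !sqdistE subrr enorm0 -e1 /a divfK ?gt_eqF ?exprn_gt0 //.
  rewrite expr0n /= mulr0 subr0.
  have := hB _ (C_dom hS (XC _ z1X)); have := hB _ (C_dom hS (XC _ Xy0)).
  rewrite !ler_norml => /andP[? ?] /andP[? ?]; lra.
have Wz1 : W q z1 <= W q' x' + Cc S q q' z1 x'.
  have [_ _ hs] := sW.
  have [|h _] := hs q (fun z => a * sqdist y0 z) z1 (C1_scale a (@C1_sqdist _ _ y0)) (C_dom hS (XC _ z1X)).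
    have rp1 : 0 < r - enorm (z1 - y0) by rewrite subr_gt0.
    apply: filterS (nbhs_enorm z1 rp1) => z hz _; apply: hz1; rewrite inE.
    rewrite /X /eball /=; have := enormD (z - z1) (z1 - y0); rewrite addrA subrK (enormB z z1).
    by move=> h; apply: le_trans h _; lra.
  have := h (XC _ z1X); rewrite ge_max => /andP[h4 _].
  have h5 : ((W q z1)%:E <= Nop W z1)%E.
    move: h4; case: (Nop W z1) => [s| |] //; last by rewrite leey.
    by rewrite -EFinB !lee_fin; lra.
  by rewrite -lee_fin; apply: le_trans h5 (Nop_le _ _ Dx').
have yz : enorm (y - z1) < Num.min r1 r2.
  have := enormD (y - y0) (y0 - z1); rewrite addrA subrK (enormB y0).
  by move=> h; apply: le_lt_trans h _; lra.
have := h1 z1 (C_dom hS (XC _ z1X)) (lt_le_trans yz mr1).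
have := h2 q q' y z1 x' x' Cy (XC _ z1X) Dx' Dx' (lt_le_trans yz mr2).
rewrite subrr enorm0 => /(_ r20).
rewrite !ltr_norml => /andP[? ?] /andP[? ?]; lra.
Qed.

(** The subsolution is scaled to [mu * W1 - k]: because switching costs at least [c > 0], the scaled
    function satisfies the jump conditions with the slack [(1 - mu) * c], and
    [k] compensates for the effect of the scaling on the running cost. *)
Section Scaled.
Variables (W1 W2 : forall q, 'rV[R]_(sdim S q) -> R) (B : R).
Arguments W1 : clear implicits.
Arguments W2 : clear implicits.
Hypothesis hB1 : forall q x, dom S q x -> `|W1 q x| <= B.
Hypothesis hB2 : forall q x, dom S q x -> `|W2 q x| <= B.
Hypothesis c1 : forall q, {within dom S q, continuous (W1 q)}.
Hypothesis c2 : forall q, {within dom S q, continuous (W2 q)}.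
Hypothesis s1 : viscosity_subsolution (S := S) W1.
Hypothesis s2 : viscosity_supersolution (S := S) W2.
Variables (mu k c K0 : R).
Hypothesis mu01 : 0 < mu < 1.
Hypothesis hk : (1 - mu) * K0 <= lambda S * k.
Hypothesis k0 : 0 <= k.
Hypothesis hCa : forall i x v, A S i x -> c <= Ca S i x v.
Hypothesis hCc : forall i i' x y, C S i x -> D S i' y -> c <= Cc S i i' x y.
Hypothesis hK0 : forall i x u, Omega S i x -> `|K S i x u| <= K0.
Variable M : R.
Let G q x := mu * W1 q x - k - W2 q x.
Hypothesis hM : forall q x, dom S q x -> G x <= M.

(** Jumping from [x] costs at least [c], so the gap after the jump exceeds the gap
    at [x] by [(1 - mu) * c], and it is at most [M]. *)
Lemma gap_A q x : A S q x -> G x <= M - (1 - mu) * c.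
Proof.
move=> Ax; apply/ler_addgt0Pr => e e0.
have [v hv] := supersolution_A_ge s2 Ax e0.
have hw := subsolution_A_le v s1 Ax.
have [hg _ _] := sa_transition hS.
have := hM (D_dom hS (hg q x v Ax)); have := hCa v Ax.
move/andP: mu01 => [m0 m1]; rewrite /G => h1 h2.
have : mu * W1 q x <= mu * (W1 _ (g S q x v) + Ca S q x v) by rewrite ler_wpM2l // ltW.
have : (1 - mu) * c <= (1 - mu) * Ca S q x v by rewrite ler_wpM2l //; lra.
rewrite mulrDr; lra.
Qed.

(** As on [A]; where the supersolution does not reach its obstacle, no such bound
    holds, but there it satisfies the Hamilton-Jacobi inequality. *)
Lemma gap_C q x : C S q x -> (0 <= (W2 q x)%:E - Nop W2 x)%E -> G x <= M - (1 - mu) * c.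
Proof.
move=> Cx hN; apply/ler_addgt0Pr => e e0.
have [q' [x' [Dx' hv]]] := Nop_ge hN e0.
have hw := subsolution_C_le s1 (@c1 q) (@hB1 q) Cx Dx'.
have := hM (D_dom hS Dx'); have := hCc Cx Dx'.
move/andP: mu01 => [m0 m1]; rewrite /G => h1 h2.
have : mu * W1 q x <= mu * (W1 _ x' + Cc S q q' x x') by rewrite ler_wpM2l // ltW.
have : (1 - mu) * c <= (1 - mu) * Cc S q q' x x' by rewrite ler_wpM2l //; lra.
rewrite mulrDr; lra.
Qed.

Lemma gap_Gamma q x : dom S q x -> Gamma S q x -> G x <= 0.
Proof.
move=> dx Gx; have e := Gamma_tgt hS Gx; subst q.
have bx := dom_Gamma_bdry dx Gx.
have [_ h1 _] := s1; have [_ h2 _] := s2.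
have [_ h3] := sa_terminal_cost hS.
have := h1 x bx; have := h2 x bx; have := h3 x Gx.
move/andP: mu01 => [m0 m1] e1 e2 e3; rewrite /G.
have : mu * W1 _ x <= mu * h S _ x by rewrite ler_wpM2l // ltW.
have : 0 <= (1 - mu) * h S _ x by rewrite mulr_ge0 //; lra.
rewrite mulrBl mul1r => e4 e5; move: (k0); lra.
Qed.

(** The Hamilton-Jacobi inequalities at [x] and [y], evaluated at one and the same
    control and subtracted: the penalisation has the same gradient on both sides,
    so it only contributes through the Lipschitz variation of [f]. *)
Lemma doubling_inequality (a del L LK F : R) q (x y x0 : 'rV[R]_(sdim S q)) :
  (forall i x x' u, Omega S i x -> Omega S i x' ->
     enorm (f S i x u - f S i x' u) <= L * enorm (x - x')) ->
  (forall i x x' u, Omega S i x -> Omega S i x' ->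
     `|K S i x u - K S i x' u| <= LK * enorm (x - x')) ->
  (forall i x u, Omega S i x -> enorm (f S i x u) <= F) ->
  0 < a -> 0 < del ->
  dom S q x -> dom S q y ->
  ~ A S q x -> ~ Gamma S q x -> ~ A S q y -> ~ Gamma S q y ->
  (C S q y -> ~ (0 <= (W2 q y)%:E - Nop W2 y)%E) ->
  (\forall z \near x, dom S q z ->
     mu * W1 q z - a * sqdist y z - del * sqdist x0 z <=
     mu * W1 q x - a * sqdist y x - del * sqdist x0 x) ->
  (\forall z \near y, dom S q z ->
     W2 q y + a * sqdist x y <= W2 q z + a * sqdist x z) ->
  lambda S * (mu * W1 q x - k - W2 q y) <=
    LK * enorm (x - y) + L * (2 * a * enorm (x - y) ^+ 2) + F * (2 * del * enorm (x - x0)).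
Proof.
move=> hL hLK hF a0 del0 dx dy nAx nGx nAy nGy nCy mx my.
have [m0 m1] := andP mu01.
have Ox := dom_Omega hS dx; have Oy := dom_Omega hS dy.
have C1a z b := C1_scale b (@C1_sqdist R (sdim S q) z).
pose phi1 z := a / mu * sqdist y z + del / mu * sqdist x0 z.
have g1 : grad phi1 x = mu^-1 *: (2 * a *: (x - y) + 2 * del *: (x - x0)).
  rewrite grad_additive ?grad_scale ?grad_sqdist; try exact: differentiable_sqdist.
  - by apply/rowP => i; rewrite !mxE; field; rewrite gt_eqF.
  - exact: (C1a y (a / mu) x I).1.
  - exact: (C1a x0 (del / mu) x I).1.
have h1 u : lambda S * W1 q x <= K S q x u + dot (f S q x u) (grad phi1 x).
  apply: (Ham_ub hS Ox).
  have [_ _ hs] := s1.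
  have [|hC hO] := hs q phi1 x (C1_add (C1a y (a / mu)) (C1a x0 (del / mu))) dx.
    apply: filterS mx => z hz /hz {}hz.
    have e z' : mu * phi1 z' = a * sqdist y z' + del * sqdist x0 z'.
      by rewrite /phi1; field; rewrite gt_eqF.
    by rewrite -(ler_pM2l m0) !mulrBr !e; lra.
  have [Cx|nCx] := pselect (C S q x).
    by have := hC Cx; rewrite ge_max => /andP[_]; rewrite lee_fin.
  by apply: hO; split=> // -[[]|].
pose phi2 z := - a * sqdist x z.
have g2 : grad phi2 y = 2 * a *: (x - y).
  rewrite grad_scale ?grad_sqdist; last exact: differentiable_sqdist.
  by rewrite scalerA -[x - y]opprB scalerN -scaleNr; congr (_ *: _); ring.
have h2 : 0 <= W2 q y + Ham y (grad phi2 y).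
  have [_ _ hs] := s2.
  have [|hC hO] := hs q phi2 y (C1a x (- a)) dy.
    by apply: filterS my => z hz /hz {}hz; rewrite /phi2 !mulNr !opprK.
  have [Cy|ny] := pselect (C S q y).
    have := hC Cy; rewrite le_max => /orP[h|]; last by rewrite lee_fin.
    by have := nCy Cy h.
  by apply: hO; split=> // -[[]|].
apply/ler_addgt0Pr => e e0.
have [u hu] := Ham_approx hS Oy h2 e0.
have {}h1 := h1 u.
have mh : lambda S * (mu * W1 q x) <= mu * K S q x u + dot (f S q x u) (2 * a *: (x - y) + 2 * del *: (x - x0)).
  have : mu * (lambda S * W1 q x) <= mu * (K S q x u + dot (f S q x u) (grad phi1 x)).
    by rewrite ler_wpM2l // ltW.
  rewrite g1 dotZr mulrDr (mulrA mu mu^-1) divff ?gt_eqF // mul1r; lra.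
have hKx : mu * K S q x u - lambda S * k <= K S q x u.
  have := hK0 u Ox; rewrite ler_norml => /andP[? _].
  have : (1 - mu) * (- K0) <= (1 - mu) * K S q x u by rewrite ler_wpM2l //; lra.
  by move: hk; lra.
have hKxy : K S q x u - K S q y u <= LK * enorm (x - y).
  exact: le_trans (ler_norm _) (hLK q x y u Ox Oy).
have hf : dot (f S q x u - f S q y u) (2 * a *: (x - y)) <= L * (2 * a * enorm (x - y) ^+ 2).
  apply: le_trans (dot_le _ _) _; rewrite enormZ gtr0_norm; last by rewrite mulr_gt0.
  have : enorm (f S q x u - f S q y u) * (2 * a * enorm (x - y)) <=
     L * enorm (x - y) * (2 * a * enorm (x - y)).
    by rewrite ler_wpM2r ?hL // !mulr_ge0 ?enorm_ge0 // ltW.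
  by rewrite expr2; lra.
have hd : dot (f S q x u) (2 * del *: (x - x0)) <= F * (2 * del * enorm (x - x0)).
  apply: le_trans (dot_le _ _) _; rewrite enormZ gtr0_norm; last by rewrite mulr_gt0.
  by rewrite ler_wpM2r ?hF // !mulr_ge0 ?enorm_ge0 // ltW.
move: hu; rewrite g2 => hu.
move: mh hf; rewrite dotDr dotDl dotNl; lra.
Qed.

End Scaled.

(** A positive supremum of the scaled gap is impossible.  The doubled functional
    is maximised over a compact set around an approximate maximum point [x0] of
    the gap.  Comparing its maximum with the value at [(x, x)] gives
    [a * |x - y|^2 <= W2 x - W2 y], which uniform continuity makes small for a
    fixed large [a]: no limit in [a] is taken.  At [x] and [y] the gap is within
    [(1 - mu) * c] of its supremum, so that neither point admits a jump, and
    [doubling_inequality] contradicts the positivity of the supremum. *)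
Lemma scaled_gap (W1 W2 : forall q, 'rV[R]_(sdim S q) -> R) (B mu k c K0 M gam : R)
  (G := fun q x => mu * @W1 q x - k - @W2 q x) :
  (forall q x, dom S q x -> `|@W1 q x| <= B) ->
  (forall q x, dom S q x -> `|@W2 q x| <= B) ->
  (forall q, {within dom S q, continuous (@W1 q)}) ->
  (forall q, {within dom S q, continuous (@W2 q)}) ->
  viscosity_subsolution (S := S) W1 -> viscosity_supersolution (S := S) W2 ->
  0 < mu < 1 -> (1 - mu) * K0 <= lambda S * k -> 0 <= k ->
  (forall i x v, A S i x -> c <= Ca S i x v) ->
  (forall i i' x y, C S i x -> D S i' y -> c <= Cc S i i' x y) ->
  (forall i x u, Omega S i x -> `|K S i x u| <= K0) ->
  (forall q x, dom S q x -> G q x <= M) ->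
  0 < c -> 0 < gam ->
  (exists q x, dom S q x /\ gam <= G q x) ->
  (forall e : R, 0 < e -> exists q x, dom S q x /\ M - e < G q x) -> False.
Proof.
move=> hB1 hB2 c1 c2 s1 s2 mu01 hk k0 hCa hCc hK0 hM c0 gam0 [q1 [x1 [dx1 gx1]]] hsup.
have [m0 m1] := andP mu01.
have Mg : gam <= M by apply: le_trans gx1 (hM _ _ dx1).
have l0 := sa_lambda hS.
have [[L0 hL0] _ [F0 hF0]] := sa_vector_fields hS.
have [[LK0 hLK0] _ _] := sa_running_cost hS.
pose L := Num.max L0 1; pose LK := Num.max LK0 1; pose F := Num.max F0 1.
have L1 : 1 <= L by rewrite le_max lexx orbT.
have LK1 : 1 <= LK by rewrite le_max lexx orbT.
have F1 : 1 <= F by rewrite le_max lexx orbT.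
have hL i (x x' : 'rV[R]_(sdim S i)) u : Omega S i x -> Omega S i x' ->
    enorm (f S i x u - f S i x' u) <= L * enorm (x - x').
  move=> Ox Ox'; apply: le_trans (hL0 i x x' u Ox Ox') _.
  by rewrite ler_wpM2r ?enorm_ge0 // le_max lexx.
have hLK i (x x' : 'rV[R]_(sdim S i)) u : Omega S i x -> Omega S i x' ->
    `|K S i x u - K S i x' u| <= LK * enorm (x - x').
  move=> Ox Ox'; apply: le_trans (hLK0 i x x' u Ox Ox') _.
  by rewrite ler_wpM2r ?enorm_ge0 // le_max lexx.
have hF i (x : 'rV[R]_(sdim S i)) u : Omega S i x -> enorm (f S i x u) <= F.
  by move=> Ox; apply: le_trans (hF0 i x u Ox) _; rewrite le_max lexx.
have B0 : 0 <= B by apply: le_trans (hB1 _ _ dx1).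
pose T := 2 * B + 1.
have T0 : 0 < T by rewrite /T; order_lra.
pose s := lambda S * gam / 8.
have s0 : 0 < s by rewrite /s; nra.
(* where the localisation is below [T], its gradient is below [2 * sqrt (del * T)] *)
pose del := s ^+ 2 / (4 * F ^+ 2 * T).
have del0 : 0 < del.
  by rewrite divr_gt0 ?exprn_gt0 // mulr_gt0 // mulr_gt0 // exprn_gt0 //; order_lra.
pose eta := Num.min (Num.min (gam / 8) ((1 - mu) * c / 8)) (s / (2 * L)).
have [eta0 eta1 eta2 eta3] : [/\ 0 < eta, eta <= gam / 8, eta <= (1 - mu) * c / 8 & eta <= s / (2 * L)].
  split; rewrite /eta ?ge_min ?lexx ?orbT //.
  rewrite !lt_min !divr_gt0 ?mulr_gt0 //; order_lra.
have [q [x0 [dx0 gx0]]] := hsup eta eta0.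
have hU z z' : dom S q z -> dom S q z' -> mu * @W1 q z - k - @W2 q z' < T.
  move=> /hB1 + /hB2; rewrite !ler_norml => /andP[? ?] /andP[? ?].
  have : mu * @W1 q z <= mu * B by rewrite ler_wpM2l // ltW.
  have : mu * B <= 1 * B by rewrite ler_wpM2r // ltW.
  move: k0; rewrite /T; order_lra.
pose r := Num.sqrt (T / del).
have Tdel : 0 <= T / del by rewrite divr_ge0 // ltW.
have r2 : del * r ^+ 2 = T by rewrite (sqr_sqrtr Tdel) mulrC divfK // gt_eqF.
have r0 : 0 <= r by exact: sqrtr_ge0.
pose X := dom S q `&` eball x0 r.
pose Y := dom S q `&` eball x0 (r + 1).
have cX : compact X by apply: compact_closedI2.
have cY : compact Y by apply: compact_closedI2.
have XY : X `<=` Y by move=> z [? h]; split=> //; apply: le_trans h _; order_lra.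
have Xx0 : X x0 by split=> //; rewrite /eball /= subrr enorm0.
have [rho1 rho10 u2] := uniform_continuity_compact cY (continuous_subspaceW (@subIsetl _ _ _) (@c2 q)) eta0.
have [rho2 rho20 u1] := uniform_continuity_compact cY (continuous_subspaceW (@subIsetl _ _ _) (@c1 q)) eta0.
pose rho := Num.min (Num.min rho1 rho2) (Num.min 1 (s / LK)).
have [rho0 h1 h2 h3 h4] : [/\ 0 < rho, rho <= rho1, rho <= rho2, rho <= 1 & rho <= s / LK].
  split; rewrite /rho ?ge_min ?lexx ?orbT //.
  rewrite !lt_min rho10 rho20 divr_gt0 ?ltr01 //; order_lra.
(* [a * |x - y|^2 < T] forces [|x - y| < rho] *)
pose a := T / rho ^+ 2.
have a0 : 0 < a by rewrite divr_gt0 ?exprn_gt0.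
pose Phi (p : 'rV[R]_(sdim S q) * 'rV[R]_(sdim S q)) :=
  mu * @W1 q p.1 - k - @W2 q p.2 - a * sqdist p.2 p.1 - del * sqdist x0 p.1.
have cPhi : {within X `*` Y, continuous Phi}.
  have W1X := continuous_subspaceW (@subIsetl _ _ _ : X `<=` _) (@c1 q).
  have W2Y := continuous_subspaceW (@subIsetl _ _ _ : Y `<=` _) (@c2 q).
  apply/subspace_continuousP => p XYp; set Fp := within _ _.
  have h1' := within_cvg (@within_fst _ _ _ X Y _ W1X) XYp.
  have h2' := within_cvg (@within_snd _ _ _ X Y _ W2Y) XYp.
  apply: cvgB; first apply: cvgB; first apply: cvgB; first apply: cvgB; first apply: cvgM => //.
  - exact: cvg_cst.
  - exact: cvg_cst.
  - exact: h2'.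
  - apply: cvgM; first exact: cvg_cst.
    apply: cvg_trans (@continuous_sqdist_pair R (sdim S q) p).
    by apply: cvg_app; exact: cvg_within.
  - apply: cvgM; first exact: cvg_cst.
    apply: (cvg_trans _ (differentiable_continuous (differentiable_sqdist x0 p.1))).
    apply: cvg_trans (cvg_app (sqdist x0) (@cvg_fst _ _ (nbhs p.1) (nbhs p.2) _)).
    by apply: (cvg_app (fun p' => sqdist x0 p'.1)); exact: cvg_within.
have [|[x y] Kxy hmax] := compact_EVT_max _ (compact_setX cX cY) cPhi.
  by exists (x0, x0); split=> //=; exact: XY.
rewrite inE in Kxy; have [/= Xx Yy] := Kxy.
have {}hmax z z' : X z -> Y z' -> Phi (z, z') <= Phi (x, y).
  by move=> ? ?; apply: hmax; rewrite inE.
have dx : dom S q x by case: Xx.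
have dy : dom S q y by case: Yy.
have b1 : M - eta < Phi (x, y).
  have := hmax _ _ Xx0 (XY _ Xx0); rewrite /Phi /= !sqdistE subrr enorm0 expr0n /= !mulr0 !subr0.
  by apply: lt_le_trans.
have sq1 : 0 <= a * sqdist y x by rewrite sqdistE mulr_ge0 ?sqr_ge0 // ltW.
have sq2 : 0 <= del * sqdist x0 x by rewrite sqdistE mulr_ge0 ?sqr_ge0 // ltW.
have b2 : a * sqdist y x + del * sqdist x0 x < T.
  by have := hU x y dx dy; move: b1; rewrite /Phi /=; order_lra.
have xy : enorm (x - y) < rho.
  have : a * sqdist y x < T by order_lra.
  rewrite sqdistE /a mulrAC ltr_pdivrMr ?exprn_gt0 // ltr_pM2l //.
  by rewrite ltr_pXn2r ?nnegrE ?enorm_ge0 // ltW.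
have xx0 : enorm (x - x0) < r.
  have : del * sqdist x0 x < del * r ^+ 2 by rewrite r2; order_lra.
  by rewrite sqdistE ltr_pM2l // ltr_pXn2r ?nnegrE ?enorm_ge0.
have yx0 : enorm (y - x0) < r + 1.
  have := enormD (y - x) (x - x0); rewrite addrA subrK (enormB y x) => h.
  by apply: le_lt_trans h _; order_lra.
have w2 := u2 x y (XY _ Xx) Yy (lt_le_trans xy h1).
have w1 := u1 x y (XY _ Xx) Yy (lt_le_trans xy h2).
have b3 : a * sqdist y x < eta.
  have := hmax x x Xx (XY _ Xx); rewrite /Phi /= (sqdistE x x) subrr enorm0 expr0n /= mulr0.
  by move: w2; rewrite ltr_norml => /andP[_ ?]; order_lra.
have gx : M - 2 * eta < G q x.
  by move: b1 w2; rewrite /Phi /G /= ltr_norml => ? /andP[? ?]; order_lra.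
have gy : M - 2 * eta < G q y.
  have : mu * (@W1 q x - @W1 q y) < eta.
    move: w1; rewrite ltr_norml => /andP[? w1'].
    have [w10|w10] := lerP 0 (@W1 q x - @W1 q y); last first.
      by apply: lt_trans eta0; rewrite pmulr_rlt0.
    apply: le_lt_trans w1'; rewrite ler_piMl // ltW //.
  by move: b1; rewrite /Phi /G /= mulrBr; order_lra.
have nj : M - (1 - mu) * c < M - 2 * eta.
  have : 0 < (1 - mu) * c by rewrite mulr_gt0 //; order_lra.
  order_lra.
have gA z : A S q z -> G q z <= M - (1 - mu) * c.
  by move=> Az; apply: (gap_A s1 s2 mu01 hCa hM Az).
have gG z : dom S q z -> Gamma S q z -> G q z <= 0.
  by move=> dz Gz; apply: (gap_Gamma s1 s2 mu01 k0 dz Gz).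
have gC z : C S q z -> (0 <= (@W2 q z)%:E - Nop W2 z)%E -> G q z <= M - (1 - mu) * c.
  by move=> Cz hz; apply: (gap_C (@hB1) (@c1) s1 mu01 hCc hM Cz hz).
have nAx : ~ A S q x by move=> /gA h; order_lra.
have nAy : ~ A S q y by move=> /gA h; order_lra.
have nGx : ~ Gamma S q x by move=> /(gG _ dx) h; order_lra.
have nGy : ~ Gamma S q y by move=> /(gG _ dy) h; order_lra.
have nCy : C S q y -> ~ (0 <= (@W2 q y)%:E - Nop W2 y)%E.
  by move=> Cy /(gC _ Cy) h; order_lra.
have mx : \forall z \near x, dom S q z ->
     mu * @W1 q z - a * sqdist y z - del * sqdist x0 z <=
     mu * @W1 q x - a * sqdist y x - del * sqdist x0 x.
  have rp : 0 < r - enorm (x - x0) by rewrite subr_gt0.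
  apply: filterS (nbhs_enorm x rp) => z hz dz.
  have Xz : X z.
    split=> //; rewrite /eball /=.
    have := enormD (z - x) (x - x0); rewrite addrA subrK (enormB z x) => h.
    by apply: le_trans h _; order_lra.
  by have := hmax z y Xz Yy; rewrite /Phi /=; order_lra.
have my : \forall z \near y, dom S q z ->
     @W2 q y + a * sqdist x y <= @W2 q z + a * sqdist x z.
  have rp : 0 < r + 1 - enorm (y - x0) by rewrite subr_gt0.
  apply: filterS (nbhs_enorm y rp) => z hz dz.
  have Yz : Y z.
    split=> //; rewrite /eball /=.
    have := enormD (z - y) (y - x0); rewrite addrA subrK (enormB z y) => h.
    by apply: le_trans h _; order_lra.
  have := hmax x z Xx Yz; rewrite /Phi /=.
  by rewrite !sqdistE !(enormB x); order_lra.
have := doubling_inequality s1 s2 mu01 hk hK0 hL hLK hF a0 del0 dx dy nAx nGx nAy nGy nCy mx my.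
rewrite leNgt => /negP; apply; rewrite !sqdistE in sq1 sq2 b2 b3.
apply: (@doubling_budget _ (lambda S) gam M eta T L LK F del a rho).
all: rewrite ?enorm_ge0 ?(ltW xy) //.
  by order_lra.
by move: b1; rewrite /Phi /= !sqdistE => b1; order_lra.
Qed.

(** If [W1] exceeded [W2] somewhere, the scaled gap would have a positive supremum
    for [mu] close to 1, which [scaled_gap] excludes. *)
Lemma comparison (W1 W2 : forall q, 'rV[R]_(sdim S q) -> R) (B : R) :
  (forall q x, dom S q x -> `|@W1 q x| <= B) ->
  (forall q x, dom S q x -> `|@W2 q x| <= B) ->
  (forall q, {within dom S q, continuous (@W1 q)}) ->
  (forall q, {within dom S q, continuous (@W2 q)}) ->
  viscosity_subsolution (S := S) W1 -> viscosity_supersolution (S := S) W2 ->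
  forall q x, dom S q x -> @W1 q x <= @W2 q x.
Proof.
move=> hB1 hB2 c1 c2 s1 s2 q x dx; rewrite leNgt; apply/negP => lt12.
have l0 := sa_lambda hS.
have [_ _ [c c0 [hCa hCc]] _ _] := sa_switching_costs hS.
have [K1 K10 hK1] := running_cost_bound hS.
have B0 : 0 <= B by apply: le_trans (hB1 _ _ dx).
pose g0 := @W1 q x - @W2 q x.
have g00 : 0 < g0 by rewrite subr_gt0.
pose b := B + K1 / lambda S.
have b0 : 0 <= b by rewrite addr_ge0 // divr_ge0 // ltW.
(* [th = 1 - mu] is small enough for the scaled gap to keep half of [g0] *)
pose th := g0 / (2 * (b + g0)).
have th0 : 0 < th by rewrite divr_gt0 // mulr_gt0 //; order_lra.
have thE : th * b + th * g0 = g0 / 2 by rewrite /th; field; rewrite gt_eqF //; order_lra.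
have tb : 0 <= th * b by rewrite mulr_ge0 // ltW.
have th1 : th < 1.
  by rewrite -(ltr_pM2r g00) mul1r; order_lra.
pose k := th * K1 / lambda S.
have k0 : 0 <= k by apply: divr_ge0; [apply: mulr_ge0 => //; exact: ltW|exact: ltW].
pose G q x := (1 - th) * @W1 q x - k - @W2 q x.
have mu01 : 0 < 1 - th < 1 by apply/andP; split; order_lra.
have hk : (1 - (1 - th)) * K1 <= lambda S * k.
  suff -> : lambda S * k = (1 - (1 - th)) * K1 by [].
  by rewrite /k; field; rewrite gt_eqF.
have gG : g0 / 2 <= G q x.
  have e1 : th * @W1 q x <= th * B.
    by rewrite ler_pM2l // (le_trans (ler_norm _)) // hB1.
  have e2 : th * b = th * B + k by rewrite /b /k mulrDr mulrA.
  have e3 : G q x = g0 - th * @W1 q x - k by rewrite /G /g0; ring.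
  have e4 : 0 <= th * g0 by rewrite mulr_ge0 // ltW.
  by rewrite e3; order_lra.
pose E := [set r | exists q x, dom S q x /\ r = G q x].
have hE : has_sup E.
  split; first by exists (G q x); exists q, x.
  exists (B + B) => _ [p [z [dz ->]]].
  have := hB1 _ _ dz; have := hB2 _ _ dz; rewrite !ler_norml => /andP[h1 h2] /andP[h3 h4].
  have e1 : (1 - th) * @W1 p z <= (1 - th) * B by rewrite ler_wpM2l //; order_lra.
  have e2 : 0 <= th * B by rewrite mulr_ge0 // ltW.
  by rewrite /G; rewrite mulrBl mul1r in e1 *; order_lra.
apply: (@scaled_gap W1 W2 B (1 - th) k c K1 (sup E) (g0 / 2)) => //.
- by move=> p z dz; apply: (sup_upper_bound hE); exists p, z.
- by rewrite divr_gt0.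
- by exists q, x.
- move=> e e0; have [_ [p [z [dz ->]]] hz] := sup_adherent e0 hE.
  by exists p, z.
Qed.

End Comparison.

(** * Integrals over intervals *)

Section LebesgueR.
Variable R : realType.
Notation mu := (@lebesgue_measure R).
Notation RM := (measurableTypeR R).
Implicit Types (f g : R -> R) (a b t : R).

Lemma measurable_shift t (D : set RM) : measurable_fun D ((fun s : R => s + t) : RM -> RM).
Proof. by apply: measurable_funTS; apply: measurable_funD. Qed.

Lemma measurable_shift_set t (A : set RM) : measurable A ->
  measurable ((fun s : R => s + t) @^-1` A).
Proof.
by move=> mA; rewrite -[X in measurable X]setTI; apply: measurable_shift.
Qed.

(** The shifted measure gives the same length to intervals. *)
Lemma lebesgue_measure_shift t (A : set RM) : measurable A ->
  mu ((fun s : R => s + t) @^-1` A) = mu A.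
Proof.
move=> mA.
pose phi_mixin := isMeasurableFun.Build _ _ RM RM _ (@measurable_shift t setT).
pose phi : {mfun RM >-> RM} := HB.pack ((fun s : R => s + t) : RM -> RM) phi_mixin.
apply/esym.
apply: (@lebesgue_measure_unique R (pushforward mu phi)) => // X [[a b] /= _ <-].
rewrite /pushforward /= [RHS](_ : _ = mu `]a - t, b - t]%classic).
  rewrite !lebesgue_measure_itv /= !lte_fin ltrD2r; case: ifP => // _.
  by rewrite -!EFinB; congr (_%:E); ring.
by congr (mu _); apply/seteqP; split => x /=; rewrite !in_itv /= ltrBlDr lerBrDr.
Qed.

Lemma ge0_integral_shift t (D : set RM) (G : RM -> \bar R) : measurable D ->
  measurable_fun D G -> (forall s, D s -> (0 <= G s)%E) ->
  (\int[mu]_(s in (fun r : R => (r + t)%R) @^-1` D) G (s + t)%R = \int[mu]_(s in D) G s)%E.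
Proof.
move=> mD mG G0.
have := @ge0_integral_pushforward _ _ (measurableTypeR R) (measurableTypeR R) R _
  (@measurable_shift t setT) mu D G mD mG.
move=> <-; last by move=> s; rewrite inE; exact: G0.
apply: eq_measure_integral; first exact: (@measurable_shift t setT).
by move=> mphi B mB _; exact: (lebesgue_measure_shift t mB).
Qed.

Lemma integral_shift t (D : set RM) (G : RM -> \bar R) : measurable D ->
  measurable_fun D G ->
  (\int[mu]_(s in (fun r : R => (r + t)%R) @^-1` D) G (s + t)%R = \int[mu]_(s in D) G s)%E.
Proof.
move=> mD mG; rewrite integralE [RHS]integralE; congr (_ - _)%E.
  rewrite -(@ge0_integral_shift t D) //; first by apply: eq_integral => s _; rewrite !funeposE.
  exact: measurable_funepos.
rewrite -(@ge0_integral_shift t D) //; first by apply: eq_integral => s _; rewrite !funenegE.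
exact: measurable_funeneg.
Qed.

Lemma measurable_fun_shift t (D : set RM) d' (T : measurableType d') (G : RM -> T) :
  measurable D -> measurable_fun D G ->
  measurable_fun ((fun r : R => r + t) @^-1` D) (fun s => G (s + t)).
Proof.
move=> mD mG; apply: (@measurable_comp _ _ _ _ _ _ D _ _ ((fun s : R => s + t) : RM -> RM)) => //.
- by move=> _ [s + <-].
- exact: measurable_shift.
Qed.

Lemma integrable_shift t (D : set RM) (G : RM -> \bar R) : measurable D ->
  mu.-integrable D G ->
  mu.-integrable ((fun s : R => s + t) @^-1` D) (fun s => G (s + t)).
Proof.
move=> mD /integrableP[mG iG]; apply/integrableP; split.
  exact: (@measurable_fun_shift t D _ _ G).
rewrite (@ge0_integral_shift t D (fun s => `|G s|%E)) //.
exact: measurableT_comp.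
Qed.

Lemma continuous_integrable a b f : continuous f -> mu.-integrable `[a, b] (EFin \o f).
Proof.
move=> cf; apply: continuous_compact_integrable; first exact: segment_compact.
exact: continuous_subspaceT.
Qed.

Lemma Rintegral_chasles f a b t : a <= t -> t <= b -> mu.-integrable `[a, b] (EFin \o f) ->
  \int[mu]_(s in `[a, b]) f s = \int[mu]_(s in `[a, t]) f s + \int[mu]_(s in `[t, b]) f s.
Proof.
move=> hat htb hi.
have := @Rintegral_itvB R f (BLeft a) (BRight b) t hi; rewrite !bnd_simp => /(_ hat htb).
rewrite Rintegral_itv_obnd_cbnd; last first.
  apply: integrableS hi => //; apply: subset_itv; rewrite ?bnd_simp //.
lra.
Qed.

Lemma Rintegral_bound f a b (F : R) : a <= b -> mu.-integrable `[a, b] (EFin \o f) ->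
  (forall s, a <= s <= b -> f s <= F) -> \int[mu]_(s in `[a, b]) f s <= F * (b - a).
Proof.
move=> ab hi hF.
have -> : F * (b - a) = \int[mu]_(s in `[a, b]) F.
  by rewrite Rintegral_cst //= lebesgue_measure_itv /= lte_fin; case: ltgtP ab => // ->; rewrite subrr.
apply: le_Rintegral => //.
  by apply: (@continuous_integrable a b (cst F)) => ?; exact: cst_continuous.
Qed.

Lemma Rintegral_ge_bound f a b (F : R) : a <= b -> mu.-integrable `[a, b] (EFin \o f) ->
  (forall s, a <= s <= b -> F <= f s) -> F * (b - a) <= \int[mu]_(s in `[a, b]) f s.
Proof.
move=> ab hi hF.
have -> : F * (b - a) = \int[mu]_(s in `[a, b]) F.
  by rewrite Rintegral_cst //= lebesgue_measure_itv /= lte_fin; case: ltgtP ab => // ->; rewrite subrr.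
apply: le_Rintegral => //.
  by apply: (@continuous_integrable a b (cst F)) => ?; exact: cst_continuous.
Qed.

Lemma Rintegral_norm_bound f a b (F : R) : a <= b -> mu.-integrable `[a, b] (EFin \o f) ->
  (forall s, a <= s <= b -> `|f s| <= F) -> `|\int[mu]_(s in `[a, b]) f s| <= F * (b - a).
Proof.
move=> ab hi hF; rewrite ler_norml; apply/andP; split.
  rewrite -mulNr; apply: Rintegral_ge_bound => // s /hF; rewrite ler_norml => /andP[] //.
by apply: Rintegral_bound => // s /hF; rewrite ler_norml => /andP[].
Qed.

Lemma integrable_sum_dot n (v : R -> 'rV[R]_n) (w : 'rV[R]_n) a b :
  (forall k, mu.-integrable `[a, b] (EFin \o (fun s => v s 0 k))) ->
  mu.-integrable `[a, b] (EFin \o (fun s => dot (v s) w)) /\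
  \int[mu]_(s in `[a, b]) dot (v s) w = \sum_k (\int[mu]_(s in `[a, b]) v s 0 k) * w 0 k.
Proof.
move=> hi.
have hk k : mu.-integrable `[a, b] (EFin \o (fun s => v s 0 k * w 0 k)).
  have -> : EFin \o (fun s => v s 0 k * w 0 k) = (fun s => (w 0 k)%:E * (v s 0 k)%:E)%E.
    by apply/funext => s /=; rewrite mulrC.
  by apply: integrableZl => //; exact: hi.
rewrite /dot; elim: (index_enum _) => [|k l [h1 h2]].
  have -> : (fun s => \sum_(k <- [::]) v s 0 k * w 0 k) = cst 0.
    by apply/funext => s; rewrite big_nil.
  rewrite big_nil; split; last by rewrite Rintegral_cst // mul0r.
  by apply: (@continuous_integrable a b (cst 0)) => ?; exact: cst_continuous.
have -> : (fun s => \sum_(j <- k :: l) v s 0 j * w 0 j) =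
    (fun s => v s 0 k * w 0 k + \sum_(j <- l) v s 0 j * w 0 j).
  by apply/funext => s; rewrite big_cons.
split; first by have := integrableD _ (hk k) h1; apply.
by rewrite RintegralD // big_cons h2 RintegralZr.
Qed.

(** Triangle inequality for the Euclidean norm, by testing the integral against
    itself. *)
Lemma enorm_integral_le n (v : R -> 'rV[R]_n) (F : R) a b (z : 'rV[R]_n) : a <= b ->
  (forall k, mu.-integrable `[a, b] (EFin \o (fun s => v s 0 k))) ->
  (forall s, a <= s <= b -> enorm (v s) <= F) ->
  (forall k, z 0 k = \int[mu]_(s in `[a, b]) v s 0 k) -> enorm z <= F * (b - a).
Proof.
move=> ab hi hF hz; have [h1 h2] := integrable_sum_dot z hi.
have F0 : 0 <= F by apply: le_trans (hF a _); rewrite ?enorm_ge0 ?lexx.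
have [->|z0] := eqVneq (enorm z) 0; first by rewrite mulr_ge0 // subr_ge0.
have zp : 0 < enorm z by rewrite lt_def z0 enorm_ge0.
rewrite -(ler_pM2r zp) -expr2 enorm_sq.
have -> : dot z z = \int[mu]_(s in `[a, b]) dot (v s) z.
  by rewrite h2 /dot; apply: eq_bigr => k _; rewrite -hz.
rewrite mulrAC; apply: Rintegral_bound => // s /hF hs.
by apply: le_trans (dot_le _ _) _; rewrite ler_wpM2r // ltW.
Qed.

Lemma continuous_expRM c : continuous (fun s : R => expR (c * s)).
Proof.
move=> s; apply: (@continuous_comp _ _ _ (fun s => c * s) expR); last exact: continuous_expR.
by apply: (@continuousM _ _ (cst c) id); [exact: cst_continuous|move=> ?; exact: cvg_id].
Qed.

Lemma is_derive_expRM c (s : R) : is_derive s (1 : R) (fun s : R => expR (c * s)) (c * expR (c * s)).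
Proof.
have h : is_derive s (1 : R) (fun s : R => c * s) c.
  by apply: is_derive_eq (is_deriveZ c (is_derive_id s (1:R))) _; rewrite /GRing.scale /= mulr1.
by apply: is_derive_eq; rewrite mulrC.
Qed.

Lemma Rintegral_expR (c t : R) : 0 < c -> 0 <= t ->
  \int[mu]_(s in `[0, t]) expR (c * s) <= expR (c * t) / c.
Proof.
move=> c0; rewrite le_eqVlt => /orP[/eqP <-|t0].
  by rewrite set_itv1 Rintegral_set1 mulr0 expR0 divr_ge0 // ltW.
have ce := continuous_expRM (c := c).
rewrite /Rintegral (@continuous_FTC2 _ _ (fun s => c^-1 * expR (c * s)) 0 t) //.
- rewrite -EFinB /= mulr0 expR0 mulrC mulr1 lerBlDr lerDl invr_ge0 ltW //.
- exact: continuous_subspaceT.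
- split.
  + by move=> s _; apply: derivableM => //; exact: ex_derive.
  + apply: cvg_at_right_filter; apply: cvgM; [exact: cvg_cst|exact: ce].
  + apply: cvg_at_left_filter; apply: cvgM; [exact: cvg_cst|exact: ce].
- move=> s _; rewrite derive1E.
  have h3 := is_deriveZ c^-1 (is_derive_expRM c s).
  rewrite (_ : (fun _ => _) = c^-1 \*: (fun s : R => expR (c * s))) // derive_val.
  by rewrite /GRing.scale /= mulrA mulVf ?mul1r // gt_eqF.
Qed.

End LebesgueR.

(** * Flows of Lipschitz fields *)

Section Picard.
Variables (R : realType) (n : nat) (b : 'rV[R]_n -> 'rV[R]_n) (L F : R) (x : 'rV[R]_n).
Notation mu := (@lebesgue_measure R).
Hypothesis L0 : 0 < L.
Hypothesis F0 : 0 <= F.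
Hypothesis bLip : forall z w k, `|b z 0 k - b w 0 k| <= L * `|z - w|.
Hypothesis bF : forall z k, `|b z 0 k| <= F.

Lemma continuous_field (y : R -> 'rV[R]_n) k : continuous y -> continuous (fun s => b (y s) 0 k).
Proof.
move=> cy s; apply/cvgrPdist_lt => e e0.
have eL : 0 < e / L by rewrite divr_gt0.
have := cy s; move/cvgr_dist_lt => /(_ _ eL); apply: filterS => r hr.
by apply: le_lt_trans (bLip _ _ _) _; rewrite mulrC -ltr_pdivlMr.
Qed.

Definition picard_step (y : R -> 'rV[R]_n) (t : R) : 'rV[R]_n :=
  \row_k (x 0 k + \int[mu]_(s in `[0, t]) b (y s) 0 k).

Lemma lipschitz_continuous (y : R -> 'rV[R]_n) (c : R) : 0 <= c ->
  (forall s t, s <= t -> `|y t - y s| <= c * (t - s)) -> continuous y.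
Proof.
move=> c0 h s; apply/cvgrPdist_lt => e e0.
have c1 : 0 < c + 1 by rewrite ltr_wpDl.
have := @cvg_id _ (nbhs s); move/cvgr_dist_lt => /(_ _ (divr_gt0 e0 c1)).
apply: filterS => t; rewrite ltr_pdivlMr // => hst.
apply: le_lt_trans hst.
have [st|ts] := leP s t.
  by rewrite distrC (le_trans (h _ _ st)) // distrC ger0_norm ?subr_ge0 // mulrC ler_wpM2l ?subr_ge0 // lerDl.
have st0 : 0 <= s - t by rewrite subr_ge0 ltW.
by rewrite (le_trans (h _ _ (ltW ts))) // ger0_norm // mulrC ler_wpM2l // lerDl.
Qed.

Lemma Rintegral_itv_lt0 (g : R -> R) t : t < 0 -> \int[mu]_(s in `[0, t]) g s = 0.
Proof. by move=> t0; rewrite set_itv_ge ?Rintegral_set0 // bnd_simp -ltNge. Qed.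

Lemma picard_step_lipschitz (y : R -> 'rV[R]_n) s t : continuous y -> s <= t ->
  `|picard_step y t - picard_step y s| <= F * (t - s).
Proof.
move=> cy st; apply: norm_le_coord => [|k]; first by rewrite mulr_ge0 // subr_ge0.
rewrite !mxE opprD addrACA subrr add0r.
have hi r r' : mu.-integrable `[r, r'] (EFin \o (fun s => b (y s) 0 k)).
  by apply: continuous_integrable; exact: continuous_field.
have [t0|t0] := ltP t 0.
  by rewrite !Rintegral_itv_lt0 ?subr0 ?normr0 ?mulr_ge0 ?subr_ge0 // (le_lt_trans st).
have [s0|s0] := ltP s 0.
  rewrite (Rintegral_itv_lt0 _ s0) subr0.
  apply: le_trans (Rintegral_norm_bound t0 (hi _ _) (fun r _ => bF (y r) k)) _.
  by rewrite ler_wpM2l // lerB // ltW.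
rewrite (Rintegral_chasles s0 st) // addrAC subrr add0r.
exact: Rintegral_norm_bound.
Qed.

Fixpoint picard m : R -> 'rV[R]_n :=
  if m is m'.+1 then picard_step (picard m') else cst x.

Lemma picard_continuous m : continuous (picard m).
Proof.
elim: m => [|m IH]; first exact: cst_continuous.
by apply: (@lipschitz_continuous _ F) => // s t st; apply: picard_step_lipschitz.
Qed.

Lemma picard_lipschitz m s t : s <= t -> `|picard m t - picard m s| <= F * (t - s).
Proof.
case: m => [|m] st; first by rewrite subrr normr0 mulr_ge0 // subr_ge0.
by apply: picard_step_lipschitz => //; exact: picard_continuous.
Qed.

Let w t := F / (2 * L) * expR (2 * L * t).

(** In the weight [exp (2 * L * t)] the integral operator contracts by one half on
    the whole half-line, whence solutions for all times at once. *)
Lemma picard_step_diff (y z : R -> 'rV[R]_n) (c t : R) : continuous y -> continuous z -> 0 <= c ->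
  0 <= t -> (forall s, 0 <= s <= t -> `|y s - z s| <= c * expR (2 * L * s)) ->
  `|picard_step y t - picard_step z t| <= c / 2 * expR (2 * L * t).
Proof.
move=> cy cz c0 t0 h; apply: norm_le_coord => [|k].
  by rewrite mulr_ge0 ?expR_ge0 // divr_ge0.
rewrite !mxE opprD addrACA subrr add0r.
have hi u : continuous u -> mu.-integrable `[0, t] (EFin \o (fun s => b (u s) 0 k)).
  by move=> cu; apply: continuous_integrable; exact: continuous_field.
rewrite -RintegralB; [|by []|exact: hi|exact: hi].
have cg : continuous (fun s => b (y s) 0 k - b (z s) 0 k).
  by move=> s; apply: cvgB; exact: continuous_field.
have ce1 := @continuous_expRM R (2 * L).
have ce : continuous (fun s => L * c * expR (2 * L * s)).
  by move=> s; apply: cvgM; [exact: cvg_cst|exact: ce1].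
have cng : continuous (fun s => `|b (y s) 0 k - b (z s) 0 k|).
  by move=> s; apply: cvg_norm; exact: cg.
apply: le_trans (le_normr_Rintegral _ _) _ => //; first exact: continuous_integrable.
apply: (@le_trans _ _ (\int[mu]_(s in `[0, t]) (L * c * expR (2 * L * s)))).
  apply: le_Rintegral => //; try exact: continuous_integrable.
  move=> s /=; rewrite in_itv /= => hs; apply: le_trans (bLip _ _ _) _.
  by rewrite -mulrA ler_pM2l // h.
rewrite RintegralZl //; last exact: continuous_integrable.
have L2 : 0 < 2 * L by rewrite mulr_gt0.
have := Rintegral_expR L2 t0; rewrite ler_pdivlMr // => h2.
set I := Rintegral _ _ _ in h2 *.
have -> : L * c * I = c / 2 * (I * (2 * L)) by field.
by rewrite ler_wpM2l // divr_ge0.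
Qed.

(** The first step is at most [F * t <= w t]; each further one gains a factor one
    half. *)
Lemma picard_diff m t : 0 <= t -> `|picard m.+1 t - picard m t| <= w t / 2 ^+ m.
Proof.
have L2 : 0 < 2 * L by rewrite mulr_gt0.
elim: m t => [|m IH] t t0.
  rewrite expr0 divr1 /= /w.
  have := @picard_lipschitz 1 0 t t0; rewrite subr0.
  have -> : picard 1 0 = x.
    by apply/rowP => k; rewrite mxE set_itv1 Rintegral_set1 addr0.
  move=> h; apply: le_trans h _.
  rewrite -mulrA ler_wpM2l // mulrC ler_pdivlMr // mulrC.
  apply: le_trans (expR_ge1Dx _); lra.
have -> : w t / 2 ^+ m.+1 = F / (2 * L) / 2 ^+ m / 2 * expR (2 * L * t).
  by rewrite /w exprS; field; rewrite !gt_eqF // exprn_gt0.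
change (`|picard_step (picard m.+1) t - picard_step (picard m) t| <= F / (2 * L) / 2 ^+ m / 2 * expR (2 * L * t)).
apply: (@picard_step_diff (picard m.+1) (picard m) _ t); [exact: picard_continuous|exact: picard_continuous| |exact: t0|].
  by apply: divr_ge0; [apply: divr_ge0 => //; exact: ltW|exact: exprn_ge0].
move=> s /andP[s0 _]; apply: le_trans (IH s s0) _.
by rewrite /w mulrAC.
Qed.

Lemma picard_cauchy m j t : 0 <= t ->
  `|picard (m + j)%N t - picard m t| <= 2 * w t / 2 ^+ m * (1 - (2 ^+ j)^-1).
Proof.
move=> t0; elim: j => [|j IH].
  by rewrite addn0 subrr normr0 expr0 invr1 subrr mulr0.
have := picard_diff (m + j) t0; rewrite addnS => h.
have -> : picard (m + j).+1 t - picard m t = (picard (m + j).+1 t - picard (m + j)%N t) + (picard (m + j)%N t - picard m t).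
  by rewrite addrA subrK.
apply: le_trans (ler_normD _ _) _; apply: le_trans (lerD h IH) _.
rewrite exprD exprS le_eqVlt; apply/orP; left; apply/eqP; field.
by rewrite !gt_eqF // exprn_gt0.
Qed.

Lemma half_power_small (a e : R) : 0 < e -> exists m, a / 2 ^+ m < e.
Proof.
move=> e0.
have : (fun m => a / 2 ^+ m) @ \oo --> (0 : R).
  have -> : (fun m => a / 2 ^+ m) = geometric a (2^-1).
    by apply/funext => m; rewrite /geometric /= exprVn.
  by apply: cvg_geometric; rewrite ger0_norm // invf_lt1 // ltr1n.
by move=> /cvgr_lt /(_ _ e0) [m _ hm]; exists m; exact: (hm m (leqnn m)).
Qed.

(** The successive approximations differ by at most a geometric factor times
    the weight [exp (2 L t)], so they converge locally uniformly. *)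
Lemma picard_exists : exists y : R -> 'rV[R]_n,
  [/\ continuous y, y 0 = x &
   forall t k, 0 <= t -> y t 0 k = x 0 k + \int[mu]_(s in `[0, t]) b (y s) 0 k].
Proof.
have w0 t : 0 <= w t by rewrite mulr_ge0 ?expR_ge0 // divr_ge0 // mulr_ge0 // ltW.
have bnd m j t : 0 <= t -> (m <= j)%N -> `|picard j t - picard m t| <= 2 * w t / 2 ^+ m.
  move=> t0 mj; have := @picard_cauchy m (j - m) t t0; rewrite subnKC // => h.
  apply: le_trans h _; apply: ler_piMr.
    by apply: divr_ge0; [exact: mulr_ge0|exact: exprn_ge0].
  by rewrite lerBlDr lerDl invr_ge0 exprn_ge0.
have hc t : 0 <= t -> forall k, (fun m => picard m t 0 k) @ \oo --> limn (fun m => picard m t 0 k).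
  move=> t0 k; suff : cvgn (fun m => picard m t 0 k) by [].
  apply/cauchy_cvgP; apply: cauchy_exP => e e0.
  have [m hm] := half_power_small (2 * w t) e0.
  exists (picard m t 0 k); exists m => // j /= mj.
  rewrite -ball_normE /= distrC.
  have := coord_le_norm (picard j t - picard m t) k; rewrite !mxE => h2.
  by apply: le_lt_trans h2 _; apply: le_lt_trans hm; exact: bnd.
pose y t : 'rV[R]_n := \row_k limn (fun m => picard m (Num.max t 0) 0 k).
have yE t : 0 <= t -> y t = \row_k limn (fun m => picard m t 0 k).
  by move=> t0; rewrite /y (max_idPl t0).
have yp m t : 0 <= t -> `|picard m t - y t| <= 2 * w t / 2 ^+ m.
  move=> t0; apply: norm_le_coord => [|k].
    by apply: divr_ge0; [exact: mulr_ge0|exact: exprn_ge0].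
  apply/ler_addgt0Pr => e e0.
  have := hc t t0 k; move=> /cvgr_dist_lt /(_ _ e0) [j _ hj].
  have h1 := hj (maxn j m) (leq_maxl _ _).
  have h2 := bnd m (maxn j m) t t0 (leq_maxr _ _).
  have h3 := le_trans (coord_le_norm (picard (maxn j m) t - picard m t) k) h2.
  rewrite yE // !mxE in h3 *; rewrite distrC /= in h1.
  rewrite distrC.
  have -> : limn (fun m0 => picard m0 t 0 k) - picard m t 0 k =
    (limn (fun m0 => picard m0 t 0 k) - picard (maxn j m) t 0 k) + (picard (maxn j m) t 0 k - picard m t 0 k).
    by rewrite addrA subrK.
  apply: le_trans (ler_normD _ _) _; rewrite addrC; apply: lerD => //.
  by rewrite distrC ltW.
have ylip s t : s <= t -> `|y t - y s| <= F * (t - s).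
  move=> st; set t' := Num.max t 0; set s' := Num.max s 0.
  have [t'0 s'0] : 0 <= t' /\ 0 <= s' by rewrite !le_max !lexx !orbT.
  have -> : y t = y t' by rewrite /y /t' (max_idPl t'0).
  have -> : y s = y s' by rewrite /y /s' (max_idPl s'0).
  have st' : s' <= t' by rewrite /s' /t' ge_max !le_max st lexx !orbT.
  have dst : t' - s' <= t - s.
    rewrite /t' /s'; have [s0|s0] := lerP 0 s.
      by rewrite (max_idPl (le_trans s0 st)).
    by rewrite subr0; have [t0|t0] := lerP 0 t; lra.
  apply: le_trans (_ : _ <= F * (t' - s')) _; last by rewrite ler_wpM2l.
  apply/ler_addgt0Pr => e e0.
  have [m hm] := half_power_small (2 * w t' + 2 * w s') e0.
  have := picard_lipschitz m st' => h1.
  have h2 := yp m t' t'0; have h3 := yp m s' s'0.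
  have -> : y t' - y s' = (y t' - picard m t') + (picard m t' - picard m s') + (picard m s' - y s').
    by rewrite !addrA !subrK.
  apply: le_trans (ler_normD _ _) _; apply: le_trans (lerD (ler_normD _ _) (lexx _)) _.
  rewrite (distrC (y t')) addrAC; rewrite mulrDl in hm; lra.
have cy : continuous y by exact: (lipschitz_continuous F0).
have y0 : y 0 = x.
  rewrite yE //; apply/rowP => k; rewrite mxE.
  have -> : (fun m => picard m 0 0 k) = cst (x 0 k).
    apply/funext => -[|m] //=; by rewrite mxE set_itv1 Rintegral_set1 addr0.
  exact: lim_cst.
exists y; split => // t k t0.
suff : picard_step y t = y t by move=> <-; rewrite mxE.
apply/eqP; rewrite -subr_eq0 -normr_eq0 eq_le normr_ge0 andbT.
apply/ler_addgt0Pr => e e0; rewrite add0r.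
have [m hm] := half_power_small (2 * w t) e0.
have h1 : `|picard m.+1 t - picard_step y t| <= 2 * (F / (2 * L)) / 2 ^+ m / 2 * expR (2 * L * t).
  apply: picard_step_diff => //; first exact: picard_continuous.
    apply: divr_ge0; last exact: exprn_ge0.
    by apply: mulr_ge0 => //; apply: divr_ge0 => //; apply: mulr_ge0 => //; exact: ltW.
  move=> s /andP[s0 _]; apply: le_trans (yp m s s0) _.
  by rewrite le_eqVlt; apply/orP; left; apply/eqP; rewrite /w; ring.
have h2 := yp m.+1 t t0.
apply: le_trans (ltW hm).
have -> : picard_step y t - y t = (picard m.+1 t - y t) - (picard m.+1 t - picard_step y t).
  by rewrite opprB [RHS]addrC addrA subrK.
apply: le_trans (ler_normB _ _) _; apply: le_trans (lerD h2 h1) _.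
rewrite le_eqVlt; apply/orP; left; apply/eqP; rewrite /w exprS; field.
by rewrite !gt_eqF // exprn_gt0.
Qed.

End Picard.

(** McShane extension, coordinate by coordinate; the truncation at [2 * F]
    keeps the extension bounded. *)
Lemma lipschitz_extension (R : realType) n (Om : set 'rV[R]_n) (b0 : 'rV[R]_n -> 'rV[R]_n) (L F : R) :
  Om !=set0 -> 0 <= L -> 0 <= F ->
  (forall z w, Om z -> Om w -> enorm (b0 z - b0 w) <= L * enorm (z - w)) ->
  (forall z, Om z -> enorm (b0 z) <= F) ->
  exists b : 'rV[R]_n -> 'rV[R]_n, [/\ forall z, Om z -> b z = b0 z,
    forall z w k, `|b z 0 k - b w 0 k| <= L * enorm (z - w)
  & forall z k, `|b z 0 k| <= 3 * F].
Proof.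
move=> [w0 Ow0] L0 F0 hL hF.
pose E k (z : 'rV[R]_n) := [set b0 w 0 k + Num.min (L * enorm (z - w)) (2 * F) | w in Om].
have cF z k : Om z -> - F <= b0 z 0 k <= F.
  by move=> Oz; rewrite -ler_norml (le_trans (coord_le_enorm _ _)) // hF.
have m0 (z w : 'rV[R]_n) : 0 <= Num.min (L * enorm (z - w)) (2 * F).
  by rewrite le_min !mulr_ge0 ?enorm_ge0.
have lbE k z : lbound (E k z) (- F).
  by move=> _ [w Ow <-]; have := cF w k Ow => /andP[? _]; have := m0 z w; lra.
have hlb k z : has_lbound (E k z) by exists (- F); exact: lbE.
have ne k z : E k z !=set0 by exists (b0 w0 0 k + Num.min (L * enorm (z - w0)) (2 * F)); exists w0.
have half k z z' : inf (E k z) <= inf (E k z') + L * enorm (z - z').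
  rewrite -lerBlDr; apply: lb_le_inf => // _ [w Ow <-].
  rewrite lerBlDr; apply: (le_trans (ge_inf (hlb k z) (ex_intro2 _ _ w Ow erefl))).
  rewrite -addrA lerD2l.
  have h : L * enorm (z - w) <= L * enorm (z' - w) + L * enorm (z - z').
    rewrite -mulrDr ler_wpM2l //; have := enormD (z - z') (z' - w); rewrite addrA subrK; lra.
  have h0 : 0 <= L * enorm (z - z') by rewrite mulr_ge0 // enorm_ge0.
  rewrite ge_min; have [hm|hm] := lerP (L * enorm (z' - w)) (2 * F).
    by rewrite h.
  by rewrite lerDl h0 orbT.
exists (fun z => \row_k inf (E k z)); split.
- move=> z Oz; apply/rowP => k; rewrite mxE; apply/eqP; rewrite eq_le; apply/andP; split.
    apply: (le_trans (ge_inf (hlb k z) (ex_intro2 _ _ z Oz erefl))).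
    by rewrite gerDl subrr enorm0 mulr0 ge_min lexx.
  apply: lb_le_inf => // _ [w Ow <-].
  rewrite -lerBlDl le_min; apply/andP; split.
    apply: le_trans (hL z w Oz Ow); apply: le_trans (ler_norm _) _.
    by have := coord_le_enorm (b0 z - b0 w) k; rewrite !mxE.
  have /andP[_ h1] := cF z k Oz; have /andP[h2 _] := cF w k Ow; lra.
- move=> z w k; rewrite !mxE ler_norml; apply/andP; split.
    by have := half k w z; rewrite (enormB w z); lra.
  by have := half k z w; lra.
- move=> z k; rewrite mxE ler_norml; apply/andP; split.
    by apply: (@le_trans _ _ (- F)); [lra|apply: lb_le_inf].
  apply: (le_trans (ge_inf (hlb k z) (ex_intro2 _ _ w0 Ow0 erefl))).
  have /andP[_ h1] := cF w0 k Ow0.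
  have : Num.min (L * enorm (z - w0)) (2 * F) <= 2 * F by rewrite ge_min lexx orbT.
  lra.
Qed.

Section Flow.
Variables (R : realType) (U V1 : metricType R) (S : hybrid_data U V1).
Hypothesis hS : standing_assumptions S.
Notation mu := (@lebesgue_measure R).

(** The field is extended off [Omega] to get a global flow, which solves the
    original equation as long as it stays in [Omega]. *)
Lemma flow_exists q (x : 'rV[R]_(sdim S q)) u : Omega S q x ->
  exists y : R -> 'rV[R]_(sdim S q), [/\ continuous y, y 0 = x &
    forall t, 0 <= t -> (forall s, 0 <= s <= t -> Omega S q (y s)) ->
    forall k, mu.-integrable `[0, t] (EFin \o (fun s => f S q (y s) u 0 k)) /\
      y t 0 k = x 0 k + \int[mu]_(s in `[0, t]) f S q (y s) u 0 k].
Proof.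
move=> Ox; have [[L hL] _ [F hF]] := sa_vector_fields hS.
pose L1 := Num.max L 0; pose F1 := Num.max F 0.
have L10 : 0 <= L1 by rewrite le_max lexx orbT.
have F10 : 0 <= F1 by rewrite le_max lexx orbT.
have [|z w Oz Ow|z Oz|b [bE bL bF]] := @lipschitz_extension R _ (Omega S q) (fun z => f S q z u) L1 F1 _ L10 F10.
- by exists x.
- by apply: le_trans (hL q z w u Oz Ow) _; rewrite ler_wpM2r ?enorm_ge0 // le_max lexx.
- by apply: le_trans (hF q z u Oz) _; rewrite le_max lexx.
pose L2 := L1 * (sdim S q)%:R + 1.
have L20 : 0 < L2 by rewrite ltr_wpDl // mulr_ge0.
have bL2 z w k : `|b z 0 k - b w 0 k| <= L2 * `|z - w|.
  apply: le_trans (bL z w k) _.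
  apply: (@le_trans _ _ (L1 * ((sdim S q)%:R * `|z - w|))).
    by rewrite ler_wpM2l // enorm_le_norm.
  by rewrite mulrA ler_wpM2r // lerDl.
have F30 : 0 <= 3 * F1 by rewrite mulr_ge0.
have [y [cy y0 hy]] := picard_exists x L20 F30 bL2 bF.
exists y; split => // t t0 hO k.
have e : {in `[0, t], (fun s => b (y s) 0 k) =1 (fun s => f S q (y s) u 0 k)}.
  by move=> s; rewrite in_itv /= => hs; rewrite bE //; exact: hO.
split.
  have h : mu.-integrable `[0, t] (EFin \o (fun s => b (y s) 0 k)).
    by apply: continuous_integrable; exact: (continuous_field L20 bL2).
  apply: eq_integrable h => // s; rewrite inE /= => hs; congr (_%:E); exact: e.
rewrite hy //; congr (_ + _); apply: eq_Rintegral => s; rewrite inE /= => hs; exact: e.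
Qed.

End Flow.

(** * Discounted running costs *)

Section MeasurableDiagonal.
Variable R : realType.
Implicit Types (g : R -> R -> R) (D : set R).

Lemma measurable_fun_gt D (w : R -> R) : measurable D ->
  (forall c, measurable (D `&` [set s | c < w s])) -> measurable_fun D w.
Proof.
move=> mD h; apply/measurable_EFinP.
move=> _; apply: (measurability _ (ErealGenOInfty.measurableE R)).
move=> /= _ [_ [a ->]] <-.
have -> : D `&` (EFin \o w) @^-1` `]a%:E, +oo[ = D `&` [set s | a < w s].
  by apply/seteqP; split => s [Ds] /=; rewrite in_itv /= andbT lte_fin.
exact: h.
exact: mD.
Qed.

(** [g s s] is the supremum over rational [r] of [g r s - M * |s - r|].  This
    applies to the running cost rate, with [g r s] the rate at the position of
    time [r] under the control of time [s]: the control is only measurable, but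
    the position is Lipschitz in time. *)
Lemma measurable_diagonal g D (M : R) : measurable D ->
  (forall s, D s -> exists2 a, a < s & forall r, a < r -> r <= s -> D r) ->
  (forall r, D r -> measurable_fun D (g r)) ->
  (forall r r' s, D r -> D r' -> D s -> `|g r s - g r' s| <= M * `|r - r'|) ->
  measurable_fun D (fun s => g s s).
Proof.
move=> mD hD hg hM; apply: measurable_fun_gt => // c.
have -> : D `&` [set s | c < g s s] = \bigcup_(q : rat)
   (D `&` [set s | D (ratr q) /\ c < g (ratr q) s - M * `|s - ratr q|]).
  apply/seteqP; split=> [s [Ds /= cs]|s [q _ [Ds /= [Dq cq]]]].
    have [a as_ ha] := hD s Ds.
    have M1 : 0 < `|M| + 1 by rewrite ltr_wpDl.
    pose b := Num.max a (s - (g s s - c) / (2 * (`|M| + 1))).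
    have bs : b < s.
      by rewrite /b gt_max as_ ltrBlDr ltrDl divr_gt0 ?mulr_gt0 // subr_gt0.
    have [q] := rat_in_itvoo bs; rewrite in_itv /= => /andP[bq qs].
    move: bq; rewrite /b gt_max => /andP[aq]; rewrite ltrBlDr -ltrBlDl ltr_pdivlMr ?mulr_gt0 // => hq.
    have Dq : D (ratr q) by apply: ha => //; exact: ltW.
    exists q => //; split=> //=; split => //.
    have := hM _ _ _ Ds Dq Ds; rewrite ler_norml => /andP[_ h1].
    have h2 : 0 < s - ratr q by rewrite subr_gt0.
    rewrite ger0_norm in h1 *; try exact: ltW.
    have h3 : M * (s - ratr q) <= `|M| * (s - ratr q) by rewrite ler_wpM2r ?ler_norm // ltW.
    clear - h1 h2 h3 hq; nra.
  split => //=; have := hM _ _ _ Ds Dq Ds; rewrite ler_norml => /andP[h1 _]; lra.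
apply: bigcupT_measurable_rat => q.
have [Dq|nDq] := pselect (D (ratr q)); last first.
  by rewrite (_ : _ `&` _ = set0) //; apply/seteqP; split => // s [_ []].
have -> : D `&` [set s | D (ratr q) /\ c < g (ratr q) s - M * `|s - ratr q|] =
   D `&` (fun s => g (ratr q) s - M * `|s - ratr q|) @^-1` `]c, +oo[.
  by apply/seteqP; split => s [Ds] /=; rewrite in_itv /= andbT => // -[].
have mh : measurable_fun D (fun s => g (ratr q) s - M * `|s - ratr q|).
  apply: measurable_funB; first exact: hg.
  apply: measurable_funM => //; apply: measurableT_comp => //.
  exact: measurable_funB.
exact: mh.
Qed.

End MeasurableDiagonal.

Section Discount.
Variables (R : realType) (lam : R).
Hypothesis l0 : 0 < lam.
Notation mu := (@lebesgue_measure R).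

Lemma integral_discount : (\int[mu]_(s in `[0%R, +oo[) (expR (- lam * s))%:E = (lam^-1)%:E)%E.
Proof.
rewrite (@ge0_continuous_FTC2y _ _ (fun s => - lam^-1 * expR (- lam * s)) 0 0) //.
- by rewrite -EFinB mulr0 expR0 mulr1 opprK add0r.
- exact: continuous_subspaceT (@continuous_expRM R (- lam)).
- rewrite -[X in _ --> X](mulr0 (- lam^-1)); apply: cvgM; first exact: cvg_cst.
  rewrite (_ : (fun s : R => expR (- lam * s)) = (fun z => expR (- z)) \o (fun s => lam * s)); last first.
    by apply: eq_fun => s; rewrite mulNr.
  apply: (@cvg_comp _ _ _ _ _ _ (pinfty_nbhs R)); last exact: cvgr_expR.
  exact: gt0_cvgMry.
- by apply: cvg_at_right_filter; apply: cvgM; [exact: cvg_cst|exact: continuous_expRM].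
- move=> s _; rewrite derive1E.
  have h3 := is_deriveZ (- lam^-1) (is_derive_expRM (- lam) s).
  rewrite (_ : (fun _ => _) = (- lam^-1) \*: (fun s : R => expR (- lam * s))) // derive_val.
  by rewrite /GRing.scale /= mulrA mulrNN mulVf ?mul1r // gt_eqF.
Qed.

Lemma integrable_discount c : mu.-integrable `[0, +oo[ (EFin \o (fun s => c * expR (- lam * s))).
Proof.
have h : mu.-integrable `[0, +oo[ (EFin \o (fun s => expR (- lam * s))).
  apply/integrableP; split.
    by apply/measurable_EFinP; apply: measurable_funTS; apply: continuous_measurable_fun; exact: continuous_expRM.
  under eq_integral do rewrite /= ger0_norm ?expR_ge0 //.
  by rewrite integral_discount ltry.
have -> : EFin \o (fun s => c * expR (- lam * s)) = (fun s => c%:E * (expR (- lam * s))%:E)%E.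
  by apply/funext => s /=; rewrite EFinM.
by apply: integrableZl => //; exact: h.
Qed.

(** Domination by [c * exp (- lam * s)], whose integral over the half-line is
    [c / lam]. *)
Lemma discounted_integral (D : set R) (w : R -> R) (c : R) : measurable D -> D `<=` [set s | 0 <= s] ->
  0 <= c -> measurable_fun D w -> (forall s, D s -> `|w s| <= c) ->
  mu.-integrable D (EFin \o (fun s => w s * expR (- lam * s))) /\
  (`| \int[mu]_(s in D) (w s * expR (- lam * s))%:E | <= (c / lam)%:E)%E.
Proof.
move=> mD D0 c0 mw hw.
have mwe : measurable_fun D (fun s => w s * expR (- lam * s)).
  apply: measurable_funM => //.
  by apply: measurable_funTS; apply: continuous_measurable_fun; exact: continuous_expRM.
have DD : D `<=` `[0, +oo[ by move=> s /D0; rewrite /= in_itv /= andbT.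
have hi : mu.-integrable D (EFin \o (fun s => c * expR (- lam * s))).
  by apply: integrableS (integrable_discount c).
have hb s : D s -> `|w s * expR (- lam * s)| <= c * expR (- lam * s).
  by move=> Ds; rewrite normrM (ger0_norm (expR_ge0 _)) ler_wpM2r ?expR_ge0 // hw.
have cp s : 0 <= c * expR (- lam * s) by rewrite mulr_ge0 // expR_ge0.
split.
  apply: le_integrable hi => //; first exact/measurable_EFinP.
  by move=> s Ds /=; rewrite lee_fin (ger0_norm (cp s)) hb.
apply: le_trans (le_abse_integral _ _ _) _ => //; first exact/measurable_EFinP.
apply: (@le_trans _ _ (\int[mu]_(s in D) (c * expR (- lam * s))%:E)%E).
  apply: ge0_le_integral => //.
  - by apply: measurableT_comp => //; exact/measurable_EFinP.
  - apply/measurable_EFinP; apply: measurable_funM => //.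
    by apply: measurable_funTS; apply: continuous_measurable_fun; exact: continuous_expRM.
apply: (@le_trans _ _ (\int[mu]_(s in `[0%R, +oo[) (c * expR (- lam * s))%:E)%E).
  apply: ge0_subset_integral => //.
  - apply/measurable_EFinP; apply: measurable_funM => //.
    by apply: measurable_funTS; apply: continuous_measurable_fun; exact: continuous_expRM.
  - by move=> s _; rewrite lee_fin.
under eq_integral do rewrite EFinM.
rewrite ge0_integralZl //.
- by rewrite integral_discount -EFinM.
- apply/measurable_EFinP; apply: measurable_funTS; apply: continuous_measurable_fun; exact: continuous_expRM.
Qed.

End Discount.

(** * Trajectories, their tails and their costs *)

Section Trajectories.
Variables (R : realType) (U V1 : metricType R) (S : hybrid_data U V1).
Hypothesis hS : standing_assumptions S.
Notation mu := (@lebesgue_measure R).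
Implicit Types (th : control S) (e : trajectory S).

Definition sK (s : state S) u : R := K S (projT1 s) (projT2 s) u.
Definition sCa (s : state S) v : R := Ca S (projT1 s) (projT2 s) v.
Definition sCc (s s' : state S) : R := Cc S (projT1 s) (projT1 s') (projT2 s) (projT2 s').
Definition sh (s : state S) : R := h S (projT1 s) (projT2 s).

Definition arcst e n t : state S := mkstate (tr_arc e n t).
Definition state_at e t : state S := mkstate (pos_at e t).

Lemma state_atE e t : state_at e t = arcst e (phase_at e t) t.
Proof. by []. Qed.

Definition timeline e : Prop :=
  [/\ tr_time e 0 = 0%E, forall n, (tr_time e n <= tr_time e n.+1)%E
    & forall M : R, exists n, (M%:E < tr_time e n)%E].

Section Timeline.
Variable e : trajectory S.
Hypothesis tl : timeline e.

Lemma time_mono n m : (n <= m)%N -> (tr_time e n <= tr_time e m)%E.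
Proof.
have [_ h _] := tl; move=> /subnKC <-; elim: (m - n)%N => [|k IH].
  by rewrite addn0.
by rewrite addnS; apply: le_trans IH _.
Qed.

Lemma time_ge0 n : (0 <= tr_time e n)%E.
Proof. by have [<- _ _] := tl; exact: time_mono. Qed.

Lemma phase_atE n t : (tr_time e n < t%:E)%E -> (t%:E <= tr_time e n.+1)%E -> phase_at e t = n.
Proof.
move=> h1 h2; rewrite /phase_at.
have [h3 h4] := @xgetPex _ 0%N [set n | (tr_time e n < t%:E)%E /\ (t%:E <= tr_time e n.+1)%E] (ex_intro _ n (conj h1 h2)).
set m := xget _ _ in h3 h4 *.
case: (ltngtP m n) => // mn.
  by have := lt_le_trans (le_lt_trans (time_mono mn) h1) h4; rewrite ltxx.
by have := lt_le_trans (le_lt_trans (time_mono mn) h3) h2; rewrite ltxx.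
Qed.

Lemma phase_atP t : 0 < t ->
  (tr_time e (phase_at e t) < t%:E)%E /\ (t%:E <= tr_time e (phase_at e t).+1)%E.
Proof.
move=> t0; have [e0 _ hu] := tl.
have ex : exists n, (t%:E <= tr_time e n)%E by have [n /ltW hn] := hu t; exists n.
have := ex_minnP ex => -[[|m] hm hmin]; first by move: hm; rewrite e0 lee_fin leNgt t0.
have hm' : (tr_time e m < t%:E)%E.
  by rewrite ltNge; apply/negP => /hmin; rewrite ltnn.
by rewrite (phase_atE hm' hm).
Qed.

Lemma phase_at0 : phase_at e 0 = 0%N.
Proof.
rewrite /phase_at xgetPN // => n [h _].
by have := time_ge0 n; rewrite leNgt h.
Qed.

Lemma time_fin n t : (tr_time e n <= t%:E)%E -> tr_time e n = (fine (tr_time e n))%:E.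
Proof.
move=> h; rewrite fineK // ge0_fin_numE ?time_ge0 //.
by apply: le_lt_trans h (ltry _).
Qed.

End Timeline.

Lemma trajectory_timeline th q (x : 'rV[R]_(sdim S q)) e : trajectory_of th x e -> timeline e.
Proof. by move=> [[? _] [? ?] _ _ _]. Qed.

Section OneTrajectory.
Variables (th : control S) (e : trajectory S) (q : nat) (x : 'rV[R]_(sdim S q)).
Hypothesis tj : trajectory_of th x e.
Let tl : timeline e := trajectory_timeline tj.

Lemma arc_speed n s t (F : R) :
  (forall i (z : 'rV[R]_(sdim S i)) u, Omega S i z -> enorm (f S i z u) <= F) ->
  (tr_time e n <= s%:E)%E -> s <= t -> (t%:E <= tr_time e n.+1)%E -> (t%:E <= tr_stop e)%E ->
  enorm (tr_arc e n t - tr_arc e n s) <= F * (t - s).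
Proof.
move=> hF hns st htn hts; have [_ _ hfl _ _] := tj; have [fl _] := hfl n.
have tn := (time_fin tl hns); set a := fine (tr_time e n) in tn.
have as_ : a <= s by rewrite -lee_fin -tn.
have st' : (s%:E <= t%:E)%E by rewrite lee_fin.
have fls := fl s hns (le_trans st' htn) (le_trans st' hts).
have flt := fl t (le_trans hns st') htn hts.
have [_ _ hs] := fls; have [_ _ ht] := flt.
apply: (@enorm_integral_le _ _ (fun r => f S (tr_mode e n) (tr_arc e n r) (ct_u th r))) => //.
- move=> k; have [hi _] := ht k; apply: integrableS hi => //; apply: subset_itv; by rewrite bnd_simp.
- move=> r /andP[sr rt]; apply: hF.
  by have [] := fl r; rewrite ?(le_trans hns) ?(le_trans _ htn) ?(le_trans _ hts) ?lee_fin.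
- move=> k; rewrite !mxE; have [_ hs2] := hs k; have [hi ht2] := ht k.
  rewrite hs2 ht2 -/a (Rintegral_chasles as_ st hi) opprD addrACA subrr add0r addrC addKr //.
Qed.

Definition run s : R := sK (state_at e s) (ct_u th s) * expR (- lambda S * s).

Definition life : set R := [set s | 0 <= s /\ (s%:E <= tr_stop e)%E].

Definition phase n : set R :=
  [set s | (tr_time e n < s%:E)%E /\ (s%:E <= tr_time e n.+1)%E /\ (s%:E <= tr_stop e)%E].

Lemma measurable_ray (b : \bar R) : measurable [set s : R | (s%:E <= b)%E].
Proof.
case: b => [b| |].
- have -> : [set s : R | (s%:E <= b%:E)%E] = `]-oo, b]%classic by apply/seteqP; split => s /=; rewrite in_itv /= lee_fin.
  exact: measurable_itv.
- have -> : [set s : R | (s%:E <= +oo)%E] = setT by apply/seteqP; split => s //= _; rewrite leey.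
  exact: measurableT.
- have -> : [set s : R | (s%:E <= -oo)%E] = set0 by apply/seteqP; split => s //=; rewrite leeNy_eq.
  exact: measurable0.
Qed.

Lemma measurable_coray (b : \bar R) : measurable [set s : R | (b < s%:E)%E].
Proof.
rewrite (_ : [set _ | _] = ~` [set s : R | (s%:E <= b)%E]).
  by apply: measurableC; exact: measurable_ray.
by apply/seteqP; split => s /=; rewrite ltNge => /negP.
Qed.

Lemma measurable_phase n : measurable (phase n).
Proof.
rewrite (_ : phase n = [set s : R | (tr_time e n < s%:E)%E] `&`
  ([set s : R | (s%:E <= tr_time e n.+1)%E] `&` [set s : R | (s%:E <= tr_stop e)%E])) //.
by apply: measurableI; [exact: measurable_coray|apply: measurableI; exact: measurable_ray].
Qed.

Lemma phase_life n : phase n `<=` life.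
Proof.
move=> s [h [_ h2]]; split=> //; rewrite -lee_fin.
by apply: le_trans (ltW h); exact: (time_ge0 tl).
Qed.

Lemma lifeE : life = (\bigcup_n phase n) `|` (life `&` [set 0]).
Proof.
apply/seteqP; split => [s [s0 hs]|s [[n _ /phase_life] //|[]//]].
move: s0; rewrite le_eqVlt => /orP[/eqP s0|s0]; first by right; subst s.
left; exists (phase_at e s) => //.
by have [h1 h2] := (phase_atP tl s0).
Qed.

Lemma measurable_life : measurable life.
Proof.
rewrite (_ : life = [set s : R | 0 <= s] `&` [set s : R | (s%:E <= tr_stop e)%E]) //.
apply: measurableI; last exact: measurable_ray.
rewrite (_ : [set _ | _] = `[0, +oo[%classic) //.
by apply/seteqP; split => s /=; rewrite in_itv /= andbT.
Qed.

Lemma phase_Omega n s : phase n s -> Omega S (tr_mode e n) (tr_arc e n s).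
Proof.
move=> [/ltW h1 [h2 h3]]; have [_ _ h _ _] := tj.
by have [fl _] := h n; have [] := fl s h1 h2 h3.
Qed.

Lemma state_at_phase n s : phase n s -> state_at e s = arcst e n s.
Proof. by move=> [h1 [h2 _]]; rewrite state_atE (phase_atE tl h1 h2). Qed.

Lemma state_at0 : state_at e 0 = mkstate x.
Proof. by rewrite state_atE (phase_at0 tl); have [[_]] := tj. Qed.

Lemma measurable_of_open (D : set R) (w : U -> R) : measurable D -> D `<=` [set s | 0 <= s] ->
  continuous w -> measurable_fun D (fun s => w (ct_u th s)).
Proof.
move=> mD D0 cw; apply: measurable_fun_gt => // c.
have -> : D `&` [set s | c < w (ct_u th s)] =
   D `&` ([set s | 0 <= s] `&` ct_u th @^-1` (w @^-1` [set r | c < r])).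
  by apply/seteqP; split => [s [Ds h]|s [Ds [_ h]]]; split => //; split => //; exact: D0.
apply: measurableI => //; apply: ct_measurable.
by apply: open_comp => [? _|]; [exact: cw|exact: open_gt].
Qed.

Lemma continuous_running_cost i (z : 'rV[R]_(sdim S i)) : Omega S i z -> continuous (K S i z).
Proof.
move=> Oz u; apply/cvgrPdist_lt => eps e0.
have [_ h _] := sa_running_cost hS; have [d d0 hd] := h eps e0.
have : nbhs u (ball u d) by exact: nbhsx_ballx.
apply: filterS => u'; rewrite ballEmdist /= => hu.
exact: hd.
Qed.

(** [measurable_diagonal] applies as [K] is Lipschitz in the state and the state is
    Lipschitz in time. *)
Lemma measurable_run_phase n : measurable_fun (phase n) (fun s => sK (state_at e s) (ct_u th s)).
Proof.
have [F F0 hF] := speed_bound hS.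
have [[L hL] _ _] := sa_running_cost hS.
pose g r s := K S (tr_mode e n) (tr_arc e n r) (ct_u th s).
apply: (@eq_measurable_fun _ _ _ _ _ (fun s => g s s)).
  by move=> s; rewrite inE => hs; rewrite (state_at_phase hs).
apply: (@measurable_diagonal _ _ _ (Num.max L 0 * F)).
- exact: measurable_phase.
- move=> s [h1 [h2 h3]]; exists (fine (tr_time e n)).
    by rewrite -lte_fin -(time_fin tl (ltW h1)).
  move=> r; rewrite -lte_fin -(time_fin tl (ltW h1)) => hr rs.
  have rs' : (r%:E <= s%:E)%E by rewrite lee_fin.
  by split => //; split; exact: le_trans rs' _.
- move=> r hr; apply: measurable_of_open; first exact: measurable_phase.
    by move=> s /phase_life [].
  by apply: continuous_running_cost; exact: phase_Omega.
- move=> r r' s hr hr' hs.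
  have L0 : 0 <= Num.max L 0 by rewrite le_max lexx orbT.
  apply: le_trans (hL _ _ _ _ (phase_Omega hr) (phase_Omega hr')) _.
  apply: (@le_trans _ _ (Num.max L 0 * enorm (tr_arc e n r - tr_arc e n r'))).
    by rewrite ler_wpM2r ?enorm_ge0 // le_max lexx.
  rewrite -mulrA ler_wpM2l //.
  have [h1 [h2 h3]] := hr; have [h1' [h2' h3']] := hr'.
  have [rr|rr] := leP r r'.
    rewrite enormB distrC ger0_norm ?subr_ge0 //.
    by apply: arc_speed => //; exact: ltW.
  have rr0 : 0 <= r - r' by rewrite subr_ge0 ltW.
  by rewrite (ger0_norm rr0); apply: arc_speed => //; exact: ltW.
Qed.

Lemma measurable_run_cost : measurable_fun life (fun s => sK (state_at e s) (ct_u th s)).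
Proof.
rewrite lifeE; apply/measurable_funU.
- by apply: bigcup_measurable => n _; exact: measurable_phase.
- by apply: measurableI => //; exact: measurable_life.
split.
  by apply/measurable_fun_bigcup => n; [exact: measurable_phase|exact: measurable_run_phase].
apply: (@measurable_funS _ _ _ _ [set (0:R)]); [exact: measurable_set1|by move=> s []|exact: measurable_fun_set1].
Qed.

Lemma state_at_Omega s : life s -> Omega S _ (projT2 (state_at e s)).
Proof.
rewrite lifeE => -[[n _ hs]|[[_ h] s0]].
  by rewrite (state_at_phase hs); exact: phase_Omega.
have {}s0 : s = 0 := s0; subst s; rewrite state_atE (phase_at0 tl) /=.
have [[t0 _] _ hf _ _] := tj; have [fl _] := hf 0%N.
by have [] := fl 0; rewrite ?t0 // (time_ge0 tl).
Qed.

Lemma run_bound (K0 : R) : 0 <= K0 ->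
  (forall i (z : 'rV[R]_(sdim S i)) u, Omega S i z -> `|K S i z u| <= K0) ->
  mu.-integrable life (EFin \o run) /\
  (`| \int[mu]_(s in life) (run s)%:E | <= (K0 / lambda S)%:E)%E.
Proof.
move=> K00 hK; apply: discounted_integral => //.
- exact: sa_lambda.
- exact: measurable_life.
- by move=> s [].
- exact: measurable_run_cost.
- by move=> s hs; apply: hK; exact: state_at_Omega.
Qed.

Definition jump_cost n : R :=
  if tr_auto e n then sCa (mkstate (pre_jump e n)) (ct_v th (n_auto e n))
  else sCc (mkstate (pre_jump e n)) (ct_dest th (n_ctrl e n)).

Definition jump_term n : \bar R :=
  if (tr_time e n.+1 < tr_stop e)%E
  then (jump_cost n * expR (- lambda S * jump_time e n))%:E else 0%E.

Definition final : R :=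
  if tr_stop e is EFin s then expR (- lambda S * s) * sh (state_at e s) else 0.

Lemma jump_cost_ge : exists2 c : R, 0 < c & forall n, (tr_time e n.+1 < +oo)%E -> c <= jump_cost n.
Proof.
have [_ _ [c c0 [hCa hCc]] _ _] := sa_switching_costs hS; exists c => // n hn.
have [_ _ hf _ _] := tj; have [_ /(_ hn)] := hf n.
rewrite /jump_cost; case: (tr_auto e n) => [[Ax _]|[Cx _ Dx _]]; [exact: hCa|exact: hCc].
Qed.

Lemma lt_stop_fin n : (tr_time e n.+1 < tr_stop e)%E -> (tr_time e n.+1 < +oo)%E.
Proof. by move=> h; apply: lt_le_trans h (leey _). Qed.

Lemma jump_term_ge0 n : (0 <= jump_term n)%E.
Proof.
rewrite /jump_term; case: ifPn => // h; rewrite lee_fin mulr_ge0 ?expR_ge0 //.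
by have [c c0 hc] := jump_cost_ge; apply: le_trans (hc n (lt_stop_fin h)); exact: ltW.
Qed.

(** The series over autonomous and over controlled jumps merge into one, which makes
    it possible to cut the cost at an arbitrary jump. *)
Lemma costE : cost th e = (\int[mu]_(s in life) (run s)%:E + \sum_(n <oo) jump_term n + (final)%:E)%E.
Proof.
rewrite /cost -/life.
have -> : (\sum_(n <oo | tr_auto e n && (tr_time e n.+1 < tr_stop e))
     (Ca S (tr_mode e n) (pre_jump e n) (ct_v th (n_auto e n))
        * expR (- lambda S * jump_time e n))%R%:E)%E =
  (\sum_(n <oo) if tr_auto e n then jump_term n else 0)%E.
  rewrite eseries_mkcond; apply: eq_eseriesr => n _; rewrite /jump_term /jump_cost.
  by case: (tr_auto e n) => //=; case: ifP.
have -> : (\sum_(n <oo | ~~ tr_auto e n && (tr_time e n.+1 < tr_stop e))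
     (Cc S (tr_mode e n) (projT1 (ct_dest th (n_ctrl e n)))
        (pre_jump e n) (projT2 (ct_dest th (n_ctrl e n)))
        * expR (- lambda S * jump_time e n))%R%:E)%E =
  (\sum_(n <oo) if ~~ tr_auto e n then jump_term n else 0)%E.
  rewrite eseries_mkcond; apply: eq_eseriesr => n _; rewrite /jump_term /jump_cost.
  by case: (tr_auto e n) => //=; case: ifP.
congr (_ + _)%E; rewrite -addeA; congr (_ + _)%E.
rewrite -nneseriesD.
- by apply: eq_eseriesr => n _; case: (tr_auto e n) => /=; rewrite ?adde0 ?add0e.
- by move=> n _ _; case: ifP => // _; exact: jump_term_ge0.
- by move=> n _ _; case: ifP => // _; exact: jump_term_ge0.
Qed.

Lemma final_ge0 : 0 <= final.
Proof.
rewrite /final; case hst: (tr_stop e) => [s| |] //; apply: mulr_ge0; first exact: expR_ge0.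
have [_ _ _ _ [h0 _ hG _]] := tj; have Gs := hG s hst.
have [_ h1] := sa_terminal_cost hS.
rewrite /sh; move: Gs; rewrite -/(pos_at e s) /=.
move: (mode_at e s) (pos_at e s) => i z Gz; have ei := Gamma_tgt hS Gz; subst i.
exact: h1.
Qed.

(** Switching and terminal costs are nonnegative, so only the running cost counts. *)
Lemma cost_ge (K0 : R) : 0 <= K0 ->
  (forall i (z : 'rV[R]_(sdim S i)) u, Omega S i z -> `|K S i z u| <= K0) ->
  ((- (K0 / lambda S))%:E <= cost th e)%E.
Proof.
move=> K00 hK; have [_ hb] := run_bound K00 hK; rewrite costE.
have h1 : ((- (K0 / lambda S))%:E <= \int[mu]_(s in life) (run s)%:E)%E.
  move: hb; case: (\int[mu]_(s in life) (run s)%:E)%E => [r| |] //.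
  by rewrite !lee_fin ler_norml => /andP[].
rewrite -[leLHS]adde0 -[leLHS]adde0; apply: leeD; last by rewrite lee_fin final_ge0.
by apply: leeD => //; apply: nneseries_ge0 => n _ _; exact: jump_term_ge0.
Qed.

End OneTrajectory.

(** [tail_of m t th e th' e']: the trajectory [e'] is what remains of [e] after
    time [t] and the first [m] phases.  Controls agree at positive times only: at
    time [t] itself the left-continuous state of [e] may precede the jumps made at
    that time. *)
Record tail_of m (t : R) th e th' e' : Prop := TailOf {
  tail_t0 : 0 <= t;
  tail_start : (tr_time e m <= t%:E)%E;
  tail_time : forall n, tr_time e (n.+1 + m) = (tr_time e' n.+1 + t%:E)%E;
  tail_arc : forall n s, 0 <= s -> arcst e (n + m) (s + t) = arcst e' n s;
  tail_auto : forall n, tr_auto e (n + m) = tr_auto e' n;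
  tail_v : forall n, ct_v th (n_auto e (n + m)) = ct_v th' (n_auto e' n);
  tail_dest : forall n, ct_dest th (n_ctrl e (n + m)) = ct_dest th' (n_ctrl e' n);
  tail_u : forall s, 0 < s -> ct_u th (s + t) = ct_u th' s;
  tail_stop : tr_stop e = (tr_stop e' + t%:E)%E;
  tail_live : (0 < tr_stop e')%E }.

Section TailStates.
Variables (m : nat) (t : R) (th th' : control S) (e e' : trajectory S).
Hypothesis tl : timeline e.
Hypothesis tl' : timeline e'.
Hypothesis ht : tail_of m t th e th' e'.

Lemma tail_state_at s : 0 < s -> state_at e (s + t) = state_at e' s.
Proof.
move=> s0; have [h1 h2] := phase_atP tl' s0; set n := phase_at e' s in h1 h2.
have -> : state_at e' s = arcst e' n s by [].
rewrite -(tail_arc ht) ?ltW // state_atE; congr (arcst e _ _).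
apply: (phase_atE tl).
  case: (n) h1 h2 => [|k] h1 h2.
    rewrite add0n; apply: le_lt_trans (tail_start ht) _.
    by rewrite lte_fin ltrDr.
  by rewrite (tail_time ht) EFinD lteD2rE.
by rewrite -addSn (tail_time ht) EFinD leeD2rE.
Qed.

Lemma tail_jump_time n : (tr_time e' n.+1 < +oo)%E -> jump_time e (n + m) = jump_time e' n + t.
Proof.
move=> h; rewrite /jump_time -addSn (tail_time ht) fineD //.
by rewrite ge0_fin_numE // (time_ge0 tl').
Qed.

Lemma tail_jump_cost n : (tr_time e' n.+1 < +oo)%E -> jump_cost th e (n + m) = jump_cost th' e' n.
Proof.
move=> h; rewrite /jump_cost (tail_auto ht) (tail_v ht) (tail_dest ht).
have -> // : mkstate (pre_jump e (n + m)) = mkstate (pre_jump e' n).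
rewrite -[LHS]/(arcst e (n + m) (jump_time e (n + m))) tail_jump_time //.
by rewrite (tail_arc ht) // fine_ge0 // (time_ge0 tl').
Qed.

Lemma tail_jump_term n :
  jump_term th e (n + m) = ((expR (- lambda S * t))%:E * jump_term th' e' n)%E.
Proof.
rewrite /jump_term -addSn (tail_time ht) (tail_stop ht) lteD2rE //.
case: ifPn => h; last by rewrite mule0.
have h' : (tr_time e' n.+1 < +oo)%E by exact: lt_le_trans h (leey _).
rewrite tail_jump_cost // tail_jump_time // -EFinM mulrDr expRD.
by congr (_%:E); ring.
Qed.

Lemma tail_run s : 0 < s -> run th e (s + t) = expR (- lambda S * t) * run th' e' s.
Proof.
move=> s0; rewrite /run tail_state_at // (tail_u ht) // mulrDr expRD; ring.
Qed.

Lemma tail_final : final e = expR (- lambda S * t) * final e'.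
Proof.
rewrite /final (tail_stop ht); have := tail_live ht; case: (tr_stop e') => [s| |] //=.
  rewrite lte_fin => s0; rewrite tail_state_at // mulrDr expRD; ring.
by rewrite mulr0.
Qed.

End TailStates.

Section Tail.
Variables (m : nat) (t : R) (th th' : control S) (e e' : trajectory S).
Variables (q q' : nat) (x : 'rV[R]_(sdim S q)) (x' : 'rV[R]_(sdim S q')).
Hypothesis tj : trajectory_of th x e.
Hypothesis tj' : trajectory_of th' x' e'.
Hypothesis ht : tail_of m t th e th' e'.
Let tl : timeline e := trajectory_timeline tj.
Let tl' : timeline e' := trajectory_timeline tj'.

Lemma tail_integral :
  (\int[mu]_(s in life e) (run th e s)%:E =
   \int[mu]_(s in `[0%R, t]) (run th e s)%:E +
   (expR (- lambda S * t))%:E * \int[mu]_(s in life e') (run th' e' s)%:E)%E.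
Proof.
have [K1 K10 hK1] := running_cost_bound hS.
have [hi _] := run_bound tj K10 hK1; have [hi' _] := run_bound tj' K10 hK1.
have t0 := tail_t0 ht.
pose D2 := [set s : R | (t%:E < s%:E)%E] `&` [set s : R | (s%:E <= tr_stop e)%E].
pose D3 := [set s : R | (0%:E < s%:E)%E] `&` [set s : R | (s%:E <= tr_stop e')%E].
have mD2 : measurable D2 by apply: measurableI; [exact: measurable_coray|exact: measurable_ray].
have mD3 : measurable D3 by apply: measurableI; [exact: measurable_coray|exact: measurable_ray].
have tstop : (t%:E <= tr_stop e)%E.
  by rewrite (tail_stop ht) -[leLHS]add0e leeD2rE // ltW // (tail_live ht).
have lE : life e = `[0, t]%classic `|` D2.
  apply/seteqP; split => s /=; rewrite in_itv /= ?lte_fin.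
    by move=> [-> h] /=; have [st|st] := leP s t; [left|right].
  move=> [/andP[s0 st]|[st h]]; split=> //; last by rewrite ltW // (le_lt_trans t0).
  by apply: le_trans tstop; rewrite lee_fin.
have lE' : life e' = [set 0] `|` D3.
  apply/seteqP; split => s /=; rewrite ?lte_fin.
    by move=> [s0 h]; move: s0; rewrite le_eqVlt => /orP[/eqP <-|s0]; [left|right].
  move=> [->|[s0 h]]; split => //; last exact: ltW.
  by apply: ltW; exact: (tail_live ht).
have D2life : D2 `<=` life e by rewrite lE; exact: subsetUr.
have D3life : D3 `<=` life e' by rewrite lE'; exact: subsetUr.
have mrun : measurable_fun (life e) (EFin \o run th e) by case/integrableP: hi.
have mrun' : measurable_fun (life e') (EFin \o run th' e') by case/integrableP: hi'.
rewrite [LHS](_ : _ = \int[mu]_(s in `[0%R, t] `|` D2) (run th e s)%:E)%E; last by rewrite -lE.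
rewrite integral_setU //; last 2 first.
- by rewrite -lE.
- rewrite disj_set2E; apply/eqP/seteqP; split => s //= -[]; rewrite in_itv /= ?lte_fin => /andP[_ st] [ts _].
  by have := lt_le_trans (ts : t < s) st; rewrite ltxx.
congr (_ + _)%E.
rewrite -(@integral_shift R t D2 (EFin \o run th e)) //; last first.
  by apply: measurable_funS mrun => //; exact: measurable_life.
have -> : (fun r : R => r + t) @^-1` D2 = D3.
  have es s : ((s + t)%:E <= tr_stop e)%E = (s%:E <= tr_stop e')%E by rewrite (tail_stop ht) EFinD leeD2rE.
  have et s : (t%:E < (s + t)%:E)%E = (0%:E < s%:E)%E by rewrite !lte_fin ltrDr.
  by apply/seteqP; split => s [h1 h2]; split => //; [move: h1|move: h2|move: h1|move: h2]; rewrite /= ?et ?es.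
rewrite [LHS](_ : _ = \int[mu]_(s in D3) ((expR (- lambda S * t))%:E * (run th' e' s)%:E))%E; last first.
  by apply: eq_integral => s; rewrite inE => -[s0 _]; rewrite -EFinM -(tail_run tl tl' ht).
rewrite integralZl //; last by apply: integrableS hi' => //; exact: measurable_life.
congr (_ * _)%E.
rewrite [RHS](_ : _ = \int[mu]_(s in [set 0%R] `|` D3) (run th' e' s)%:E)%E; last by rewrite -lE'.
rewrite integral_setU //; last 2 first.
- by rewrite -lE'.
- rewrite disj_set2E; apply/eqP/seteqP; split => s //= -[-> [h _]].
  by have := (h : (0 : R) < 0); rewrite ltxx.
by rewrite integral_set1 add0e.
Qed.

(** The dynamic programming identity along a single trajectory; all inequalities for
    the value function follow from it by cutting or extending trajectories. *)
Lemma cost_tail : cost th e =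
  (\int[mu]_(s in `[0%R, t]) (run th e s)%:E + \sum_(n < m) jump_term th e n +
   (expR (- lambda S * t))%:E * cost th' e')%E.
Proof.
have [K1 K10 hK1] := running_cost_bound hS.
have [hi' _] := run_bound tj' K10 hK1.
have fi' : (\int[mu]_(s in life e') (run th' e' s)%:E)%E \is a fin_num.
  by apply: integrable_fin_num => //; exact: measurable_life.
have J0 := jump_term_ge0 tj; have J0' := jump_term_ge0 tj'.
rewrite (costE tj) (costE tj') tail_integral (tail_final tl tl' ht).
have -> : (\sum_(n <oo) jump_term th e n = \sum_(n < m) jump_term th e n +
   (expR (- lambda S * t))%:E * \sum_(n <oo) jump_term th' e' n)%E.
  rewrite (nneseries_split 0 m) // add0n big_mkord; congr (_ + _)%E.
  rewrite -nneseries_addn // -nneseriesZl; last by move=> n _; exact: J0'.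
  by apply: eq_eseriesr => n _; exact: (tail_jump_term tl' ht).
set k := (expR (- lambda S * t))%:E; have kf : k \is a fin_num by [].
rewrite [in RHS](muleDr kf); last exact: fin_num_adde_defl.
rewrite [in RHS](muleDr kf); last exact: fin_num_adde_defr.
rewrite EFinM -/k.
set a := (\int[mu]_(s in `[0%R, t]) _)%E; set b := (_ * \int[mu]_(s in life e') _)%E.
set c := (\sum_(n < m) _)%E; set d := (_ * limn _)%E.
by rewrite (addeACA a b c d) -addeA.
Qed.

End Tail.

End Trajectories.

(** * Surgery on trajectories *)

Section Solves.
Variables (R : realType) (U V1 : metricType R) (S : hybrid_data U V1) (i : nat).
Notation mu := (@lebesgue_measure R).
Implicit Types (u : R -> U) (y : R -> 'rV[R]_(sdim S i)) (a b c r t : R).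

Definition solves u y a t : Prop := forall k,
  let F s := f S i (y s) (u s) 0 k in
  mu.-integrable `[a, t] (EFin \o F) /\
  y t 0 k = y a 0 k + \int[mu]_(s in `[a, t]) F s.

(** The controls may differ at the initial time, a negligible set; this matters
    where two controls are glued. *)
Lemma solves_ext u u' y y' a t : a <= t ->
  (forall s, a < s <= t -> u s = u' s) -> (forall s, a <= s <= t -> y s = y' s) ->
  solves u y a t -> solves u' y' a t.
Proof.
move=> at_ hu hy h k /=; have [hi he] := h k.
set F := fun s => f S i (y s) (u s) 0 k in hi he.
pose F' s := f S i (y' s) (u' s) 0 k.
have FF' s : a < s <= t -> F s = F' s.
  by move=> /andP[as_ st]; rewrite /F /F' hu ?as_ // hy // (ltW as_).
have hi1 : mu.-integrable `]a, t] (EFin \o F).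
  by apply: integrableS hi => //; apply: subset_itv; rewrite bnd_simp.
have hi2 : mu.-integrable `]a, t] (EFin \o F').
  apply: eq_integrable hi1 => // s; rewrite inE /= in_itv /= => hs.
  by rewrite FF'.
have hi3 : mu.-integrable `[a, t] (EFin \o F').
  case/integrableP: hi2 => m2 l2; apply/integrableP; split.
    by apply/emeasurable_fun_itv_obnd_cbndP.
  rewrite -integral_itv_obnd_cbnd //; exact: measurableT_comp.
split => //.
rewrite -hy ?lexx ?at_ // -hy ?lexx ?at_ // he; congr (_ + _).
rewrite -Rintegral_itv_obnd_cbnd // -[RHS]Rintegral_itv_obnd_cbnd //.
by apply: eq_Rintegral => s; rewrite inE /= in_itv /= => hs; exact: FF'.
Qed.

Lemma solves_refl u y a : solves u y a a.
Proof.
move=> k /=; rewrite set_itv1 Rintegral_set1 addr0; split => //.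
apply/integrableP; split; first exact: measurable_fun_set1.
by rewrite integral_set1 ltry.
Qed.

Lemma solves_shift u y a t r : solves u y (a + r) (t + r) <->
  solves (fun s => u (s + r)) (fun s => y (s + r)) a t.
Proof.
have pre c : (fun s : R => s + c) @^-1` `[a + c, t + c] = `[a, t]%classic.
  by apply/seteqP; split => s /=; rewrite !in_itv /= !lerD2r.
have pre' : (fun s : R => s - r) @^-1` `[a, t] = `[a + r, t + r]%classic.
  by apply/seteqP; split => s /=; rewrite !in_itv /= lerBrDr lerBlDr.
have key F : mu.-integrable `[a + r, t + r] (EFin \o F) ->
    \int[mu]_(s in `[a + r, t + r]) F s = \int[mu]_(s in `[a, t]) F (s + r).
  move=> hi; rewrite /Rintegral; congr (fine _).
  rewrite -(pre r); apply/esym.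
  apply: (@integral_shift R r `[a + r, t + r]%classic (EFin \o F)) => //.
  by case/integrableP: hi.
split=> h k /=; have [hi he] := h k; cbv zeta in he.
  split; last by rewrite he key.
  by rewrite -(pre r); exact: (@integrable_shift R r `[a + r, t + r]%classic _ _ hi).
set F := fun s => f S i (y s) (u s) 0 k.
have hi' : mu.-integrable `[a + r, t + r] (EFin \o F).
  have := @integrable_shift R (- r) `[a, t]%classic _ (measurable_itv _) hi.
  rewrite pre'; apply: eq_integrable => // s _.
  by rewrite /F /= subrK.
by split => //; rewrite he key.
Qed.

Lemma solves_sub u y a c t : a <= c -> c <= t -> solves u y a c -> solves u y a t -> solves u y c t.
Proof.
move=> ac ct h1 h2 k /=; have [i1 e1] := h1 k; have [i2 e2] := h2 k; cbv zeta in e1, e2.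
split; first by apply: integrableS i2 => //; apply: subset_itv; rewrite bnd_simp.
by rewrite e1 e2 (Rintegral_chasles ac ct i2) addrA.
Qed.

Lemma solves_cat u y a c t : a <= c -> c <= t -> solves u y a c -> solves u y c t -> solves u y a t.
Proof.
move=> ac ct h1 h2 k /=; have [i1 e1] := h1 k; have [i2 e2] := h2 k; cbv zeta in e1, e2.
set F := fun s => f S i (y s) (u s) 0 k in i1 e1 i2 e2 *.
have hi : mu.-integrable `[a, t] (EFin \o F).
  have i3 : mu.-integrable `]c, t] (EFin \o F).
    by apply: integrableS i2 => //; apply: subset_itv; rewrite bnd_simp.
  have eU : `[a, t]%classic = `[a, c]%classic `|` `]c, t]%classic.
    apply/seteqP; split => s /=; rewrite !in_itv /=.
      by move=> /andP[as_ st]; have [sc|cs] := leP s c; [left; rewrite as_|right].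
    by move=> [/andP[-> sc]|/andP[cs ->]]; rewrite ?(le_trans sc) ?(le_trans ac (ltW cs)).
  apply/integrableP; case/integrableP: i1 => m1 l1; case/integrableP: i3 => m3 l3.
  have mU : measurable_fun (`[a, c] `|` `]c, t]) (EFin \o F) by apply/measurable_funU.
  rewrite eU; split => //.
  rewrite ge0_integral_setU //.
  - by rewrite lte_add_pinfty.
  - exact: measurableT_comp.
  - rewrite disj_set2E; apply/eqP/seteqP; split => s //= -[]; rewrite !in_itv /= => /andP[_ sc] /andP[cs _].
    by have := lt_le_trans cs sc; rewrite ltxx.
by split => //; rewrite e2 e1 (Rintegral_chasles ac ct hi) addrA.
Qed.

End Solves.

Section Surgery.
Variables (R : realType) (U V1 : metricType R) (S : hybrid_data U V1).
Hypothesis hS : standing_assumptions S.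
Notation mu := (@lebesgue_measure R).
Implicit Types (th : control S) (e : trajectory S).

Lemma subr_ltpinfty (a : \bar R) (t : R) : (a - t%:E < +oo)%E -> (a < +oo)%E.
Proof. by rewrite !ltey; case: a. Qed.

Lemma addr_ltpinfty (a : \bar R) (t : R) : (a + t%:E < +oo)%E -> (a < +oo)%E.
Proof. by rewrite !ltey; case: a. Qed.

Definition sGamma (s : state S) : Prop := Gamma S (projT1 s) (projT2 s).

(** ** Cutting off an initial piece of the first phase *)
Section Shift.
Variables (th : control S) (e : trajectory S) (q : nat) (x : 'rV[R]_(sdim S q)) (t : R).
Hypothesis tj : trajectory_of th x e.
Hypothesis t0 : 0 <= t.
Hypothesis t1 : (t%:E <= tr_time e 1)%E.
Hypothesis ts : (t%:E < tr_stop e)%E.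

Lemma shift_measurable (O : set U) : open O ->
  measurable ([set s : R | 0 <= s] `&` (fun s => ct_u th (s + t)) @^-1` O).
Proof.
move=> oO.
have -> : [set s : R | 0 <= s] `&` (fun s => ct_u th (s + t)) @^-1` O =
  (fun s : R => s + t) @^-1` (`[t, +oo[%classic `&` ([set s : R | 0 <= s] `&` ct_u th @^-1` O)).
  apply/seteqP; split => s /=; rewrite in_itv /= andbT lerDr.
    by move=> [s0 h]; do 2 (split => //); rewrite addr_ge0.
  by move=> [? [? ?]].
by apply: measurable_shift_set; apply: measurableI => //; exact: ct_measurable.
Qed.

Definition shift_control : control S :=
  Control (ct_v th) (fun k => ct_time th k - t%:E)%E (ct_dest th) shift_measurable.

Definition shift_trajectory : trajectory S :=
  @Trajectory _ _ _ S (fun n => if n is n'.+1 then (tr_time e n'.+1 - t%:E)%E else 0%E)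
    (tr_mode e) (fun n s => tr_arc e n (s + t)) (tr_auto e) (tr_stop e - t%:E)%E.

Lemma shift_timeline : timeline shift_trajectory.
Proof.
have [time0 mono unb] := trajectory_timeline tj; split => //=.
  by move=> [|n]; [rewrite EFinN sube_ge0|rewrite leeD2rE].
move=> M; have [[|n] hn] := unb (`|M| + t).
  by move: hn; rewrite time0 lte_fin ltNge addr_ge0.
exists n.+1 => /=; rewrite EFinN lteBrDr // -EFinD; apply: le_lt_trans hn.
by rewrite lee_fin lerD2r ler_norm.
Qed.

Lemma shift_tail : tail_of 0 t th e shift_control shift_trajectory.
Proof.
have [time0 mono unb] := trajectory_timeline tj; split => //=.
- by rewrite time0 lee_fin.
- by move=> n; rewrite addn0 EFinN subeK.
- by move=> n s _; rewrite addn0.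
- by move=> n; rewrite addn0.
- by move=> n; rewrite addn0.
- by move=> n; rewrite addn0.
- by rewrite EFinN subeK.
- by rewrite EFinN sube_gt0.
Qed.

Lemma shift_trajectory_of : trajectory_of shift_control (tr_arc e 0 t) shift_trajectory.
Proof.
have tl := trajectory_timeline tj; have tl' := shift_timeline.
have [time0 mono unb] := tl; have [_ mono' unb'] := tl'.
have [_ _ hf hskip [hs1 hs2 hs3 hs4]] := tj.
have le_shift (a : \bar R) (s : R) : (a - t%:E <= s%:E)%E = (a <= (s + t)%:E)%E by rewrite leeBlDr.
have ge_shift (a : \bar R) (s : R) : (s%:E <= a - t%:E)%E = ((s + t)%:E <= a)%E by rewrite leeBrDr.
have gt_shift (a : \bar R) (s : R) : (s%:E < a - t%:E)%E = ((s + t)%:E < a)%E by rewrite lteBrDr.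
split.
- by split => //=; rewrite add0r.
- by split.
- move=> n; split.
  + move=> s hns hsn hst; have [fl _] := hf n.
    rewrite /= ge_shift in hsn; rewrite /= ge_shift in hst.
    have s0 : 0 <= s by rewrite -lee_fin; apply: le_trans hns; exact: time_ge0.
    have hns' : (tr_time e n <= (s + t)%:E)%E.
      case: n hns {hsn fl} => [|n] /= hns; first by rewrite time0 lee_fin addr_ge0.
      by rewrite -le_shift.
    have [h1 h2 h3] := fl (s + t) hns' hsn hst.
    split => //=; first by rewrite gt_shift.
    change (solves (S := S) (fun s => ct_u th (s + t)) (fun s => tr_arc e n (s + t))
      (fine (tr_time shift_trajectory n)) s).
    apply/solves_shift.
    have -> : fine (tr_time shift_trajectory n) + t = if n is n'.+1 then fine (tr_time e n) else t.
      case: n hns {hsn fl h1 h2 h3 hns'} => [|n] /= hns; first by rewrite add0r.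
      have : (tr_time e n.+1 <= (s + t)%:E)%E by rewrite -le_shift.
      by move=> /(time_fin tl) ->; rewrite -EFinB /= subrK.
    case: n hns hsn fl h1 h2 h3 hns' => [|n] //= hns hsn fl h1 h2 h3 hns'.
    have st : t <= s + t by rewrite lerDr.
    have h3' : solves (S := S) (ct_u th) (tr_arc e 0) 0 (s + t).
      by have := h3; rewrite time0.
    apply: (solves_sub t0 st _ h3').
    have tt : (tr_time e 0 <= t%:E)%E by rewrite time0 lee_fin.
    by have [_ _] := fl t tt t1 (ltW ts); rewrite time0.
  + move=> /= hlt; have [_ hj] := hf n.
    have hlt' : (tr_time e n.+1 < +oo)%E.
      exact: subr_ltpinfty hlt.
    have jt : jump_time shift_trajectory n + t = jump_time e n.
      rewrite /jump_time /=; move: hlt' (time_ge0 tl n.+1); case: (tr_time e n.+1) => [r| |] //= _ _.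
      by rewrite subrK.
    have := hj hlt'.
    rewrite /pre_jump /post_jump /= -jt; case: ifP => // _ [h1 h2 h3 h4]; split => //.
    by rewrite h2.
- move=> n hn; rewrite ge_min.
  have hn' : (tr_time e n < +oo)%E.
    by case: n hn => [|n] /= hn; [rewrite time0 ltry|exact: subr_ltpinfty hn].
  have := hskip n hn'; rewrite ge_min => /orP[] h; apply/orP; [left|right] => /=.
    exact: leeD2r.
  exact: leeD2r.
split.
- by rewrite /= EFinN sube_ge0 // ltW.
- move=> s s0; rewrite [tr_stop _]/= gt_shift => hs.
  have h : ~ sGamma (state_at e (s + t)) by apply: hs2 => //; exact: addr_ge0.
  move: s0; rewrite le_eqVlt => /orP[/eqP s0|s0]; last first.
    by move: h; rewrite (tail_state_at tl tl' shift_tail s0).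
  subst s; change (~ sGamma (state_at shift_trajectory 0)).
  rewrite state_atE (phase_at0 tl') /arcst /= add0r.
  rewrite add0r in h.
  move: t0; rewrite le_eqVlt => /orP[/eqP t00|tp].
    by move: h; rewrite state_atE -t00 (phase_at0 tl).
  by move: h; rewrite state_atE (@phase_atE _ _ _ _ _ tl 0%N) // time0 lte_fin.
- move=> s hs.
  have hs' : tr_stop e = (s + t)%:E by rewrite EFinD -hs [tr_stop shift_trajectory]/= EFinN subeK.
  have s0 : 0 < s by move: ts; rewrite hs' lte_fin ltrDr.
  change (sGamma (state_at shift_trajectory s)).
  rewrite -(tail_state_at tl tl' shift_tail s0); exact: hs3.
- move=> n /= hn.
  have hn' : (tr_time e n.+1 < +oo)%E := subr_ltpinfty hn.
  by rewrite lteD2rE //; exact: hs4.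
Qed.

End Shift.

Lemma n_autoS e n : n_auto e n.+1 = (tr_auto e 0 + \sum_(m < n) tr_auto e m.+1)%N.
Proof. by rewrite /n_auto big_ord_recl. Qed.

Lemma n_ctrlS e n : n_ctrl e n.+1 = (~~ tr_auto e 0 + \sum_(m < n) ~~ tr_auto e m.+1)%N.
Proof. by rewrite /n_ctrl big_ord_recl. Qed.

(** ** Cutting off a jump that takes place at time [0] *)
Section Drop.
Variables (th : control S) (e : trajectory S) (q : nat) (x : 'rV[R]_(sdim S q)).
Hypothesis tj : trajectory_of th x e.
Hypothesis t1 : tr_time e 1 = 0%E.

Definition drop_control : control S :=
  Control (fun k => ct_v th (tr_auto e 0 + k)) (fun k => ct_time th (~~ tr_auto e 0 + k))
    (fun k => ct_dest th (~~ tr_auto e 0 + k)) (@ct_measurable _ _ _ _ th).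

Definition drop_trajectory : trajectory S :=
  @Trajectory _ _ _ S (fun n => tr_time e n.+1) (fun n => tr_mode e n.+1)
    (fun n => tr_arc e n.+1) (fun n => tr_auto e n.+1) (tr_stop e).

Lemma drop_timeline : timeline drop_trajectory.
Proof.
have [time0 mono unb] := trajectory_timeline tj; split => //= M.
have [[|n] hn] := unb `|M|; first by move: hn; rewrite time0 lte_fin ltNge normr_ge0.
by exists n; apply: le_lt_trans hn; rewrite lee_fin ler_norm.
Qed.

Lemma drop_live : (0 < tr_stop e)%E.
Proof.
have [_ _ _ _ [_ _ _ h]] := tj; have := h 0%N; rewrite t1; apply; exact: ltry.
Qed.

Lemma drop_tail : tail_of 1 0 th e drop_control drop_trajectory.
Proof.
split => //=.
- by rewrite t1.
- by move=> n; rewrite addn1 adde0.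
- by move=> n s _; rewrite addn1 addr0.
- by move=> n; rewrite addn1.
- by move=> n; rewrite addn1 n_autoS.
- by move=> n; rewrite addn1 n_ctrlS.
- by move=> s _; rewrite addr0.
- by rewrite adde0.
- exact: drop_live.
Qed.

Lemma drop_start : exists2 s : state S, s = arcst e 1 0 & D S (projT1 s) (projT2 s).
Proof.
exists (arcst e 1 0) => //; have [_ _ hf _ _] := tj; have [_ hj] := hf 0%N.
have lt1 : (tr_time e 1 < +oo)%E by rewrite t1 ltry.
have [hg _ _] := sa_transition hS.
have jt : arcst e 1 0 = post_jump e 0 by rewrite /post_jump /jump_time t1.
rewrite jt; move: (hj lt1); case: ifP => _.
  by move=> [Ax ->]; exact: hg.
by move=> [_ _ Dx ->].
Qed.

Lemma drop_trajectory_of : trajectory_of drop_control (tr_arc e 1 0) drop_trajectory.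
Proof.
have tl := trajectory_timeline tj; have tl' := drop_timeline.
have [time0 mono unb] := tl; have [_ mono' unb'] := tl'.
have [_ _ hf hskip [hs1 hs2 hs3 hs4]] := tj.
split.
- by split.
- by split.
- move=> n; have [fl hj] := hf n.+1; split; first exact: fl.
  move=> hlt; move: (hj hlt); rewrite n_autoS n_ctrlS /pre_jump /post_jump /jump_time /=.
  by [].
- by move=> n hn; have := hskip n.+1 hn; rewrite n_ctrlS.
split => //.
- move=> s s0 hs; have h := hs2 s s0 hs.
  move: s0; rewrite le_eqVlt => /orP[/eqP s0|s0]; last first.
    change (~ sGamma (state_at drop_trajectory s)).
    by rewrite -(tail_state_at tl tl' drop_tail s0) addr0.
  subst s; change (~ sGamma (state_at drop_trajectory 0)).
  rewrite state_atE (phase_at0 tl').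
  have [s -> Ds] := drop_start; move=> Gs; exact: (Gamma_D_disjoint hS Gs Ds).
- move=> s hs; have s0 : 0 < s by have := drop_live; rewrite hs lte_fin.
  change (sGamma (state_at drop_trajectory s)).
  rewrite -(tail_state_at tl tl' drop_tail s0) addr0; exact: hs3.
- by move=> n; exact: hs4.
Qed.

End Drop.

(** ** Prefixing a piece of flow under a constant control *)
Section Prefix.
Variables (th : control S) (e : trajectory S) (y : R -> 'rV[R]_(sdim S (tr_mode e 0))).
Variables (t : R) (u0 : U).
Hypothesis tj : trajectory_of th (tr_arc e 0 0) e.
Hypothesis t0 : 0 <= t.
Hypothesis live : (0 < tr_stop e)%E.
Hypothesis yt : y t = tr_arc e 0 0.
Hypothesis yO : forall s, 0 <= s <= t -> Omega S _ (y s).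
Hypothesis yG : forall s, 0 <= s <= t -> ~ Gamma S _ (y s).
Hypothesis yA : forall s, 0 <= s < t -> ~ A S _ (y s).
Hypothesis ysol : forall s, 0 <= s <= t -> solves (fun _ => u0) y 0 s.

Lemma prefix_measurable (O : set U) : open O ->
  measurable ([set s : R | 0 <= s] `&` (fun s => if s <= t then u0 else ct_u th (s - t)) @^-1` O).
Proof.
move=> oO.
have -> : [set s : R | 0 <= s] `&` (fun s => if s <= t then u0 else ct_u th (s - t)) @^-1` O =
  (`[0, t]%classic `&` [set s | O u0]) `|`
  (`]t, +oo[%classic `&` (fun s : R => s - t) @^-1` ([set s : R | 0 <= s] `&` ct_u th @^-1` O)).
  apply/seteqP; split => s /=; rewrite !in_itv /= ?andbT subr_ge0.
    by move=> [s0]; have [st|st] := leP s t => h; [left; rewrite s0|right; rewrite ltW].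
  move=> [[/andP[s0 st] h]|[ts [st h]]]; first by rewrite st.
  rewrite (lt_geF ts); split => //; exact: le_trans st.
apply: measurableU.
  apply: measurableI => //.
  have [h|h] := pselect (O u0).
    by rewrite (_ : [set _ | _] = setT) //; apply/seteqP; split.
  by rewrite (_ : [set _ | _] = set0) //; apply/seteqP; split.
apply: measurableI => //; apply: measurable_shift_set; exact: ct_measurable.
Qed.

Definition prefix_control : control S :=
  Control (ct_v th) (fun k => ct_time th k + t%:E)%E (ct_dest th) prefix_measurable.

(** The two branches agree at time [t]. *)
Definition prefix_arc n : R -> 'rV[R]_(sdim S (tr_mode e n)) :=
  if n is n'.+1 then fun s => tr_arc e n'.+1 (s - t)
  else fun s => if s < t then y s else tr_arc e 0 (s - t).

Definition prefix_trajectory : trajectory S :=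
  @Trajectory _ _ _ S (fun n => if n is n'.+1 then (tr_time e n'.+1 + t%:E)%E else 0%E)
    (tr_mode e) prefix_arc (tr_auto e) (tr_stop e + t%:E)%E.

Lemma prefix_arc_after n s : t <= s -> prefix_arc n s = tr_arc e n (s - t).
Proof. by case: n => [|n] //= ts; rewrite ltNge ts. Qed.

Lemma prefix_arc_before s : s <= t -> prefix_arc 0 s = y s.
Proof. by rewrite le_eqVlt => /orP[/eqP ->|/= -> //]; rewrite /= ltxx subrr yt. Qed.

Lemma prefix_timeline : timeline prefix_trajectory.
Proof.
have tl := trajectory_timeline tj; have [time0 mono unb] := tl; split => //=.
  by move=> [|n]; [rewrite adde_ge0 ?lee_fin ?(time_ge0 tl)|rewrite leeD2rE].
move=> M; have [[|n] hn] := unb `|M|.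
  by move: hn; rewrite time0 lte_fin ltNge normr_ge0.
exists n.+1 => /=; apply: (lt_le_trans (y := tr_time e n.+1)).
  by apply: le_lt_trans hn; rewrite lee_fin ler_norm.
by rewrite leeDl // lee_fin.
Qed.

Lemma prefix_tail : tail_of 0 t prefix_control prefix_trajectory th e.
Proof.
split => //=.
- by move=> n; rewrite addn0.
- by move=> n s s0; rewrite addn0 /arcst /= prefix_arc_after ?lerDr // addrK.
- by move=> n; rewrite addn0.
- by move=> n; rewrite addn0.
- by move=> n; rewrite addn0.
- move=> s s0; rewrite addrK (_ : s + t <= t = false) //; apply/negbTE; rewrite -ltNge; lra.
Qed.

Lemma prefix_le_time1 : (t%:E <= tr_time prefix_trajectory 1)%E.
Proof. by rewrite /= -[leLHS]add0e leeD2rE // (time_ge0 (trajectory_timeline tj)). Qed.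

Lemma prefix_state_before s : 0 <= s <= t -> state_at prefix_trajectory s = mkstate (y s).
Proof.
move=> /andP[s0 st]; have tl' := prefix_timeline.
have -> : state_at prefix_trajectory s = arcst prefix_trajectory 0 s.
  rewrite state_atE; move: s0; rewrite le_eqVlt => /orP[/eqP <-|s0]; first by rewrite (phase_at0 tl').
  rewrite (phase_atE (n := 0) tl') ?lte_fin //.
  by apply: le_trans prefix_le_time1; rewrite lee_fin.
by rewrite /arcst /= -/(prefix_arc 0 s) prefix_arc_before.
Qed.

Lemma prefix_trajectory_of : trajectory_of prefix_control (y 0) prefix_trajectory.
Proof.
have tl := trajectory_timeline tj; have tl' := prefix_timeline.
have [time0 mono unb] := tl; have [_ mono' unb'] := tl'.
have [_ _ hf hskip [hs1 hs2 hs3 hs4]] := tj.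
have le_shift (a : \bar R) (s : R) : (a + t%:E <= s%:E)%E = (a <= (s - t)%:E)%E by rewrite EFinB leeBrDr.
have ge_shift (a : \bar R) (s : R) : (s%:E <= a + t%:E)%E = ((s - t)%:E <= a)%E by rewrite EFinB leeBlDr.
have gt_shift (a : \bar R) (s : R) : (s%:E < a + t%:E)%E = ((s - t)%:E < a)%E by rewrite EFinB lteBlDr.
have sol0 s : 0 <= s <= t ->
    solves (S := S) (fun s => if s <= t then u0 else ct_u th (s - t)) (prefix_arc 0) 0 s.
  move=> /andP[s0 st].
  have h : 0 <= s <= t by rewrite s0.
  apply: (solves_ext s0 _ _ (ysol h)) => r /andP[r0 rs].
    by rewrite (le_trans rs st).
  by rewrite prefix_arc_before // (le_trans rs st).
have after n a s : t <= a -> a <= s ->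
    solves (S := S) (ct_u th) (tr_arc e n) (a - t) (s - t) ->
    solves (S := S) (fun s => if s <= t then u0 else ct_u th (s - t)) (prefix_arc n) a s.
  move=> ta as_ h; apply: (@solves_ext _ _ _ S _ (fun s => ct_u th (s - t)) _ (fun s => tr_arc e n (s - t))) => //.
  - move=> r /andP[ar rs]; rewrite (_ : r <= t = false) //; apply/negbTE; rewrite -ltNge.
    exact: le_lt_trans ta ar.
  - by move=> r /andP[ar rs]; rewrite prefix_arc_after // (le_trans ta).
  - exact/solves_shift.
split.
- split => //=; congr existT; by rewrite -/(prefix_arc 0 0) prefix_arc_before.
- by split.
- move=> n; split.
  + move=> s hns hsn hst; have [fl _] := hf n.
    have [st|ts] := leP s t.
      case: n hns hsn fl => [|n] hns hsn fl.
        have s0 : 0 <= s by rewrite -lee_fin.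
        have h : 0 <= s <= t by rewrite s0.
        split.
        * rewrite [tr_arc _ _]/= -/(prefix_arc 0) prefix_arc_before //; exact: yO.
        * rewrite [tr_arc _ _]/= -/(prefix_arc 0) prefix_arc_before //.
          move: st; rewrite le_eqVlt => /orP[/eqP st|st] hs; last by apply: yA; rewrite s0.
          rewrite st yt; rewrite st gt_shift subrr in hs.
          have e0 : (tr_time e 0 <= 0%:E)%E by rewrite time0.
          by have [_ hA _] := fl 0 e0 (time_ge0 tl 1) (ltW live); exact: hA.
        * exact: sol0.
      have {}st : s = t.
        apply/eqP; rewrite eq_le st /= -lee_fin; apply: le_trans hns => /=.
        by rewrite leeDr // (time_ge0 tl).
      subst s; rewrite [tr_time _ _]/= le_shift subrr in hns.
      rewrite [tr_time _ _]/= ge_shift subrr in hsn.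
      rewrite [tr_stop _]/= ge_shift subrr in hst.
      have [h1 h2 h3] := fl 0 hns hsn hst; split.
      * by rewrite [tr_arc _ _]/= -?/(prefix_arc n.+1 t) /= subrr.
      * by rewrite [tr_time _ _]/= gt_shift /= subrr.
      * have tn := time_fin tl hns.
        have an : fine (tr_time e n.+1) = 0.
          by apply/eqP; rewrite eq_le fine_ge0 ?(time_ge0 tl) // andbT -lee_fin -tn.
        change (solves (S := S) (ct_u prefix_control) (prefix_arc n.+1) (fine (tr_time prefix_trajectory n.+1)) t).
        rewrite /= fineD ?an ?add0r; first exact: solves_refl.
        -- by rewrite tn.
        -- by [].
    rewrite [tr_time _ n.+1]/= ge_shift in hsn.
    rewrite [tr_stop _]/= ge_shift in hst.
    have st0 : 0 <= s - t by rewrite subr_ge0 ltW.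
    have hns' : (tr_time e n <= (s - t)%:E)%E.
      case: n hns {hsn fl} => [|n] /= hns; first by rewrite time0 lee_fin.
      by rewrite -le_shift.
    have [h1 h2 h3] := fl (s - t) hns' hsn hst.
    change (solves (S := S) (ct_u th) (tr_arc e n) (fine (tr_time e n)) (s - t)) in h3.
    have tn := time_fin tl hns'; have an : fine (tr_time e n) <= s - t by rewrite -lee_fin -tn.
    have a0 : 0 <= fine (tr_time e n) by rewrite fine_ge0 // (time_ge0 tl).
    split.
    * by rewrite /= -/(prefix_arc n s) prefix_arc_after // ltW.
    * by rewrite /= -/(prefix_arc n s) gt_shift prefix_arc_after // ltW.
    * change (solves (S := S) (ct_u prefix_control) (prefix_arc n) (fine (tr_time prefix_trajectory n)) s).
      have h4 : solves (S := S) (ct_u prefix_control) (prefix_arc n) (fine (tr_time e n) + t) s.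
        apply: after; rewrite ?addrK // ?lerDr //; by rewrite -lerBrDr.
      case: n tn {hns hsn hns' h1 h2 h3 fl} an a0 h4 => [|n] tn an a0 h4.
        rewrite [X in solves _ _ X]/=; apply: (@solves_cat _ _ _ _ _ _ _ 0 t) => //; first exact: ltW.
          by apply: sol0; rewrite t0 lexx.
        by move: h4; rewrite time0 add0r.
      by rewrite [X in solves _ _ X]/= fineD // tn.
  + move=> hlt; have [_ hj] := hf n.
    have hlt' : (tr_time e n.+1 < +oo)%E.
      exact: addr_ltpinfty hlt.
    have jt : jump_time prefix_trajectory n = jump_time e n + t.
      rewrite /jump_time /=; move: hlt' (time_ge0 tl n.+1); by case: (tr_time e n.+1).
    have j0 : 0 <= jump_time e n by rewrite fine_ge0 // (time_ge0 tl).
    have tjt : t <= jump_time e n + t by rewrite lerDr.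
    have pre : pre_jump prefix_trajectory n = pre_jump e n.
      by rewrite /pre_jump jt /= -/(prefix_arc n _) prefix_arc_after // addrK.
    have post : post_jump prefix_trajectory n = post_jump e n.
      by rewrite /post_jump jt /= addrK.
    have := hj hlt'; rewrite pre post /=; case: ifP => // _ [h1 h2 h3 h4]; split => //.
    by rewrite -h2.
- move=> n hn; rewrite ge_min.
  have hn' : (tr_time e n < +oo)%E.
    case: n hn => [|n] /= hn; first by rewrite time0 ltry.
    exact: addr_ltpinfty hn.
  have := hskip n hn'; rewrite ge_min => /orP[] h; apply/orP; [left|right] => /=.
    exact: leeD2r.
  exact: leeD2r.
split.
- by rewrite /= adde_ge0 ?lee_fin.
- move=> s s0; rewrite [tr_stop _]/= gt_shift => hs.
  change (~ sGamma (state_at prefix_trajectory s)).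
  have [st|ts] := leP s t.
    rewrite prefix_state_before ?s0 //; apply: yG; by rewrite s0.
  have st0 : 0 < s - t by rewrite subr_gt0.
  rewrite -(subrK t s) (tail_state_at tl' tl prefix_tail st0); apply: hs2 => //; exact: ltW.
- move=> s hs.
  have hs' : tr_stop e = (s - t)%:E.
    by move: hs => /=; case: (tr_stop e) => [r| |] //= [<-]; rewrite addrK.
  have st0 : 0 < s - t by move: live; rewrite hs' lte_fin.
  change (sGamma (state_at prefix_trajectory s)).
  rewrite -(subrK t s) (tail_state_at tl' tl prefix_tail st0); exact: hs3.
- move=> n /= hn.
  have hn' : (tr_time e n.+1 < +oo)%E.
    exact: addr_ltpinfty hn.
  by rewrite lteD2rE //; exact: hs4.
Qed.

End Prefix.

(** ** Prefixing a jump at time [0] *)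
(** [b] tells whether the new jump is autonomous. *)
Section Jump.
Variables (th : control S) (e : trajectory S) (q : nat) (x : 'rV[R]_(sdim S q)).
Variables (b : bool) (v : V1).
Hypothesis tj : trajectory_of th (tr_arc e 0 0) e.
Hypothesis Ox : Omega S q x.
Hypothesis Gx : ~ Gamma S q x.
Hypothesis Dz : D S (tr_mode e 0) (tr_arc e 0 0).
Hypothesis hb : if b then A S q x /\ arcst e 0 0 = mkstate (g S q x v) else C S q x.

Definition jump_control : control S :=
  Control (fun k => if b then if k is k'.+1 then ct_v th k' else v else ct_v th k)
    (fun k => if b then ct_time th k else if k is k'.+1 then ct_time th k' else 0%E)
    (fun k => if b then ct_dest th k else if k is k'.+1 then ct_dest th k' else arcst e 0 0)
    (@ct_measurable _ _ _ _ th).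

Definition jump_mode n : nat := if n is n'.+1 then tr_mode e n' else q.

Definition jump_arc n : R -> 'rV[R]_(sdim S (jump_mode n)) :=
  if n is n'.+1 then tr_arc e n' else fun _ => x.

Definition jump_trajectory : trajectory S :=
  @Trajectory _ _ _ S (fun n => if n is n'.+1 then tr_time e n' else 0%E)
    jump_mode jump_arc (fun n => if n is n'.+1 then tr_auto e n' else b) (tr_stop e).

Lemma jump_live : (0 < tr_stop e)%E.
Proof.
have [_ _ _ _ [h0 _ h _]] := tj; rewrite lt_neqAle h0 andbT; apply/eqP => h1.
have := h 0 (esym h1); rewrite -/(sGamma (state_at e 0)) (state_at0 tj) => Gz.
exact: (Gamma_D_disjoint hS Gz Dz).
Qed.

Lemma jump_timeline : timeline jump_trajectory.
Proof.
have tl := trajectory_timeline tj; have [time0 mono unb] := tl; split => //=.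
  by move=> [|n]; rewrite ?time0.
by move=> M; have [n hn] := unb M; exists n.+1.
Qed.

Lemma jump_n_auto n : n_auto jump_trajectory n.+1 = (b + n_auto e n)%N.
Proof. by rewrite n_autoS. Qed.

Lemma jump_n_ctrl n : n_ctrl jump_trajectory n.+1 = (~~ b + n_ctrl e n)%N.
Proof. by rewrite n_ctrlS. Qed.

Lemma jump_tail : tail_of 1 0 jump_control jump_trajectory th e.
Proof.
have [time0 _ _] := trajectory_timeline tj; split => //=.
- by rewrite time0.
- by move=> n; rewrite addn1 adde0.
- by move=> n s _; rewrite addn1 addr0.
- by move=> n; rewrite addn1.
- by move=> n; rewrite addn1 jump_n_auto; case: b.
- by move=> n; rewrite addn1 jump_n_ctrl; case: b.
- by move=> s _; rewrite addr0.
- by rewrite adde0.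
- exact: jump_live.
Qed.

Lemma jump_trajectory_of : trajectory_of jump_control x jump_trajectory.
Proof.
have tl := trajectory_timeline tj; have tl' := jump_timeline.
have [time0 mono unb] := tl; have [_ mono' unb'] := tl'.
have [_ _ hf hskip [hs1 hs2 hs3 hs4]] := tj.
split.
- by split.
- by split.
- move=> [|n]; split.
  + move=> s /= s0; rewrite time0 => s1 _.
    have {s0 s1} -> : s = 0 by apply/eqP; rewrite eq_le -!lee_fin s0 s1.
    split => //; first by rewrite ltxx.
    by move=> k; exact: (@solves_refl _ _ _ S q (ct_u th) (fun _ => x) 0 k).
  + move=> _; rewrite /post_jump /pre_jump /jump_time /= time0 /= /n_auto /n_ctrl !big_ord0.
    move: hb; rewrite -/(arcst e 0 0); case: b => // Cx; split => //.
  + by have [] := hf n.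
  + move=> hlt; have [_ /(_ hlt)] := hf n.
    rewrite jump_n_auto jump_n_ctrl /post_jump /pre_jump /jump_time /=.
    by case: ifP => _; case: b.
- move=> [|n] hn /=.
    rewrite time0 /n_ctrl big_ord0; have := hskip 0%N; rewrite time0 /n_ctrl big_ord0 => /(_ (ltry _)).
    move=> h; rewrite ge_min; apply/orP; left; case: b => //; apply: le_trans h.
    by rewrite le_min (time_ge0 tl) hs1.
  have := hskip n hn; rewrite jump_n_ctrl; by case: b.
split => //.
- move=> s s0 hs; change (~ sGamma (state_at jump_trajectory s)).
  move: s0; rewrite le_eqVlt => /orP[/eqP s0|s0].
    by subst s; rewrite state_atE (phase_at0 tl').
  by rewrite -[s]addr0 (tail_state_at tl' tl jump_tail s0); apply: hs2 => //; exact: ltW.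
- move=> s hs; have s0 : 0 < s by have := jump_live; rewrite -lte_fin -hs.
  change (sGamma (state_at jump_trajectory s)).
  by rewrite -[s]addr0 (tail_state_at tl' tl jump_tail s0); exact: hs3.
- move=> [|n] hn; first by rewrite /= time0; exact: jump_live.
  exact: hs4.
Qed.

Lemma jump_cost0 : jump_cost jump_control jump_trajectory 0 =
  if b then Ca S q x v else sCc (mkstate x) (arcst e 0 0).
Proof.
by rewrite /jump_cost /pre_jump /n_auto /n_ctrl /= !big_ord0; case: b.
Qed.

End Jump.

End Surgery.

(** * Trajectories of bounded cost *)

Section FirstHit.
Variables (R : realType) (n : nat) (y : R -> 'rV[R]_n) (B : set 'rV[R]_n).
Hypothesis cy : continuous y.
Hypothesis cB : closed B.

Lemma first_hit : (forall t, 0 <= t -> ~ B (y t)) \/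
  exists T, [/\ 0 <= T, B (y T) & forall s, 0 <= s < T -> ~ B (y s)].
Proof.
pose H := [set t : R | 0 <= t] `&` y @^-1` B.
have [h|h] := pselect (H !=set0); last first.
  by left => t t0 Bt; apply: h; exists t.
right; have cH : closed H.
  apply: closedI; first exact: closed_ge.
  by apply: closed_comp => // t _; exact: cy.
have iH : has_inf H by split => //; exists 0 => t [].
have [T0 BT] : H (inf H).
  suff : closure H (inf H) by rewrite -(closure_id H).1.
  move=> N /nbhs_ballP[d /= d0 hd].
  have [s Hs sd] := inf_adherent d0 iH; exists s; split => //; apply: hd.
  have hs : inf H <= s by exact: (ge_inf iH.2).
  by rewrite /ball /= distrC ger0_norm ?subr_ge0 // ltrBlDr addrC.
exists (inf H); split => // s /andP[s0 sT] Bs.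
have : inf H <= s by apply: (ge_inf iH.2); split.
by rewrite leNgt sT.
Qed.

End FirstHit.

Section Existence.
Variables (R : realType) (U V1 : metricType R) (S : hybrid_data U V1).
Hypothesis hS : standing_assumptions S.
Notation mu := (@lebesgue_measure R).
Variables (u0 : U) (v0 : V1).

Lemma mkstate_eta (z : state S) : mkstate (projT2 z) = z.
Proof. by case: z. Qed.

Lemma solves_speed q u (y : R -> 'rV[R]_(sdim S q)) a t (F : R) : a <= t ->
  (forall i (z : 'rV[R]_(sdim S i)) w, Omega S i z -> enorm (f S i z w) <= F) ->
  (forall s, a <= s <= t -> Omega S q (y s)) -> solves u y a t ->
  enorm (y t - y a) <= F * (t - a).
Proof.
move=> at_ hF yO sol; apply: (@enorm_integral_le _ _ (fun s => f S q (y s) (u s))) => //.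
- by move=> k; have [] := sol k.
- by move=> s hs; apply: hF; exact: yO.
- by move=> k; rewrite !mxE; have [_ ->] := sol k; rewrite addrC addKr.
Qed.

(** One phase under the constant control [u0]: [T] is the time at which it hits
    the autonomous jump set, [G] the time at which it reaches the target.  The one
    that comes second is replaced by [+oo]. *)
Record first_phase (z : state S) (y : R -> 'rV[R]_(sdim S (projT1 z))) (T G : \bar R) : Prop := FirstPhase {
  fp_start : y 0 = projT2 z;
  fp_T0 : (0 <= T)%E;
  fp_G0 : (0 < G)%E;
  fp_Omega : forall t : R, 0 <= t -> (t%:E <= T)%E -> (t%:E <= G)%E -> Omega S _ (y t);
  fp_solves : forall t : R, 0 <= t -> (t%:E <= T)%E -> (t%:E <= G)%E -> solves (fun _ => u0) y 0 t;
  fp_A : forall t : R, 0 <= t -> (t%:E < T)%E -> (t%:E <= G)%E -> ~ A S _ (y t);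
  fp_G : forall t : R, 0 <= t -> (t%:E <= T)%E -> (t%:E < G)%E -> ~ Gamma S _ (y t);
  fp_hitA : forall t : R, T = t%:E -> A S _ (y t);
  fp_hitG : forall t : R, G = t%:E -> Gamma S _ (y t);
  fp_one : T = +oo%E \/ G = +oo%E }.

(** The phase ends when the flow first meets [A], the target or the closure of the
    complement of [Omega].  In the last case the flow is still in [Omega], hence
    on its boundary, which is part of [A]. *)
Lemma first_phase_exists (z : state S) : Omega S _ (projT2 z) -> ~ Gamma S _ (projT2 z) ->
  exists y T G, first_phase (z := z) y T G.
Proof.
case: z => q x /= Ox Gx; have [y [cy y0 ysol]] := flow_exists hS u0 Ox.
pose B := A S q `|` Gamma S q `|` closure (~` Omega S q).
have cB : closed B.
  apply: closedU; last exact: closed_closure.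
  by apply: closedU; [exact: closed_A|exact: closed_Gamma].
have BnO t : ~ Omega S q (y t) -> B (y t) by right; exact: subset_closure.
have sol t : 0 <= t -> (forall s, 0 <= s <= t -> Omega S q (y s)) -> solves (fun _ => u0) y 0 t.
  by move=> t0 h k; have [h1 h2] := ysol t t0 h k; split => //; rewrite y0.
have [h|[T [T0 BT h]]] := first_hit cy cB.
  have hO t : 0 <= t -> Omega S q (y t) by move=> t0; apply: contrapT => /BnO; exact: h.
  exists y, +oo%E, +oo%E; split => //=.
  - by move=> t t0 _ _; exact: hO.
  - by move=> t t0 _ _; apply: sol => // s /andP[s0 _]; exact: hO.
  - by move=> t t0 _ _ At; apply: (h t t0); left; left.
  - by move=> t t0 _ _ At; apply: (h t t0); left; right.
  - by left.
have hO' t : 0 <= t < T -> Omega S q (y t) by move=> ht; apply: contrapT => /BnO; exact: h.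
have OT : Omega S q (y T).
  move: T0; rewrite le_eqVlt => /orP[/eqP <-|T0]; first by rewrite y0.
  rewrite (closure_id (Omega S q)).1; last exact: closed_Omega.
  move=> N NT; have := cy T _ NT => /nbhs_ballP[d /= d0 hd].
  pose s := Num.max 0 (T - d / 2).
  have d2 : 0 < d / 2 by rewrite divr_gt0.
  have sT : s < T by rewrite /s gt_max T0 ltrBlDr ltrDl.
  have s0 : 0 <= s by rewrite /s le_max lexx.
  exists (y s); split; first by apply: hO'; rewrite s0.
  apply: hd; rewrite /ball /= ger0_norm ?subr_ge0 ?(ltW sT) //.
  rewrite ltrBlDr -ltrBlDl; apply: (@lt_le_trans _ _ (T - d / 2)); last by rewrite /s le_max lexx orbT.
  by rewrite ltrD2l ltrN2 ltr_pdivrMr // ltr_pMr // ltr1n.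
have hO t : 0 <= t <= T -> Omega S q (y t).
  move=> /andP[t0]; rewrite le_eqVlt => /orP[/eqP -> //|tT]; by apply: hO'; rewrite t0.
have solT t : 0 <= t <= T -> solves (fun _ => u0) y 0 t.
  move=> /andP[t0 tT]; apply: sol => // s /andP[s0 st]; apply: hO.
  by rewrite s0 (le_trans st).
have hA t : 0 <= t < T -> ~ A S q (y t) by move=> /h hB At; apply: hB; left; left.
have hG t : 0 <= t < T -> ~ Gamma S q (y t) by move=> /h hB At; apply: hB; left; right.
have [GT|nGT] := pselect (Gamma S q (y T)).
  exists y, +oo%E, T%:E; split => //=.
  - rewrite lte_fin lt_neqAle T0 andbT; apply/eqP => T00.
    by apply: Gx; rewrite -y0 T00.
  - by move=> t t0 _; rewrite lee_fin => tT; apply: hO; rewrite t0.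
  - by move=> t t0 _; rewrite lee_fin => tT; apply: solT; rewrite t0.
  - move=> t t0 _; rewrite lee_fin le_eqVlt => /orP[/eqP ->|tT].
      exact: Gamma_A_disjoint GT.
    by apply: hA; rewrite t0.
  - by move=> t t0 _; rewrite lte_fin => tT; apply: hG; rewrite t0.
  - by move=> t [<-].
  - by left.
have AT : A S q (y T).
  case: BT => [[//|//]|cT]; apply: contrapT => nA; have := Omega_interior hS OT nA.
  by move=> /cT [w [nw]] /nw.
exists y, T%:E, +oo%E; split => //=.
- by move=> t t0 tT _; apply: hO; rewrite t0.
- by move=> t t0 tT _; apply: solT; rewrite t0.
- by move=> t t0 tT _; apply: hA; rewrite t0.
- move=> t t0 + _; rewrite lee_fin le_eqVlt => /orP[/eqP -> //|tT].
  by apply: hG; rewrite t0.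
- by move=> t [<-].
- by right.
Qed.

(** An arc that starts in [D] has to cover the distance from [D] to [A]. *)
Lemma first_phase_dwell (b F : R) (z : state S) y T G : first_phase (z := z) y T G ->
  0 < F ->
  (forall i (z : 'rV[R]_(sdim S i)) w, Omega S i z -> enorm (f S i z w) <= F) ->
  (forall q x y, A S q x -> D S q y -> b <= enorm (x - y)) ->
  D S _ (projT2 z) -> ((b / F)%:E <= T)%E.
Proof.
move=> fp F0 hF hb Dz; have := fp_T0 fp; case ET: T => [t| |] // t0; last by rewrite leey.
subst T; rewrite lee_fin ler_pdivrMr // mulrC.
have tG s : s <= t -> (s%:E <= G)%E.
  by have [//|->] := fp_one fp; rewrite leey.
have At := fp_hitA fp erefl; apply: le_trans (hb _ _ _ At Dz) _.
rewrite -(fp_start fp) -[t in leRHS]subr0.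
apply: (@solves_speed _ (fun _ => u0)) => //.
- move=> s /andP[s0 st]; apply: (fp_Omega fp) => //; exact: tG.
- apply: (fp_solves fp) => //; exact: tG.
Qed.

Definition choice_spec (z : state S) (p : (R -> 'rV[R]_(sdim S (projT1 z))) * (\bar R * \bar R)) : Prop :=
  Omega S _ (projT2 z) -> ~ Gamma S _ (projT2 z) -> first_phase p.1 p.2.1 p.2.2.

Lemma choice_exists (z : state S) : exists p, choice_spec (z := z) p.
Proof.
have [[Oz Gz]|h] := pselect (Omega S _ (projT2 z) /\ ~ Gamma S _ (projT2 z)).
  by have [y [T [G fp]]] := first_phase_exists Oz Gz; exists (y, (T, G)).
by exists (fun _ => projT2 z, (0%E, 0%E)) => O1 G1; exfalso; apply: h.
Qed.

Definition first_arc z : R -> 'rV[R]_(sdim S (projT1 z)) := (projT1 (cid (choice_exists z))).1.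
Definition hit_time z : \bar R := (projT1 (cid (choice_exists z))).2.1.
Definition reach_time z : \bar R := (projT1 (cid (choice_exists z))).2.2.

Lemma first_arcP z : Omega S _ (projT2 z) -> ~ Gamma S _ (projT2 z) ->
  first_phase (first_arc z) (hit_time z) (reach_time z).
Proof. by move=> Oz Gz; exact: (projT2 (cid (choice_exists z)) Oz Gz). Qed.

(** After a phase that never ends the state is repeated; the phases that would start
    there are dated [+oo], but all states of the sequence stay admissible. *)
Definition next_state (z : state S) : state S :=
  if hit_time z is EFin t then mkstate (g S _ (first_arc z t) v0) else z.

Section Assemble.
Variables (q : nat) (x : 'rV[R]_(sdim S q)).
Hypothesis Ox : Omega S q x.
Hypothesis Gx : ~ Gamma S q x.

Let s n : state S := iter n next_state (mkstate x).
Fixpoint auto_time n : \bar R := if n is n'.+1 then (auto_time n' + hit_time (s n'))%E else 0%E.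

Let stop : \bar R := ereal_inf [set (auto_time n + reach_time (s n))%E | n in [set: nat]].

Definition auto_trajectory : trajectory S :=
  @Trajectory _ _ _ S auto_time (fun n => projT1 (s n))
    (fun n t => first_arc (s n) (t - fine (auto_time n))) (fun _ => true) stop.

Lemma auto_control_measurable (O : set U) : open O ->
  measurable ([set t : R | 0 <= t] `&` (fun _ => u0) @^-1` O).
Proof.
move=> _; apply: measurableI; last by rewrite preimage_cst; case: ifP.
rewrite (_ : [set _ | _] = `[0, +oo[%classic) //.
by apply/seteqP; split => t /=; rewrite in_itv /= andbT.
Qed.

Definition auto_control : control S :=
  Control (fun _ => v0) (fun _ => +oo%E) (fun _ => mkstate x) auto_control_measurable.

Lemma auto_valid n : Omega S _ (projT2 (s n)) /\ ~ Gamma S _ (projT2 (s n)).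
Proof.
elim: n => [|n [On Gn]] //=; have fp := first_arcP On Gn.
rewrite -/(s n) /next_state; have := fp_hitA fp; case: (hit_time (s n)) => [t| |] //= /(_ t erefl) At.
have [hg _ _] := sa_transition hS; have Dg := hg _ _ v0 At.
by split; [exact: (D_Omega hS)|move=> Gg; exact: (Gamma_D_disjoint hS Gg Dg)].
Qed.

Let fp n : first_phase (first_arc (s n)) (hit_time (s n)) (reach_time (s n)) :=
  first_arcP (auto_valid n).1 (auto_valid n).2.

Lemma auto_time_ge0 n : (0 <= auto_time n)%E.
Proof. by elim: n => [|n IH] //=; rewrite adde_ge0 // (fp_T0 (fp n)). Qed.

Lemma auto_time_mono n : (auto_time n <= auto_time n.+1)%E.
Proof. by rewrite /= leeDl // (fp_T0 (fp n)). Qed.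

Lemma auto_time_fin n : (auto_time n.+1 < +oo)%E ->
  exists a t, [/\ auto_time n = a%:E, 0 <= a, hit_time (s n) = t%:E, 0 <= t & reach_time (s n) = +oo%E].
Proof.
move=> /= h; have := fp_one (fp n); move: h (auto_time_ge0 n) (fp_T0 (fp n)).
case: (auto_time n) => [a| |]; case: (hit_time (s n)) => [t| |] //= _.
by rewrite !lee_fin => a0 t0 -[//|->]; exists a, t.
Qed.

Lemma auto_post n a t : auto_time n = a%:E -> hit_time (s n) = t%:E ->
  s n.+1 = mkstate (g S _ (first_arc (s n) t) v0) /\
  D S (dest S (projT1 (s n))) (g S _ (first_arc (s n) t) v0).
Proof.
move=> ha ht; have At := fp_hitA (fp n) ht; have [hg _ _] := sa_transition hS.
by split; [rewrite [s n.+1]/= -/(s n) /next_state ht|exact: hg].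
Qed.

Lemma auto_time_dwell (b F : R) n : 0 < F -> 0 < b ->
  (forall i (z : 'rV[R]_(sdim S i)) w, Omega S i z -> enorm (f S i z w) <= F) ->
  (forall q x y, A S q x -> D S q y -> b <= enorm (x - y)) ->
  ((n%:R * (b / F))%:E <= auto_time n.+1)%E.
Proof.
move=> F0 b0 hF hb; elim: n => [|n IH]; first by rewrite mul0r; exact: auto_time_ge0.
have [h|h] := leP +oo%E (auto_time n.+1).
  by apply: le_trans (auto_time_mono n.+1); apply: le_trans h; rewrite leey.
have [a [t [ha a0 ht t0 _]]] := auto_time_fin h.
have [sE Dg] := auto_post ha ht.
rewrite -natr1 mulrDl mul1r EFinD; apply: leeD => //.
have Ds : D S _ (projT2 (s n.+1)) by rewrite sE.
exact: first_phase_dwell (fp n.+1) F0 hF hb Ds.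
Qed.

Lemma auto_timeline : timeline auto_trajectory.
Proof.
split => //; first exact: auto_time_mono.
have [F F0 hF] := speed_bound hS; have [b b0 [_ hb _ _ _]] := separation_constant hS.
move=> M; have bF : 0 < b / F by rewrite divr_gt0.
exists (Num.Def.archi_bound (`|M| / (b / F))).+1.
apply: lt_le_trans (auto_time_dwell _ F0 b0 hF hb).
rewrite lte_fin -ltr_pdivrMr //; apply: le_lt_trans (archi_boundP _).
  by rewrite ler_pM2r ?invr_gt0 // ler_norm.
by rewrite divr_ge0 // ltW.
Qed.

Lemma auto_stop_le n : (stop <= auto_time n + reach_time (s n))%E.
Proof. by apply: ereal_inf_lbound; exists n. Qed.

(** At most one phase contributes a finite term to the infimum that defines the
    reach time: a phase that reaches the target is never followed by a jump. *)
Lemma auto_stop_cases : stop = +oo%E \/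
  exists n, [/\ (auto_time n < +oo)%E, auto_time n.+1 = +oo%E & stop = (auto_time n + reach_time (s n))%E].
Proof.
have [[n hn]|h] := pselect (exists n, (auto_time n + reach_time (s n) < +oo)%E); last first.
  left; apply/eqP; rewrite eq_le leey /=; apply: le_ereal_inf_tmp => _ [n _ <-].
  by rewrite leNgt; apply/negP => hn; apply: h; exists n.
right; exists n.
have G0 := fp_G0 (fp n).
have an : (auto_time n < +oo)%E by apply: le_lt_trans hn; rewrite leeDl // ltW.
have Tn : auto_time n.+1 = +oo%E.
  apply/eqP; rewrite -[_ == _]negbK -ltey; apply/negP => /auto_time_fin[a [t [ha _ _ _ hG]]].
  by move: hn; rewrite hG ha.
split => //; apply/eqP; rewrite eq_le auto_stop_le /=; apply: le_ereal_inf_tmp => _ [m _ <-].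
have mono := time_mono auto_timeline.
have [nm|mn|-> //] := ltngtP n m.
  have -> : auto_time m = +oo%E.
    by have := mono _ _ nm; rewrite [tr_time _ n.+1]Tn leye_eq => /eqP.
  by rewrite addye ?leey // gt_eqF // (lt_trans _ (fp_G0 (fp m))) // ltNy0.
have /auto_time_fin[a [t [-> _ _ _ ->]]] : (auto_time m.+1 < +oo)%E by apply: le_lt_trans an; exact: (mono _ _ mn).
by rewrite addey // leey.
Qed.

Lemma auto_phase n t : (auto_time n <= t%:E)%E -> (t%:E <= auto_time n.+1)%E -> (t%:E <= stop)%E ->
  exists a, [/\ auto_time n = a%:E, 0 <= t - a, ((t - a)%:E <= hit_time (s n))%E & ((t - a)%:E <= reach_time (s n))%E].
Proof.
move=> h1 h2 h3; have tn := time_fin auto_timeline h1; exists (fine (auto_time n)).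
have h4 := le_trans h3 (auto_stop_le n).
move: h2 h4 h1; rewrite [auto_time n.+1]/= [tr_time _ _]/= in tn *; rewrite tn /=.
by rewrite lee_fin EFinB => h2 h4 h1; split; rewrite ?subr_ge0 // leeBlDl.
Qed.

Lemma auto_trajectory_of : trajectory_of auto_control x auto_trajectory.
Proof.
have tl := auto_timeline; have [_ mono unb] := tl.
split.
- by split => //=; rewrite subr0 (fp_start (fp 0%N)).
- by split.
- move=> n; split.
  + move=> t h1 h2 h3; have [a [ha t0 hT hG]] := auto_phase h1 h2 h3.
    split.
    * by rewrite /= ha; exact: (fp_Omega (fp n)).
    * rewrite /= -/(auto_time n) ha /= => h4; apply: (fp_A (fp n)) => //.
      by rewrite EFinB lteBlDl.
    * have sol := fp_solves (fp n) t0 hT hG.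
      change (solves (S := S) (fun _ => u0) (fun t => first_arc (s n) (t - fine (auto_time n))) (fine (auto_time n)) t).
      rewrite ha /= -[X in solves _ _ X _]add0r -[X in solves _ _ _ X](subrK a).
      apply/solves_shift; apply: (solves_ext t0 _ _ sol) => // r _.
      by rewrite addrK.
  + move=> h; have [a [t [ha a0 ht t0 _]]] := auto_time_fin h.
    have jt : jump_time auto_trajectory n = a + t by rewrite /jump_time /= ha ht.
    have pre : pre_jump auto_trajectory n = first_arc (s n) t.
      by rewrite /pre_jump jt /= ha /= addrC addKr.
    have [sE Dg] := auto_post ha ht.
    change (A S _ (pre_jump auto_trajectory n) /\ post_jump auto_trajectory n = mkstate (g S _ (pre_jump auto_trajectory n) v0)).
    split; first by rewrite pre; exact: (fp_hitA (fp n)).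
    rewrite pre /post_jump jt.
    have -> : mkstate (tr_arc auto_trajectory n.+1 (a + t)) = s n.+1.
      rewrite [tr_arc _ _]/= -/(s n) -/(s n.+1) -/(auto_time n.+1).
      have -> : fine (auto_time n.+1) = a + t by rewrite /= ha ht.
      change (mkstate (first_arc (s n.+1) (a + t - (a + t))) = s n.+1).
      by rewrite subrr (fp_start (fp n.+1)) mkstate_eta.
    exact: sE.
- by move=> n hn; rewrite leey.
split.
- apply: le_ereal_inf_tmp => _ [n _ <-]; rewrite adde_ge0 ?auto_time_ge0 // ltW //.
  exact: fp_G0 (fp n).
- move=> t t0 hs.
  have [h1 h2] : (auto_time (phase_at auto_trajectory t) <= t%:E)%E /\ (t%:E <= auto_time (phase_at auto_trajectory t).+1)%E.
    move: (t0); rewrite le_eqVlt => /orP[/eqP <-|tp].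
      by rewrite (phase_at0 tl); split => //; exact: auto_time_ge0.
    by have [/ltW] := phase_atP tl tp.
  set n := phase_at _ _ in h1 h2.
  have [a [ha ta hT hG]] := auto_phase h1 h2 (ltW hs).
  change (~ Gamma S _ (tr_arc auto_trajectory n t)).
  rewrite /= ha; apply: (fp_G (fp n)) => //.
  have := lt_le_trans hs (auto_stop_le n); rewrite ha EFinB => h; by rewrite lteBlDl.
- move=> t hs; have [hy|[n [an Tn hn]]] := auto_stop_cases; first by move: hs; rewrite /= hy.
  have G0 := fp_G0 (fp n); have a0 := auto_time_ge0 n.
  have [a [ea eG]] : exists a, auto_time n = a%:E /\ reach_time (s n) = (t - a)%:E.
    move: hs; rewrite /= hn; move: an a0 G0.
    case: (auto_time n) => [a| |] // _ _; case: (reach_time (s n)) => [r| |] // _ [<-].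
    by exists a; split => //; rewrite addrAC subrr add0r.
  have at_ : a < t by move: G0; rewrite eG lte_fin subr_gt0.
  have ph : phase_at auto_trajectory t = n.
    apply: (phase_atE tl); first by rewrite [tr_time _ _]ea lte_fin.
    by rewrite [tr_time _ _]Tn leey.
  change (sGamma (state_at auto_trajectory t)).
  rewrite state_atE ph /arcst /sGamma /= ea /=; exact: (fp_hitG (fp n)).
- move=> n hn; have [hy|[m [am Tm hm]]] := auto_stop_cases; first by rewrite [tr_stop _]hy.
  have nm : (n.+1 <= m)%N.
    rewrite leqNgt; apply/negP => mn; move: hn.
    have := time_mono tl mn; rewrite [tr_time _ m.+1]Tm leye_eq => /eqP ->.
    by rewrite ltxx.
  apply: (le_lt_trans (time_mono tl nm)); rewrite [tr_stop _]hm /=.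
  have := fp_G0 (fp m); have := auto_time_ge0 m; move: am.
  case: (auto_time m) => [a| |] // _ _; case: (reach_time (s m)) => [r| |] //.
    by rewrite !lte_fin ltrDl.
  by move=> _; exact: ltry.
Qed.

End Assemble.

(** The target is reached from outside, so on its boundary. *)
Lemma stop_dom th e q (x : 'rV[R]_(sdim S q)) s : trajectory_of th x e -> dom S q x ->
  tr_stop e = s%:E -> dom S _ (projT2 (state_at e s)).
Proof.
move=> tj dx hs; have tl := trajectory_timeline tj; have [_ _ _ _ [s0 hG _ _]] := tj.
move: s0; rewrite hs lee_fin le_eqVlt => /orP[/eqP <-|s0]; first by rewrite (state_at0 tj).
have [h1 h2] := phase_atP tl s0.
rewrite state_atE; set n := phase_at e s in h1 h2 *; have tn := time_fin tl (ltW h1).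
set a := fine _ in tn; have as_ : a < s by rewrite -lte_fin -tn.
have a0 : 0 <= a by rewrite fine_ge0 // (time_ge0 tl).
have [F F0 hF] := speed_bound hS.
move=> N /nbhs_enormP[r r0 hN].
pose s' := Num.max ((a + s) / 2) (s - r / (2 * F)).
have F2 : 0 < r / (2 * F) by rewrite divr_gt0 // mulr_gt0.
have s's : s' < s by rewrite /s' gt_max; apply/andP; split; lra.
have as' : a < s' by rewrite /s' lt_max; apply/orP; left; lra.
have ph : phase e n s'.
  split; first by rewrite tn lte_fin.
  by split; [apply: le_trans h2|rewrite hs]; rewrite lee_fin ltW.
exists (tr_arc e n s'); split.
  split; first exact: (phase_Omega tj).
  change (~ sGamma (arcst e n s')); rewrite -(state_at_phase tj ph).
  by apply: hG; [lra|rewrite hs lte_fin].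
apply: hN; apply: le_lt_trans (_ : F * (s - s') < r).
  by apply: (arc_speed tj hF) => //; rewrite ?tn ?hs ?lee_fin // ltW.
have h : s - s' <= r / (2 * F) by rewrite lerBlDr -lerBlDl /s' le_max lexx orbT.
apply: (@le_lt_trans _ _ (F * (r / (2 * F)))); first by rewrite ler_pM2l.
rewrite (_ : F * (r / (2 * F)) = r / 2); last by field; rewrite gt_eqF.
lra.
Qed.

Lemma terminal_bound : exists2 H, 0 <= H & forall z, bdry (Gamma S (tgt S)) z -> h S (tgt S) z <= H.
Proof.
have [_ _ cB _ _] := sa_target hS; have [ch h0] := sa_terminal_cost hS.
have [[z0 Bz0]|nB] := pselect (bdry (Gamma S (tgt S)) !=set0); last first.
  by exists 0 => // z Bz; exfalso; apply: nB; exists z.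
have cb : {within bdry (Gamma S (tgt S)), continuous (h S (tgt S))}.
  by apply: continuous_subspaceW ch; exact: bdry_Gamma_sub.
have [c] := compact_EVT_max (ex_intro _ z0 Bz0) cB cb; rewrite inE => Bc hc.
exists (h S (tgt S) c) => [|z Bz]; first by apply: h0; exact: (bdry_Gamma_sub hS).
by apply: hc; rewrite inE.
Qed.

Lemma final_le th e q (x : 'rV[R]_(sdim S q)) H : trajectory_of th x e -> dom S q x -> 0 <= H ->
  (forall z, bdry (Gamma S (tgt S)) z -> h S (tgt S) z <= H) -> final e <= H.
Proof.
move=> tj dx H0 hH; rewrite /final; case hst: (tr_stop e) => [s| |] //.
have [_ _ _ _ [s0 _ hG _]] := tj; have := hG s hst; rewrite -/(sGamma (state_at e s)).
have := stop_dom tj dx hst.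
case: (state_at e s) => i z /= dz Gz; rewrite /sGamma /= in Gz.
have ei := Gamma_tgt hS Gz; subst i; rewrite /sh /=.
have hz := hH z (dom_Gamma_bdry dz Gz).
apply: (@le_trans _ _ (expR (- lambda S * s) * H)); first by rewrite ler_pM2l ?expR_gt0.
rewrite -[leRHS]mul1r ler_wpM2r // expR_le1 mulNr oppr_le0.
by rewrite mulr_ge0 ?(ltW (sa_lambda hS)) //; move: s0; rewrite hst lee_fin.
Qed.

(** Successive forced jumps are at least [b / F] apart, so their discounted costs are
    dominated by a geometric series; the running cost is bounded by [K1 / lambda]
    and the terminal cost by the maximum of [h] over the compact boundary of the
    target. *)
Lemma auto_cost_bound : exists B : R, forall q (x : 'rV[R]_(sdim S q)), Omega S q x -> ~ Gamma S q x ->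
  exists th e, trajectory_of th x e /\ (cost th e <= B%:E)%E.
Proof.
have [K1 K10 hK1] := running_cost_bound hS.
have [_ _ _ [_ [C0 hC0]] _] := sa_switching_costs hS.
have [F F0 hF] := speed_bound hS; have [b b0 [_ hb _ _ _]] := separation_constant hS.
have [H H0 hH] := terminal_bound; have l0 := sa_lambda hS.
pose C1 := Num.max C0 0.
have C10 : 0 <= C1 by rewrite le_max lexx orbT.
pose tau := b / F; have tau0 : 0 < tau by rewrite divr_gt0.
pose r := expR (- lambda S * tau).
have r1 : r < 1 by rewrite expR_lt1 mulNr oppr_lt0 mulr_gt0.
have r0 : 0 < r by exact: expR_gt0.
exists (K1 / lambda S + C1 * (1 - r)^-1 + H) => q x Ox Gx.
have tj := auto_trajectory_of Ox Gx.
set th := auto_control x in tj *; set e := auto_trajectory x in tj *.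
exists th, e; split => //.
have [_ hrun] := run_bound hS tj K10 hK1.
rewrite (costE hS tj) !EFinD; apply: leeD; last first.
  by rewrite lee_fin (final_le tj) //; exact: Omega_dom.
apply: leeD; first by apply: le_trans hrun; exact: lee_abs.
have term n : (jump_term th e n <= (C1 * r ^+ n)%:E)%E.
  rewrite /jump_term; case: ifPn => hn; last by rewrite lee_fin mulr_ge0 // exprn_ge0 // ltW.
  have hn' := lt_stop_fin hn.
  have [_ _ hf _ _] := tj; have [_ /(_ hn') [Ax _]] := hf n.
  rewrite lee_fin /jump_cost /=; apply: ler_pM; rewrite ?expR_ge0 //.
  - have [_ _ [c c0 [hCa _]] _ _] := sa_switching_costs hS.
    by apply: le_trans (ltW c0) _; exact: hCa.
  - apply: (@le_trans _ _ C0); last by rewrite le_max lexx.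
    by apply: le_trans (ler_norm _) _; exact: hC0.
  - rewrite /r -expRM_natl ler_expR mulrCA ler_nM2l ?oppr_lt0 // -lee_fin.
    have tf : tr_time e n.+1 = (jump_time e n)%:E.
      by rewrite /jump_time fineK // ge0_fin_numE // (time_ge0 (trajectory_timeline tj)).
    by rewrite -tf; exact: (auto_time_dwell Ox Gx n F0 b0 hF hb).
apply: lime_le.
  by apply: is_cvg_nneseries => n _ _; exact: (jump_term_ge0 hS tj).
apply: nearW => n.
apply: le_trans (_ : (\sum_(0 <= i < n) (C1 * r ^+ i)%:E <= _)%E); first exact: lee_sum.
rewrite sumEFin lee_fin; apply: (geometric_le_lim n C10 r0).
by rewrite ger0_norm // ltW.
Qed.

End Existence.

(** * Finiteness of the value and dynamic programming *)

Section Value.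
Variables (R : realType) (U V1 : metricType R) (S : hybrid_data U V1).
Hypothesis hS : standing_assumptions S.
Notation mu := (@lebesgue_measure R).
Implicit Types (th : control S) (e : trajectory S).

(** Substituting this equation between states identifies the initial mode and the
    initial position together, without transport between modes. *)
Lemma start_state th (z : state S) e : trajectory_of th (projT2 z) e -> z = arcst e 0 0.
Proof. by move=> [[_ h] _ _ _ _]; rewrite /arcst h mkstate_eta. Qed.

Lemma value_le_cost th q (x : 'rV[R]_(sdim S q)) e : trajectory_of th x e -> (value S q x <= cost th e)%E.
Proof. by move=> tj; apply: ereal_inf_lbound; exists th, e. Qed.

Lemma value_ge_bound q (x : 'rV[R]_(sdim S q)) (c : \bar R) :
  (forall th e, trajectory_of th x e -> (c <= cost th e)%E) -> (c <= value S q x)%E.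
Proof. by move=> h; apply: le_ereal_inf_tmp => _ [th [e [tj ->]]]; exact: h. Qed.

(** The evolution is over at time [0], before any jump. *)
Lemma target_cost th q (x : 'rV[R]_(sdim S q)) e : trajectory_of th x e -> Gamma S q x ->
  cost th e = (h S q x)%:E.
Proof.
move=> tj Gx; have tl := trajectory_timeline tj; have [_ _ _ _ [s0 hG _ hj]] := tj.
have st : tr_stop e = 0%E.
  apply/eqP; rewrite eq_le s0 andbT leNgt; apply/negP => sp.
  have := hG 0 (lexx _) sp; rewrite -/(sGamma (state_at e 0)) (state_at0 tj); exact.
rewrite (costE hS tj).
have -> : life e = [set 0].
  apply/seteqP; split => [s [h1]|s ->]; rewrite /life /= st ?lee_fin // => h2.
  by apply/eqP; rewrite eq_le h1 h2.
rewrite integral_set1 add0e eseries0 => [|n _ _]; last first.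
  by rewrite /jump_term st ltNge (time_ge0 tl).
by rewrite add0e /final st /= mulr0 expR0 mul1r (state_at0 tj).
Qed.

Lemma target_trajectory (u0 : U) (v0 : V1) q (x : 'rV[R]_(sdim S q)) : Gamma S q x ->
  exists th e, trajectory_of th x e.
Proof.
move=> Gx.
pose e := @Trajectory _ _ _ S (fun n => if n is _.+1 then +oo%E else 0%E) (fun _ => q) (fun _ _ => x) (fun _ => true) 0%E.
have tl : timeline e.
  by split => //; [case=> [|n] /=; rewrite leey|move=> M; exists 1%N; rewrite ltry].
exists (auto_control u0 v0 x), e; have [_ h1 h2] := tl; split => //.
- move=> [|n]; split => //=.
  + move=> t /=; rewrite !lee_fin => t0 _ t1.
    have {t0 t1} -> : t = 0 by apply/eqP; rewrite eq_le t0 t1.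
    split; first exact: (Gamma_Omega hS).
      by move=> _; exact: (Gamma_A_disjoint hS).
    by move=> k; exact: (@solves_refl _ _ _ S q (fun _ => u0) (fun _ => x) 0 k).
- by move=> n _; rewrite leey.
split => //.
- by move=> t t0; rewrite lte_fin ltNge t0.
Qed.

Lemma value_Gamma q (x : 'rV[R]_(sdim S q)) : Gamma S q x -> value S q x = (h S q x)%:E.
Proof.
move=> Gx; have [_ [u0 _] _ [v0 _]] := sa_control_sets hS.
apply/eqP; rewrite eq_le; apply/andP; split.
  have [th [e tj]] := target_trajectory u0 v0 Gx.
  by rewrite -(target_cost tj Gx); exact: value_le_cost.
by apply: value_ge_bound => th e tj; rewrite (target_cost tj Gx).
Qed.

Lemma value_bounded : exists B : R, forall q x, dom S q x -> exists2 w, value S q x = w%:E & `|w| <= B.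
Proof.
have [_ [u0 _] _ [v0 _]] := sa_control_sets hS.
have [K1 K10 hK1] := running_cost_bound hS.
have [B hB] := auto_cost_bound hS u0 v0; have [H H0 hH] := terminal_bound hS.
exists (`|B| + H + K1 / lambda S) => q x dx.
have KL : 0 <= K1 / lambda S by rewrite divr_ge0 // ltW // (sa_lambda hS).
have lo : ((- (K1 / lambda S))%:E <= value S q x)%E.
  by apply: value_ge_bound => th e tj; exact: (cost_ge hS tj).
have up : (value S q x <= (`|B| + H)%:E)%E.
  have [Gx|nGx] := pselect (Gamma S q x).
    rewrite value_Gamma // lee_fin; apply: (@le_trans _ _ H); last by rewrite lerDr.
    have ei := Gamma_tgt hS Gx; subst q; apply: hH; exact: dom_Gamma_bdry.
  have [th [e [tj hc]]] := hB q x (dom_Omega hS dx) nGx.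
  apply: (le_trans (value_le_cost tj)); apply: (le_trans hc).
  by rewrite lee_fin; apply: le_trans (ler_norm _) _; rewrite lerDl.
move: lo up; case: (value S q x) => [w| |] //; rewrite !lee_fin => lo up.
exists w => //; rewrite ler_norml; apply/andP; split; first by have := normr_ge0 B; lra.
by lra.
Qed.

Definition fvalue q (x : 'rV[R]_(sdim S q)) : R := fine (value S q x).
Definition svalue (z : state S) : R := fvalue (projT2 z).

Lemma fvalueE q x : dom S q x -> value S q x = (fvalue x)%:E.
Proof. by have [B hB] := value_bounded => /hB[w h _]; rewrite /fvalue h. Qed.

Lemma fvalue_le th q (x : 'rV[R]_(sdim S q)) e : dom S q x -> trajectory_of th x e ->
  ((fvalue x)%:E <= cost th e)%E.
Proof. by move=> dx tj; rewrite -fvalueE //; exact: value_le_cost. Qed.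

Lemma fvalue_near q (x : 'rV[R]_(sdim S q)) (eps : R) : dom S q x -> 0 < eps ->
  exists th e r, [/\ trajectory_of th x e, cost th e = r%:E & r <= fvalue x + eps].
Proof.
move=> dx e0; have vE := fvalueE dx.
have vf : value S q x \is a fin_num by rewrite vE.
have [_ [th [e [tj ->]]] hlt] := lb_ereal_inf_adherent e0 vf.
rewrite -/(value S q x) vE in hlt.
have := fvalue_le dx tj; move: hlt; case hc: (cost th e) => [r| |] // h1 h2.
by exists th, e, r; split => //; rewrite ltW.
Qed.

(** ** Cutting the cost functional *)

Definition flow_cost q (y : R -> 'rV[R]_(sdim S q)) (u : R -> U) t : R :=
  \int[mu]_(s in `[0, t]) (K S q (y s) (u s) * expR (- lambda S * s)).

Lemma run_first_phase th q (x : 'rV[R]_(sdim S q)) e t : trajectory_of th x e -> 0 <= t ->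
  (t%:E <= tr_time e 1)%E -> (t%:E <= tr_stop e)%E ->
  mu.-integrable `[0, t] (EFin \o (fun s => K S _ (tr_arc e 0 s) (ct_u th s) * expR (- lambda S * s))) /\
  (\int[mu]_(s in `[0%R, t]) (run th e s)%:E)%E = (flow_cost (tr_arc e 0) (ct_u th) t)%:E.
Proof.
move=> tj t0 t1 ts; have tl := trajectory_timeline tj; have [time0 _ _] := tl.
have [K1 K10 hK1] := running_cost_bound hS.
have [hi _] := run_bound hS tj K10 hK1.
have runE s : s \in `[0, t]%classic -> run th e s = K S _ (tr_arc e 0 s) (ct_u th s) * expR (- lambda S * s).
  rewrite inE /= in_itv /= => /andP[s0 st]; rewrite /run.
  have -> // : state_at e s = arcst e 0 s.
  rewrite state_atE; congr (arcst e _ s).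
  move: s0; rewrite le_eqVlt => /orP[/eqP <-|s0]; first exact: phase_at0.
  by apply: (phase_atE tl); rewrite ?time0 ?lte_fin //; apply: le_trans t1; rewrite lee_fin.
have hi' : mu.-integrable `[0, t] (EFin \o run th e).
  apply: integrableS hi => //; first exact: measurable_life.
  move=> s /=; rewrite in_itv /= => /andP[s0 st]; split => //.
  by apply: le_trans ts; rewrite lee_fin.
have hi2 : mu.-integrable `[0, t] (EFin \o (fun s => K S _ (tr_arc e 0 s) (ct_u th s) * expR (- lambda S * s))).
  by apply: eq_integrable hi' => // s hs; rewrite /= runE.
split => //; rewrite /flow_cost /Rintegral fineK; last exact: integrable_fin_num.
by apply: eq_integral => s hs; rewrite runE.
Qed.

Lemma cost_tail_flow th e q (x : 'rV[R]_(sdim S q)) th' e' q' (x' : 'rV[R]_(sdim S q')) t :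
  trajectory_of th x e -> trajectory_of th' x' e' -> tail_of 0 t th e th' e' ->
  (t%:E <= tr_time e 1)%E ->
  cost th e = ((flow_cost (tr_arc e 0) (ct_u th) t)%:E + (expR (- lambda S * t))%:E * cost th' e')%E.
Proof.
move=> tj tj' ht t1; have ts : (t%:E <= tr_stop e)%E.
  by rewrite (tail_stop ht) -[leLHS]add0e leeD2rE // ltW // (tail_live ht).
rewrite (cost_tail hS tj tj' ht) big_ord0 adde0.
by have [_ ->] := run_first_phase tj (tail_t0 ht) t1 ts.
Qed.

Lemma cost_tail_jump th e q (x : 'rV[R]_(sdim S q)) th' e' q' (x' : 'rV[R]_(sdim S q')) :
  trajectory_of th x e -> trajectory_of th' x' e' -> tail_of 1 0 th e th' e' ->
  tr_time e 1 = 0%E -> cost th e = ((jump_cost th e 0)%:E + cost th' e')%E.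
Proof.
move=> tj tj' ht t1; rewrite (cost_tail hS tj tj' ht) set_itv1 integral_set1 add0e.
rewrite big_ord_recl big_ord0 adde0 mulr0 expR0 mul1e /jump_term t1.
have -> : (0 < tr_stop e)%E by rewrite (tail_stop ht) adde0 (tail_live ht).
by rewrite /jump_time t1 /= mulr0 expR0 mulr1.
Qed.

(** ** Dynamic programming inequalities *)

(** A nearly optimal trajectory from [y t], preceded by the flow up to time [t], is a
    competitor at [y 0]. *)
Lemma value_flow q (y : R -> 'rV[R]_(sdim S q)) t u0 : 0 <= t ->
  (forall s, 0 <= s <= t -> Omega S q (y s)) ->
  (forall s, 0 <= s <= t -> ~ Gamma S q (y s)) ->
  (forall s, 0 <= s < t -> ~ A S q (y s)) ->
  (forall s, 0 <= s <= t -> solves (fun _ => u0) y 0 s) ->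
  mu.-integrable `[0, t] (EFin \o (fun s => K S q (y s) u0 * expR (- lambda S * s))) /\
  fvalue (y 0) <= flow_cost y (fun _ => u0) t + expR (- lambda S * t) * fvalue (y t).
Proof.
move=> t0 yO yG yA ysol.
have t00 : (0 : R) <= 0 <= t by apply/andP.
have ttt : 0 <= t <= t by rewrite t0 lexx.
have d0 : dom S q (y 0) by apply: Omega_dom; [exact: yO|exact: yG].
have dt : dom S q (y t) by apply: Omega_dom; [exact: yO|exact: yG].
suff key eps : 0 < eps -> mu.-integrable `[0, t] (EFin \o (fun s => K S q (y s) u0 * expR (- lambda S * s))) /\
    fvalue (y 0) <= flow_cost y (fun _ => u0) t + expR (- lambda S * t) * fvalue (y t) + eps.
  by split; [have [] := key 1 ltr01|apply/ler_addgt0Pr => eps /key []].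
move=> e0; have [th [e [r [tj hr hle]]]] := fvalue_near dt e0.
have : mu.-integrable `[0, t] (EFin \o (fun s => K S q (y s) u0 * expR (- lambda S * s))) /\
    fvalue (y 0) <= flow_cost y (fun _ => u0) t + expR (- lambda S * t) * r.
  pose P (z : state S) := forall y : R -> 'rV[R]_(sdim S (projT1 z)), y t = projT2 z ->
    (forall s, 0 <= s <= t -> Omega S _ (y s)) ->
    (forall s, 0 <= s <= t -> ~ Gamma S _ (y s)) ->
    (forall s, 0 <= s < t -> ~ A S _ (y s)) ->
    (forall s, 0 <= s <= t -> solves (fun _ => u0) y 0 s) -> dom S _ (y 0) ->
    mu.-integrable `[0, t] (EFin \o (fun s => K S _ (y s) u0 * expR (- lambda S * s))) /\
    fvalue (y 0) <= flow_cost y (fun _ => u0) t + expR (- lambda S * t) * r.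
  suff hP : forall z : state S, trajectory_of th (projT2 z) e -> P z.
    exact: (hP (mkstate (y t)) tj y erefl yO yG yA ysol d0).
  move=> z tj'; have ez := start_state tj'; subst z.
  move=> y' yt' yO' yG' yA' ysol' d0'.
  have live : (0 < tr_stop e)%E.
    have [_ _ _ _ [s0 _ hG _]] := tj'; rewrite lt_neqAle s0 andbT; apply/eqP => s00.
    apply: (yG' t ttt); have := hG 0 (esym s00); rewrite -/(sGamma (state_at e 0)) (state_at0 tj') yt'.
    exact.
  have tj2 := prefix_trajectory_of tj' t0 live yt' yO' yG' yA' ysol'.
  have ht := prefix_tail th y' u0 t0 live.
  have t1 := prefix_le_time1 y' t tj'.
  have arcE s : s \in `[0, t]%classic -> K S _ (tr_arc (prefix_trajectory y' t) 0 s) (ct_u (prefix_control th u0 t0) s) = K S _ (y' s) u0.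
    rewrite inE /= in_itv /= => /andP[s0 st].
    by rewrite -/(prefix_arc y' t 0 s) prefix_arc_before // st.
  have stop2 : (t%:E <= tr_stop (prefix_trajectory y' t))%E.
    by rewrite /= -[leLHS]add0e leeD2r // ltW.
  have [hi _] := run_first_phase tj2 t0 t1 stop2.
  split; first by apply: eq_integrable hi => // s hs; rewrite /= -/(tr_arc (prefix_trajectory y' t) 0 s) -arcE.
  rewrite -lee_fin; apply: (le_trans (fvalue_le d0' tj2)).
  rewrite (cost_tail_flow tj2 tj' ht t1) hr -EFinM -EFinD lee_fin lerD2r.
  rewrite le_eqVlt; apply/orP; left; apply/eqP; apply: eq_Rintegral => s hs.
  by rewrite (arcE s hs).
move=> [hi h1]; split => //; apply: (le_trans h1); rewrite -addrA lerD2l.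
have k1 : expR (- lambda S * t) <= 1.
  by rewrite expR_le1 mulNr oppr_le0 mulr_ge0 // ltW // (sa_lambda hS).
apply: (@le_trans _ _ (expR (- lambda S * t) * (fvalue (y t) + eps))); first by rewrite ler_wpM2l ?expR_ge0.
by rewrite mulrDr lerD2l -[leRHS]mul1r ler_wpM2r // ltW.
Qed.

Lemma value_jump q (x : 'rV[R]_(sdim S q)) b v (z : state S) : Omega S q x -> ~ Gamma S q x ->
  D S _ (projT2 z) -> (if b then A S q x /\ z = mkstate (g S q x v) else C S q x) ->
  fvalue x <= (if b then Ca S q x v else sCc (mkstate x) z) + svalue z.
Proof.
move=> Ox Gx Dz hb; have dx := Omega_dom Ox Gx; have dz := D_dom hS Dz.
apply/ler_addgt0Pr => eps e0; have [th [e [r [tj hr hle]]]] := fvalue_near dz e0.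
suff : fvalue x <= (if b then Ca S q x v else sCc (mkstate x) z) + r.
  by move=> h1; apply: (le_trans h1); rewrite -addrA lerD2l.
move: hle => _; have ez := start_state tj; subst z.
have tj2 := jump_trajectory_of hS tj Ox Gx Dz hb.
have ht := jump_tail hS x b v tj Dz.
have [t0 _ _] := trajectory_timeline tj.
rewrite -lee_fin; apply: (le_trans (fvalue_le dx tj2)).
by rewrite (cost_tail_jump tj2 tj ht) // hr jump_cost0 EFinD.
Qed.

Lemma drop_value th e q (x : 'rV[R]_(sdim S q)) : trajectory_of th x e -> tr_time e 1 = 0%E ->
  ((jump_cost th e 0 + svalue (arcst e 1 0))%:E <= cost th e)%E.
Proof.
move=> tj t1; have tj' := drop_trajectory_of hS tj t1.
have [s es Ds] := drop_start hS tj t1; subst s.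
rewrite (cost_tail_jump tj tj' (drop_tail tj t1) t1) EFinD leeD2l //.
by apply: fvalue_le => //; exact: (D_dom hS).
Qed.

(** A trajectory that starts in [A] must jump at once, and the jump cannot be a
    controlled one since [A] and [C] are disjoint. *)
Lemma autonomous_start th e q (x : 'rV[R]_(sdim S q)) : trajectory_of th x e -> A S q x ->
  exists v, ((Ca S q x v + fvalue (g S q x v))%:E <= cost th e)%E.
Proof.
move=> tj Ax; pose P (z : state S) := exists v,
  ((Ca S _ (projT2 z) v + fvalue (g S _ (projT2 z) v))%:E <= cost th e)%E.
suff hP : forall z : state S, trajectory_of th (projT2 z) e -> A S _ (projT2 z) -> P z.
  exact: (hP (mkstate x) tj Ax).
move=> z {tj Ax x q}tj Az; have ez := start_state tj; subst z.
have tl := trajectory_timeline tj; have [time0 mono _] := tl.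
have [_ _ hf _ [s0 _ hG hstop]] := tj.
have [fl hj] := hf 0%N.
have t1 : tr_time e 1 = 0%E.
  apply/eqP; rewrite eq_le (time_ge0 tl) andbT leNgt; apply/negP => t1.
  have [_ h _] : [/\ Omega S _ (tr_arc e 0 0), (0%:E < tr_time e 1)%E -> ~ A S _ (tr_arc e 0 0) & True].
    by have [|||h1 h2 _] := fl 0; rewrite ?time0 ?(ltW t1).
  exact: (h t1 Az).
have lt1 : (tr_time e 1 < +oo)%E by rewrite t1 ltry.
have := drop_value tj t1; have := hj lt1; rewrite /jump_cost /post_jump /pre_jump /jump_time t1 /=.
rewrite -[mkstate (tr_arc e 1 0)]/(arcst e 1 0); case: ifP => _.
  move=> [_ ->] h; exists (ct_v th (n_auto e 0)); exact: h.
by move=> [Cx _ _ _]; exfalso; exact: (A_C_disjoint hS Az Cx).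
Qed.

(** Far from the autonomous jump set and from the target, the only event that can
    end the first phase before time [t] is a controlled jump; cutting the
    trajectory at that jump, or else at time [t], bounds its cost from below by
    the value function at the place of the cut. *)
Lemma first_piece th e q (x : 'rV[R]_(sdim S q)) t F : trajectory_of th x e -> 0 <= t ->
  (forall i (z : 'rV[R]_(sdim S i)) u, Omega S i z -> enorm (f S i z u) <= F) ->
  (forall y, enorm (y - x) <= F * t -> ~ A S q y /\ ~ Gamma S q y) ->
  exists (y : R -> 'rV[R]_(sdim S q)) (u : R -> U) tau,
    [/\ 0 <= tau <= t, y 0 = x, forall s, 0 <= s <= tau -> Omega S q (y s) /\ enorm (y s - x) <= F * s,
      solves u y 0 tau /\
      mu.-integrable `[0, tau] (EFin \o (fun s => K S q (y s) (u s) * expR (- lambda S * s))) &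
      (tau = t /\ ((flow_cost y u t + expR (- lambda S * t) * fvalue (y t))%:E <= cost th e)%E) \/
      (C S q (y tau) /\ exists2 z : state S, D S _ (projT2 z) &
        ((flow_cost y u tau + expR (- lambda S * tau) * (sCc (mkstate (y tau)) z + svalue z))%:E <= cost th e)%E)].
Proof.
move=> tj t0 hF hfree.
pose P (z : state S) := (forall y, enorm (y - projT2 z) <= F * t -> ~ A S _ y /\ ~ Gamma S _ y) ->
  exists (y : R -> 'rV[R]_(sdim S (projT1 z))) (u : R -> U) tau,
    [/\ 0 <= tau <= t, y 0 = projT2 z, forall s, 0 <= s <= tau -> Omega S _ (y s) /\ enorm (y s - projT2 z) <= F * s,
      solves u y 0 tau /\
      mu.-integrable `[0, tau] (EFin \o (fun s => K S _ (y s) (u s) * expR (- lambda S * s))) &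
      (tau = t /\ ((flow_cost y u t + expR (- lambda S * t) * fvalue (y t))%:E <= cost th e)%E) \/
      (C S _ (y tau) /\ exists2 z : state S, D S _ (projT2 z) &
        ((flow_cost y u tau + expR (- lambda S * tau) * (sCc (mkstate (y tau)) z + svalue z))%:E <= cost th e)%E)].
suff hP : forall z : state S, trajectory_of th (projT2 z) e -> P z.
  exact: (hP (mkstate x) tj hfree).
move=> z {tj hfree x q}tj; have ez := start_state tj; subst z => /= hfree.
have tl := trajectory_timeline tj; have [time0 mono _] := tl.
have [_ _ hf _ [s0 _ hG hstop]] := tj; have [fl hj] := hf 0%N.
have F0 : 0 <= F.
  have [_ [u _] _ _] := sa_control_sets hS.
  have e0 : (tr_time e 0 <= 0%:E)%E by rewrite time0.
  have [hO _ _] := fl 0 e0 (time_ge0 tl 1) s0.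
  by apply: le_trans (hF _ _ u hO); exact: enorm_ge0.
have near s : 0 <= s -> (s%:E <= tr_time e 1)%E -> (s%:E <= tr_stop e)%E ->
    enorm (tr_arc e 0 s - tr_arc e 0 0) <= F * s.
  move=> sp s1 ss; rewrite -[s in leRHS]subr0.
  by apply: (arc_speed tj hF) => //; rewrite time0.
have free s : 0 <= s -> s <= t -> (s%:E <= tr_time e 1)%E -> (s%:E <= tr_stop e)%E ->
    ~ A S _ (tr_arc e 0 s) /\ ~ Gamma S _ (tr_arc e 0 s).
  move=> sp st s1 ss; apply: hfree; apply: le_trans (near s sp s1 ss) _.
  by rewrite ler_wpM2l.
have live s : tr_stop e = s%:E -> s <= t -> ~ (s%:E <= tr_time e 1)%E.
  move=> hs st s1; have sp : 0 <= s by move: s0; rewrite hs lee_fin.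
  have [_ nG] : ~ A S _ (tr_arc e 0 s) /\ ~ Gamma S _ (tr_arc e 0 s) by apply: free; rewrite ?hs.
  apply: nG; have := hG s hs; rewrite -/(sGamma (state_at e s)) state_atE.
  have -> : phase_at e s = 0%N; last by [].
  move: sp; rewrite le_eqVlt => /orP[/eqP <-|sp]; first exact: phase_at0.
  by apply: (phase_atE tl); rewrite ?time0 ?lte_fin.
have desc tau : 0 <= tau -> tau <= t -> (tau%:E <= tr_time e 1)%E -> (tau%:E < tr_stop e)%E ->
  [/\ 0 <= tau <= t, forall s, 0 <= s <= tau -> Omega S _ (tr_arc e 0 s) /\ enorm (tr_arc e 0 s - tr_arc e 0 0) <= F * s,
    solves (ct_u th) (tr_arc e 0) 0 tau &
    mu.-integrable `[0, tau] (EFin \o (fun s => K S _ (tr_arc e 0 s) (ct_u th s) * expR (- lambda S * s)))].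
  move=> tau0 taut tau1 taus; split.
  - by rewrite tau0.
  - move=> s /andP[sp st].
    have s1 : (s%:E <= tr_time e 1)%E by apply: le_trans tau1; rewrite lee_fin.
    have ss : (s%:E <= tr_stop e)%E by apply: le_trans (ltW taus); rewrite lee_fin.
    by split; [have [|||//] := fl s; rewrite ?time0|exact: near].
  - by have [|||_ _ h] := fl tau; rewrite ?time0 ?(ltW taus) //; move: h; rewrite time0.
  - by have [] := run_first_phase tj tau0 tau1 (ltW taus).
have [t1|t1] := ltP t%:E (tr_time e 1).
  have ts : (t%:E < tr_stop e)%E.
    rewrite ltNge; apply/negP => st.
    move: (s0) (st) (live); case: (tr_stop e) => [s| |] // sp; rewrite lee_fin => st' /(_ s erefl st').
    by apply; apply: le_trans (ltW t1); rewrite lee_fin.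
  have [d1 d2 d3 d4] := desc t t0 (lexx _) (ltW t1) ts.
  exists (tr_arc e 0), (ct_u th), t; split => //; left; split => //.
  have tj' := shift_trajectory_of tj t0 (ltW t1) ts.
  have ht := shift_tail tj t0 ts.
  rewrite (cost_tail_flow tj tj' ht (ltW t1)) EFinD leeD2l // EFinM lee_wpmul2l ?lee_fin ?expR_ge0 //.
  apply: fvalue_le => //; have [Ot _] := d2 t d1.
  by apply: Omega_dom => //; have [] := free t t0 (lexx _) (ltW t1) (ltW ts).
have tf := time_fin tl t1; set tau := fine _ in tf.
have tau0 : 0 <= tau by rewrite fine_ge0 // (time_ge0 tl).
have taut : tau <= t by rewrite -lee_fin -tf.
have tau1 : (tau%:E <= tr_time e 1)%E by rewrite tf.
have lt1 : (tr_time e 1 < +oo)%E by rewrite tf ltry.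
have taus : (tau%:E < tr_stop e)%E by rewrite -tf; exact: hstop.
have [d1 d2 d3 d4] := desc tau tau0 taut tau1 taus.
exists (tr_arc e 0), (ct_u th), tau; split => //; right.
have tj' := shift_trajectory_of tj tau0 tau1 taus.
have ht := shift_tail tj tau0 taus.
have t1' : tr_time (shift_trajectory e tau) 1 = 0%E by rewrite /= tf -EFinD subrr.
have dv := drop_value tj' t1'.
have [nA _] := free tau tau0 taut tau1 (ltW taus).
have := hj lt1; rewrite /pre_jump /jump_time -/tau.
case: ifP => [_ [Ax _]|hau [Cx _ Dz ez]]; first by exfalso; exact: nA.
split => //; exists (post_jump e 0); first by rewrite ez.
rewrite (cost_tail_flow tj tj' ht tau1) EFinD leeD2l // EFinM lee_wpmul2l ?lee_fin ?expR_ge0 //.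
move: dv; rewrite /jump_cost [tr_auto _ _]/= hau /pre_jump /jump_time t1' /arcst /= add0r.
have -> : ct_dest th (n_ctrl (shift_trajectory e tau) 0) = post_jump e 0 by rewrite ez.
exact.
Qed.

End Value.

(** * The value function as a viscosity solution *)

Section Bounds.
Variable R : realType.
Implicit Types a m t : R.

(** The upper bound comes from [exp (- a) <= 1 / (1 + a)]. *)
Lemma expR_chord a : 0 <= a -> 1 - a <= expR (- a) <= 1 - a + a ^+ 2.
Proof.
move=> a0; apply/andP; split; first exact: expR_ge1Dx.
have h1 : 1 + a <= expR a by exact: expR_ge1Dx.
have p1 : 0 < 1 + a by rewrite ltr_wpDr.
rewrite expRN; apply: (@le_trans _ _ (1 + a)^-1).
  by rewrite lef_pV2 ?posrE ?expR_gt0.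
rewrite -[leLHS]mul1r ler_pdivrMr //; have a3 : 0 <= a ^+ 3 by exact: exprn_ge0.
rewrite (_ : (1 - a + a ^+ 2) * (1 + a) = 1 + a ^+ 3); last by ring.
by rewrite lerDl.
Qed.

Lemma discount_first_order a m : 0 <= a -> `|expR (- a) * m - m| <= a * `|m|.
Proof.
move=> a0; have /andP[h1 _] := expR_chord a0.
have h2 : expR (- a) <= 1 by rewrite expR_le1 oppr_le0.
rewrite -{2}[m]mul1r -mulrBl normrM ler_wpM2r // ler_norml; apply/andP; split; lra.
Qed.

Lemma discount_second_order a m : 0 <= a -> `|expR (- a) * m - m + a * m| <= a ^+ 2 * `|m|.
Proof.
move=> a0; have /andP[h1 h2] := expR_chord a0; have a2 : 0 <= a ^+ 2 by exact: exprn_ge0.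
rewrite (_ : expR (- a) * m - m + a * m = (expR (- a) - 1 + a) * m); last by ring.
rewrite normrM ler_wpM2r // ler_norml; apply/andP; split; lra.
Qed.

Lemma small_time (c r : R) : 0 <= c -> 0 < r -> exists2 t, 0 < t & forall s, 0 <= s <= t -> s * c <= r.
Proof.
move=> c0 r0; have c1 : 0 < c + 1 by rewrite ltr_wpDl.
exists (r / (c + 1)); first by rewrite divr_gt0.
move=> s /andP[s0]; rewrite ler_pdivlMr // => h.
by apply: le_trans h; rewrite ler_wpM2l // lerDl.
Qed.

End Bounds.

Section Viscosity.
Variables (R : realType) (U V1 : metricType R) (S : hybrid_data U V1).
Hypothesis hS : standing_assumptions S.
Notation mu := (@lebesgue_measure R).

(** The running cost plus the work of [p] accumulates at a rate which, along an arc
    of bounded speed, stays within [k * t] of its rate at the starting point [x];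
    over a time [t] this is an error of second order. *)
Lemma generator_estimate q (x p : 'rV[R]_(sdim S q)) (F : R) : Omega S q x -> 0 < F ->
  (forall i (z : 'rV[R]_(sdim S i)) u, Omega S i z -> enorm (f S i z u) <= F) ->
  exists2 k : R, 0 <= k & forall (y : R -> 'rV[R]_(sdim S q)) (u : R -> U) t c,
    0 <= t -> y 0 = x ->
    (forall s, 0 <= s <= t -> Omega S q (y s) /\ enorm (y s - x) <= F * s) ->
    solves u y 0 t ->
    mu.-integrable `[0, t] (EFin \o (fun s => K S q (y s) (u s) * expR (- lambda S * s))) ->
    ((forall s, c <= K S q x (u s) + dot (f S q x (u s)) p) ->
       (c - k * t) * t <= flow_cost y u t + dot (y t - x) p) /\
    ((forall s, K S q x (u s) + dot (f S q x (u s)) p <= c) ->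
       flow_cost y u t + dot (y t - x) p <= (c + k * t) * t).
Proof.
move=> Ox F0 hF; have l0 := sa_lambda hS.
have [[L hL] _ _] := sa_running_cost hS; have [K1 K10 hK1] := running_cost_bound hS.
have [[Lf hLf] _ _] := sa_vector_fields hS.
pose L1 := Num.max L 0; pose Lf1 := Num.max Lf 0.
have L10 : 0 <= L1 by rewrite le_max lexx orbT.
have Lf10 : 0 <= Lf1 by rewrite le_max lexx orbT.
pose k := L1 * F + K1 * lambda S + enorm p * Lf1 * F.
have k0 : 0 <= k by rewrite !addr_ge0 // !mulr_ge0 ?enorm_ge0 // ltW.
exists k => // y u t c t0 y0 hy sol hi.
pose G s := K S q (y s) (u s) * expR (- lambda S * s) + dot (f S q (y s) (u s)) p.
have [hi2 hE] := @integrable_sum_dot _ _ (fun s => f S q (y s) (u s)) p 0 t (fun i => (sol i).1).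
have hG : mu.-integrable `[0, t] (EFin \o G).
  by have := integrableD _ hi hi2; apply.
have GE : flow_cost y u t + dot (y t - x) p = \int[mu]_(s in `[0, t]) G s.
  rewrite (RintegralD _ hi hi2) //; congr (_ + _); rewrite hE; apply: eq_bigr => i _.
  by rewrite !mxE; have [_ ->] := sol i; rewrite y0 addrAC subrr add0r.
have close s : 0 <= s <= t -> `|G s - (K S q x (u s) + dot (f S q x (u s)) p)| <= k * t.
  move=> hs; have /andP[s0 st] := hs; have [Oys dys] := hy s hs.
  have e1 : `|K S q (y s) (u s) - K S q x (u s)| <= L1 * (F * s).
    apply: le_trans (hL _ _ _ _ Oys Ox) _; apply: (@le_trans _ _ (L1 * enorm (y s - x))).
      by rewrite ler_wpM2r ?enorm_ge0 // le_max lexx.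
    by rewrite ler_wpM2l.
  have e2 : enorm (f S q (y s) (u s) - f S q x (u s)) <= Lf1 * (F * s).
    apply: le_trans (hLf _ _ _ _ Oys Ox) _; apply: (@le_trans _ _ (Lf1 * enorm (y s - x))).
      by rewrite ler_wpM2r ?enorm_ge0 // le_max lexx.
    by rewrite ler_wpM2l.
  have e3 : `|dot (f S q (y s) (u s) - f S q x (u s)) p| <= Lf1 * (F * s) * enorm p.
    by apply: le_trans (dot_CauchySchwarz _ _) _; rewrite ler_wpM2r ?enorm_ge0.
  have ls : 0 <= lambda S * s by rewrite mulr_ge0 // ltW.
  have e4 : `|K S q (y s) (u s) * expR (- lambda S * s) - K S q (y s) (u s)| <= K1 * (lambda S * s).
    rewrite [_ * expR _]mulrC mulNr; apply: le_trans (discount_first_order _ ls) _.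
    by rewrite mulrC ler_wpM2r // hK1.
  rewrite (_ : G s - _ = (K S q (y s) (u s) * expR (- lambda S * s) - K S q (y s) (u s)) +
     (K S q (y s) (u s) - K S q x (u s)) + dot (f S q (y s) (u s) - f S q x (u s)) p); last first.
    by rewrite /G dotDl dotNl; ring.
  apply: le_trans (ler_normD _ _) _; apply: (@le_trans _ _ (k * s)); last by rewrite ler_wpM2l.
  have e5 := ler_normD (K S q (y s) (u s) * expR (- lambda S * s) - K S q (y s) (u s)) (K S q (y s) (u s) - K S q x (u s)).
  rewrite (_ : k * s = K1 * (lambda S * s) + L1 * (F * s) + Lf1 * (F * s) * enorm p); last by rewrite /k; ring.
  by apply: lerD => //; apply: le_trans e5 _; exact: lerD.
rewrite GE; split => hc.
  have := @Rintegral_ge_bound _ G 0 t (c - k * t) t0 hG; rewrite subr0; apply => s hs.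
  have := close s hs; rewrite ler_norml => /andP[h1 _]; have := hc s; order_lra.
have := @Rintegral_bound _ G 0 t (c + k * t) t0 hG; rewrite subr0; apply => s hs.
have := close s hs; rewrite ler_norml => /andP[_ h1]; have := hc s; order_lra.
Qed.

(** At speed at most [F], sets at distance [r] cannot be met before time [r / F];
    the first phase from [x] therefore lasts at least that long. *)
Lemma short_flow q (x : 'rV[R]_(sdim S q)) u (F r t : R) : 0 < F ->
  (forall i (z : 'rV[R]_(sdim S i)) u, Omega S i z -> enorm (f S i z u) <= F) ->
  Omega S q x ->
  (forall y, enorm (y - x) < r -> ~ A S q y /\ ~ Gamma S q y) -> 0 <= t -> F * t < r ->
  exists y : R -> 'rV[R]_(sdim S q), y 0 = x /\
    forall s, 0 <= s <= t -> [/\ Omega S q (y s), enorm (y s - x) <= F * s, ~ A S q (y s) , ~ Gamma S q (y s)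
     & solves (fun _ => u) y 0 s].
Proof.
move=> F0 hF Ox free t0 Ft.
have r0 : 0 < r by apply: le_lt_trans Ft; rewrite mulr_ge0 // ltW.
have [_ nGx] : ~ A S q x /\ ~ Gamma S q x by apply: free; rewrite subrr enorm0.
have [y [T [G fp]]] := first_phase_exists hS u (z := mkstate x) Ox nGx.
have y0 := fp_start fp; rewrite /= in y0.
have near s : 0 <= s -> (s%:E <= T)%E -> (s%:E <= G)%E -> enorm (y s - x) <= F * s.
  move=> s0 sT sG; rewrite -y0 -[s in leRHS]subr0.
  apply: (@solves_speed _ _ _ S _ (fun _ => u)) => //; last exact: (fp_solves fp).
  move=> s' /andP[s'0 s's]; apply: (fp_Omega fp) => //.
    by apply: le_trans sT; rewrite lee_fin.
  by apply: le_trans sG; rewrite lee_fin.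
have short s : 0 <= s -> s <= t -> (s%:E <= T)%E -> (s%:E <= G)%E -> ~ A S q (y s) /\ ~ Gamma S q (y s).
  move=> s0 st sT sG; apply: free; apply: le_lt_trans Ft; apply: le_trans (near s s0 sT sG) _.
  by rewrite ler_pM2l.
have tT : (t%:E < T)%E.
  rewrite ltNge; apply/negP => Tt; have T0 := fp_T0 fp.
  case: T fp near short Tt T0 => [s| |] // fp near short; rewrite !lee_fin => st s0.
  have sG : (s%:E <= G)%E by have [//|->] := fp_one fp; rewrite leey.
  have [nA _] := short s s0 st (lexx _) sG; apply: nA; exact: (fp_hitA fp).
have tG : (t%:E < G)%E.
  rewrite ltNge; apply/negP => Gt; have G0 := ltW (fp_G0 fp).
  case: G fp near short Gt G0 => [s| |] // fp near short; rewrite !lee_fin => st s0.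
  have sT : (s%:E <= T)%E by have [->|//] := fp_one fp; rewrite leey.
  have [_ nG] := short s s0 st sT (lexx _); apply: nG; exact: (fp_hitG fp).
exists y; split => // s /andP[s0 st].
have sT : (s%:E <= T)%E by apply: le_trans (ltW tT); rewrite lee_fin.
have sG : (s%:E <= G)%E by apply: le_trans (ltW tG); rewrite lee_fin.
have [nA nG] := short s s0 st sT sG.
split => //; [exact: (fp_Omega fp)|exact: near|exact: (fp_solves fp)].
Qed.

(** The dynamic programming inequality [value_flow] for a constant control over a
    short time [t], with the value replaced by the touching test function, expanded
    to first order in [t]. *)
Lemma value_subsolution_at q (x : 'rV[R]_(sdim S q)) (phi : 'rV[R]_(sdim S q) -> R) :
  Omega S q x -> ~ A S q x -> ~ Gamma S q x -> differentiable phi x ->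
  (\forall y \near x, dom S q y -> fvalue y - phi y <= fvalue x - phi x) ->
  fvalue x + Ham x (grad phi x) <= 0.
Proof.
move=> Ox nA nG dphi hmax; apply: (Ham_le hS Ox) => u.
set p := grad phi x; set w := fvalue x; have l0 := sa_lambda hS.
have [F F0 hF] := speed_bound hS.
have [k k0 hk] := generator_estimate p Ox F0 hF.
have [r1 r10 h1] := free_ball hS Ox nA nG.
have [r2 r20 h2] := nbhs_enormP hmax.
apply/ler_addgt0Pr => e e0.
have e1 : 0 < e / (4 * F) by rewrite divr_gt0 // mulr_gt0.
have [r3 r30 h3] := grad_expansion dphi e1.
pose c := k + lambda S ^+ 2 * `|w| + lambda S * (enorm p * F).
have c0 : 0 <= c by rewrite !addr_ge0 // !mulr_ge0 ?enorm_ge0 ?sqr_ge0 // ltW.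
have e4 : 0 < e / 4 by rewrite divr_gt0.
have [t1 t10 ht1] := small_time c0 e4.
pose r := Num.min r1 (Num.min r2 r3).
have r0 : 0 < r by rewrite !lt_min r10 r20 r30.
pose t := Num.min t1 (r / (2 * F)).
have t0 : 0 < t by rewrite lt_min t10 divr_gt0 // mulr_gt0.
have Ft : F * t < r.
  apply: (@le_lt_trans _ _ (F * (r / (2 * F)))); first by rewrite ler_pM2l // ge_min lexx orbT.
  rewrite (_ : F * (r / (2 * F)) = r / 2); last by field; rewrite gt_eqF.
  by rewrite ltr_pdivrMr // ltr_pMr // ltr1n.
have ct : t * c <= e / 4 by apply: ht1; rewrite (ltW t0) ge_min lexx.
have free y : enorm (y - x) < r -> ~ A S q y /\ ~ Gamma S q y.
  by rewrite !lt_min => /andP[hy _]; have [] := h1 y hy.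
have [y [y0 hy]] := short_flow u F0 hF Ox free (ltW t0) Ft.
have tt : 0 <= t <= t by rewrite ltW // lexx.
have [Oyt dyt nAt nGt solt] := hy t tt.
have [hi V] : mu.-integrable `[0, t] (EFin \o (fun s => K S q (y s) u * expR (- lambda S * s))) /\
    w <= flow_cost y (fun _ => u) t + expR (- lambda S * t) * fvalue (y t).
  rewrite /w -y0; apply: value_flow => // [|s hs|s hs|s hs|s hs]; first exact: ltW.
  - by have [] := hy s hs.
  - by have [] := hy s hs.
  - have hs' : 0 <= s <= t by case/andP: hs => -> /ltW ->.
    by have [] := hy s hs'.
  - by have [] := hy s hs.
have dr : enorm (y t - x) < r by apply: le_lt_trans Ft.
have [_ hup] := hk y (fun _ => u) t (K S q x u + dot (f S q x u) p) (ltW t0) y0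
  (fun s hs => let: And5 a b _ _ _ := hy s hs in conj a b) solt hi.
have {}hup := hup (fun _ => lexx _).
have hphi : fvalue (y t) <= w + dot (y t - x) p + e / 4 * t.
  have hm : fvalue (y t) - phi (y t) <= w - phi x.
    apply: h2; last exact: Omega_dom.
    by rewrite enormB; move: dr; rewrite !lt_min => /and3P[].
  have hx := h3 (y t); have {}hx := hx _; have : enorm (y t - x) < r3 by move: dr; rewrite !lt_min => /and3P[].
  move=> /hx; rewrite ler_norml => /andP[_ h4].
  have h5 : e / (4 * F) * enorm (y t - x) <= e / 4 * t.
    apply: (@le_trans _ _ (e / (4 * F) * (F * t))); first by rewrite ler_pM2l.
    rewrite le_eqVlt; apply/orP; left; apply/eqP; field; rewrite gt_eqF //.
  rewrite dotC -/p in h4 *; order_lra.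
have lt0 : 0 <= lambda S * t by rewrite mulr_ge0 // ltW.
set E := expR _ in V; set P := dot (y t - x) p in hphi hup.
have E0 : 0 <= E by exact: expR_ge0.
have E1 : E <= 1 by rewrite /E expR_le1 mulNr oppr_le0.
have q1 : `|E * w - w + lambda S * t * w| <= (lambda S * t) ^+ 2 * `|w|.
  by rewrite /E mulNr; exact: discount_second_order.
have q2 : `|E * P - P| <= (lambda S * t) * `|P| by rewrite /E mulNr; exact: discount_first_order.
have q3 : `|P| <= enorm p * F * t.
  apply: le_trans (dot_CauchySchwarz _ _) _; rewrite mulrC -mulrA ler_wpM2l ?enorm_ge0 //.
have q4 : lambda S * t * `|P| <= lambda S * t * (enorm p * F * t) by rewrite ler_wpM2l.
have q5 : E * fvalue (y t) <= E * (w + P + e / 4 * t) by rewrite ler_wpM2l.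
have q6 : E * (e / 4 * t) <= e / 4 * t.
  by rewrite -[leRHS]mul1r ler_wpM2r // mulr_ge0 // ltW.
have q7 : t * (t * c) <= t * (e / 4) by rewrite ler_pM2l.
suff : lambda S * w * t <= (K S q x u + dot (f S q x u) p + e) * t by rewrite ler_pM2r.
rewrite (_ : t * (t * c) = k * t * t + (lambda S * t) ^+ 2 * `|w| + lambda S * t * (enorm p * F * t)) in q7; last first.
  by rewrite /c; ring.
move: q1 q2; rewrite !ler_norml => /andP[_ q1] /andP[_ q2].
have et : 0 < e * t by rewrite mulr_gt0.
set a := K S q x u + dot (f S q x u) p in hup *; set FC := flow_cost _ _ _ in V hup.
clear - V q1 q2 q4 q5 q6 q7 hup et.
move: (E * fvalue (y t)) V q5 => Ev V q5; lra.
Qed.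

(** Otherwise every control would exceed the balance of the Hamilton-Jacobi equation
    by [e], so that a trajectory flowing for a short time [t] would lose about
    [e * t], and one that jumps before would lose about [2 * gam]; a trajectory
    which is optimal up to [eta] can afford neither. *)
Lemma value_supersolution_at q (x : 'rV[R]_(sdim S q)) (phi : 'rV[R]_(sdim S q) -> R) (rho gam : R) :
  Omega S q x -> ~ A S q x -> ~ Gamma S q x -> differentiable phi x ->
  (\forall y \near x, dom S q y -> fvalue x - phi x <= fvalue y - phi y) ->
  0 < rho -> 0 < gam ->
  (forall y (z : state S), enorm (y - x) < rho -> C S q y -> D S _ (projT2 z) ->
     fvalue x + 2 * gam <= sCc (mkstate y) z + svalue z) ->
  0 <= fvalue x + Ham x (grad phi x).
Proof.
move=> Ox nA nG dphi hmin rho0 gam0 hjump; apply: (Ham_ge hS Ox) => e e0.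
set p := grad phi x; set w := fvalue x; have l0 := sa_lambda hS.
apply: contrapT => nex.
have hlo u : lambda S * w + e <= K S q x u + dot (f S q x u) p.
  by rewrite leNgt; apply/negP => hu; apply: nex; exists u; exact: ltW.
have dx : dom S q x by exact: Omega_dom.
have [F F0 hF] := speed_bound hS.
have [k k0 hk] := generator_estimate p Ox F0 hF.
have [r1 r10 h1] := free_ball hS Ox nA nG.
have [r2 r20 h2] := nbhs_enormP hmin.
have e1 : 0 < e / (8 * F) by rewrite divr_gt0 // mulr_gt0.
have [r3 r30 h3] := grad_expansion dphi e1.
have [K1 K10 hK1] := running_cost_bound hS.
pose c := k + lambda S ^+ 2 * `|w| + lambda S * (enorm p * F).
have c0 : 0 <= c by rewrite !addr_ge0 // !mulr_ge0 ?enorm_ge0 ?sqr_ge0 // ltW.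
have e4 : 0 < e / 4 by rewrite divr_gt0.
have [t1 t10 ht1] := small_time c0 e4.
pose c' := K1 + lambda S * `|w + 2 * gam|.
have c'0 : 0 <= c' by rewrite addr_ge0 // mulr_ge0 // ltW.
have [t2 t20 ht2] := small_time c'0 gam0.
pose r := Num.min (Num.min r1 rho) (Num.min r2 r3).
have r0 : 0 < r by rewrite !lt_min r10 r20 r30 rho0.
pose t := Num.min (Num.min t1 t2) (r / (2 * F)).
have t0 : 0 < t by rewrite !lt_min t10 t20 divr_gt0 // mulr_gt0.
have Ft : F * t < r.
  apply: (@le_lt_trans _ _ (F * (r / (2 * F)))); first by rewrite ler_pM2l // ge_min lexx orbT.
  rewrite (_ : F * (r / (2 * F)) = r / 2); last by field; rewrite gt_eqF.
  by rewrite ltr_pdivrMr // ltr_pMr // ltr1n.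
have tt1 : t <= t1 by rewrite !ge_min lexx.
have tt2 : t <= t2 by rewrite !ge_min lexx !orbT.
have ct : t * c <= e / 4 by apply: ht1; rewrite (ltW t0).
pose eta := Num.min (gam / 2) (e / 8 * t).
have eta0 : 0 < eta by rewrite lt_min divr_gt0 //= mulr_gt0 // divr_gt0.
have [th [tr [cost_r [tj hr hle]]]] := fvalue_near hS dx eta0.
have free y : enorm (y - x) <= F * t -> ~ A S q y /\ ~ Gamma S q y.
  move=> hy; have := le_lt_trans hy Ft; rewrite !lt_min => /andP[/andP[hy1 _] _].
  by have [] := h1 y hy1.
have [y [u [tau [/andP[tau0 taut] y0 hy [sol hi] hcase]]]] := first_piece hS tj (ltW t0) hF free.
have eta1 : eta <= gam / 2 by rewrite ge_min lexx.
have eta2 : eta <= e / 8 * t by rewrite ge_min lexx orbT.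
rewrite hr in hcase; case: hcase => [[taue]|[Cy [z Dz]]]; rewrite lee_fin => hc; last first.
  have hyt : enorm (y tau - x) < rho.
    have [_ hd] := hy tau (introT andP (conj tau0 (lexx tau))).
    have : enorm (y tau - x) < r by apply: le_lt_trans hd _; apply: le_lt_trans Ft; rewrite ler_pM2l.
    by rewrite !lt_min => /andP[/andP[]].
  have hj := hjump (y tau) z hyt Cy Dz.
  have fc : - K1 * tau <= flow_cost y u tau.
    have := @Rintegral_ge_bound _ _ 0 tau (- K1) tau0 hi; rewrite subr0; apply => s hs.
    have [Oys _] := hy s hs; have /andP[s0 _] := hs.
    have hK : `|K S q (y s) (u s) * expR (- lambda S * s)| <= K1.
      rewrite normrM (ger0_norm (expR_ge0 _)) -[leRHS]mulr1; apply: ler_pM; rewrite ?expR_ge0 ?hK1 //.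
      by rewrite expR_le1 mulNr oppr_le0 mulr_ge0 // ltW.
    by have := hK; rewrite ler_norml => /andP[].
  have lt0 : 0 <= lambda S * tau by rewrite mulr_ge0 // ltW.
  have q1 := discount_first_order (w + 2 * gam) lt0; rewrite -mulNr in q1.
  have q2 : expR (- lambda S * tau) * (w + 2 * gam) <= expR (- lambda S * tau) * (sCc (mkstate (y tau)) z + svalue z).
    by rewrite ler_wpM2l // expR_ge0.
  have q3 : tau * c' <= gam by apply: ht2; rewrite tau0 (le_trans taut).
  move: q1; rewrite ler_norml => /andP[q1 _]; rewrite /c' mulrDr in q3.
  clear - hle hc fc q1 q2 q3 eta1 gam0.
  move: (expR _ * (sCc _ _ + _)) (expR _ * (w + _)) hc q1 q2 => E1 E2 hc q1 q2.
  rewrite -/w in hle; lra.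
subst tau.
have tt : 0 <= t <= t by rewrite ltW // lexx.
have [Oyt dyt] := hy t tt.
have dr : enorm (y t - x) < r by apply: le_lt_trans Ft.
have [hlow _] := hk y u t (lambda S * w + e) (ltW t0) y0 hy sol hi.
have {}hlow := hlow (fun s => hlo (u s)).
have hphi : w + dot (y t - x) p - e / 8 * t <= fvalue (y t).
  have hm : w - phi x <= fvalue (y t) - phi (y t).
    apply: h2; last by apply: Omega_dom => //; have [] := free _ dyt.
    by rewrite enormB; move: dr; rewrite !lt_min => /and3P[].
  have hx := h3 (y t); have {}hx := hx _; have : enorm (y t - x) < r3 by move: dr; rewrite !lt_min => /and3P[].
  move=> /hx; rewrite ler_norml => /andP[h4 _].
  have h5 : e / (8 * F) * enorm (y t - x) <= e / 8 * t.
    apply: (@le_trans _ _ (e / (8 * F) * (F * t))); first by rewrite ler_pM2l.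
    rewrite le_eqVlt; apply/orP; left; apply/eqP; field; rewrite gt_eqF //.
  rewrite dotC -/p in h4 *; order_lra.
have lt0 : 0 <= lambda S * t by rewrite mulr_ge0 // ltW.
set E := expR _ in hc; set P := dot (y t - x) p in hphi hlow.
have E0 : 0 <= E by exact: expR_ge0.
have E1 : E <= 1 by rewrite /E expR_le1 mulNr oppr_le0.
have q1 : `|E * w - w + lambda S * t * w| <= (lambda S * t) ^+ 2 * `|w|.
  by rewrite /E mulNr; exact: discount_second_order.
have q2 : `|E * P - P| <= (lambda S * t) * `|P| by rewrite /E mulNr; exact: discount_first_order.
have q3 : `|P| <= enorm p * F * t.
  apply: le_trans (dot_CauchySchwarz _ _) _; rewrite mulrC -mulrA ler_wpM2l ?enorm_ge0 //.
have q4 : lambda S * t * `|P| <= lambda S * t * (enorm p * F * t) by rewrite ler_wpM2l.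
have q5 : E * (w + P - e / 8 * t) <= E * fvalue (y t) by rewrite ler_wpM2l.
have q6 : E * (e / 8 * t) <= e / 8 * t.
  by rewrite -[leRHS]mul1r ler_wpM2r // mulr_ge0 // ltW // divr_gt0.
have q7 : t * (t * c) <= t * (e / 4) by rewrite ler_pM2l.
rewrite (_ : t * (t * c) = k * t * t + (lambda S * t) ^+ 2 * `|w| + lambda S * t * (enorm p * F * t)) in q7; last first.
  by rewrite /c; ring.
move: q1 q2; rewrite !ler_norml => /andP[q1 _] /andP[q2 _].
have et : 0 < e * t by rewrite mulr_gt0.
rewrite -/w in hle; set FC := flow_cost _ _ _ in hc hlow.
clear - hc hle eta2 q1 q2 q4 q5 q6 q7 hlow et.
move: (E * fvalue (y t)) hc q5 => Ev hc q5; lra.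
Qed.

Notation W := (@fvalue R U V1 S).

Lemma value_A_le q (x : 'rV[R]_(sdim S q)) v : A S q x ->
  fvalue x <= fvalue (g S q x v) + Ca S q x v.
Proof.
move=> Ax; have [hg _ _] := sa_transition hS; rewrite addrC.
apply: (@value_jump _ _ _ _ hS q x true v (mkstate (g S q x v))) => //; first exact: A_Omega.
  by move=> Gx; exact: (Gamma_A_disjoint hS Gx Ax).
exact: hg.
Qed.

Lemma value_C_le q q' (x : 'rV[R]_(sdim S q)) (x' : 'rV[R]_(sdim S q')) : C S q x -> D S q' x' ->
  fvalue x <= fvalue x' + Cc S q q' x x'.
Proof.
move=> Cx Dx; have [_ _ _ [v _]] := sa_control_sets hS; rewrite addrC.
apply: (@value_jump _ _ _ _ hS q x false v (mkstate x')) => //; first exact: C_Omega.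
by move=> Gx; exact: (Gamma_C_disjoint hS Gx Cx).
Qed.

Lemma value_subsolution : viscosity_subsolution (S := S) W.
Proof.
split.
- move=> q x Ax; rewrite sube_le0; apply: le_ereal_inf_tmp => _ [v _ <-].
  by rewrite lee_fin; exact: value_A_le.
- by move=> x bx; rewrite /fvalue value_Gamma //; exact: (bdry_Gamma_sub hS).
- move=> q phi x C1 dx hmax; have [dphi _] := C1 x I.
  have Ox := dom_Omega hS dx.
  split=> [Cx|[_ nACG]].
    rewrite ge_max; apply/andP; split.
      rewrite sube_le0; apply: le_ereal_inf_tmp => _ [q' [x' [Dx' ->]]].
      by rewrite lee_fin; exact: value_C_le.
    rewrite lee_fin; apply: value_subsolution_at => //.
      by move=> Ax; exact: (A_C_disjoint hS Ax Cx).
    by move=> Gx; exact: (Gamma_C_disjoint hS Gx Cx).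
  apply: value_subsolution_at => // [Ax|Gx]; apply: nACG; first by left; left.
  by right.
Qed.

Lemma value_A_ge q (x : 'rV[R]_(sdim S q)) : A S q x -> (Mop W x <= (fvalue x)%:E)%E.
Proof.
move=> Ax; apply/lee_addgt0Pr => e e0.
have [th [tr [r [tj hr hle]]]] := fvalue_near hS (A_dom hS Ax) e0.
have [v hv] := autonomous_start hS tj Ax; rewrite hr lee_fin addrC in hv.
apply: (@le_trans _ _ (fvalue (g S q x v) + Ca S q x v)%:E).
  by apply: ereal_inf_lbound; exists v.
by rewrite -EFinD lee_fin; apply: le_trans hle.
Qed.

Lemma value_supersolution : viscosity_supersolution (S := S) W.
Proof.
split.
- by move=> q x Ax; rewrite subre_ge0 //; exact: value_A_ge.
- by move=> x bx; rewrite /fvalue value_Gamma //; exact: (bdry_Gamma_sub hS).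
- move=> q phi x C1 dx hmin; have [dphi _] := C1 x I.
  have Ox := dom_Omega hS dx.
  split=> [Cx|[_ nACG]]; last first.
    have [r r0 hr] : exists2 r, 0 < r & forall y, enorm (x - y) < r -> ~ C S q y.
      apply: nbhs_enormP; apply: open_nbhs_nbhs; split; last by move=> Cx; apply: nACG; left; right.
      by apply: closed_openC; exact: closed_C.
    apply: (@value_supersolution_at q x phi r 1) => // [Ax|Gx|y z hy Cy].
    + by apply: nACG; left; left.
    + by apply: nACG; right.
    + by exfalso; apply: (hr y) => //; rewrite enormB.
  rewrite le_max subre_ge0 //.
  have [//|WN] := leP (Nop W x) (fvalue x)%:E; rewrite orFb lee_fin.
  (* where the value is below its obstacle, it is so with a margin, which the
     uniform continuity of [Cc] preserves at nearby points of [C] *)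
  have [gam gam0 hgam] : exists2 gam, 0 < gam & forall q' x', D S q' x' -> fvalue x + 3 * gam <= fvalue x' + Cc S q q' x x'.
    case hN: (Nop W x) WN => [m| |] // WN.
      rewrite lte_fin in WN; exists ((m - fvalue x) / 3); first by rewrite divr_gt0 // subr_gt0.
      move=> q' x' Dx'; have := @Nop_le _ _ _ S W q x q' x' Dx'; rewrite hN lee_fin; lra.
    exists 1 => // q' x' Dx'; have := @Nop_le _ _ _ S W q x q' x' Dx'.
    by rewrite hN leye_eq.
  have [_ hCc _ _ _] := sa_switching_costs hS; have [rho rho0 hrho] := hCc gam gam0.
  apply: (@value_supersolution_at q x phi rho gam) => //.
  + by move=> Ax; exact: (A_C_disjoint hS Ax Cx).
  + by move=> Gx; exact: (Gamma_C_disjoint hS Gx Cx).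
  + move=> y [q' x'] /= hy Cy Dx'; have h := hgam q' x' Dx'.
    have := hrho q q' y x x' x' Cy Cx Dx' Dx' hy; rewrite subrr enorm0 => /(_ rho0).
    rewrite ltr_norml /sCc /svalue /= => /andP[h2 _]; lra.
Qed.

Hypothesis hV : forall q, {within dom S q, continuous (value S q)}.

Lemma fvalue_continuous q : {within dom S q, continuous (@fvalue R U V1 S q)}.
Proof.
apply/subspace_continuousP => x dx; have /subspace_continuousP /(_ x dx) := @hV q.
rewrite /from_subspace (fvalueE hS dx) => h.
exact: (fine_cvg h).
Qed.

Lemma value_viscosity_solution : viscosity_solution (S := S) W.
Proof.
split.
- have [B hB] := value_bounded hS; exists B => q x dx.
  by have [w hw wB] := hB q x dx; rewrite /fvalue hw.
- exact: fvalue_continuous.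
- exact: value_subsolution.
- exact: value_supersolution.
Qed.

End Viscosity.

(** * Existence and uniqueness *)

Theorem theorem7 (R : realType) (U V1 : metricType R) (S : hybrid_data U V1)
    (hS : standing_assumptions S)
    (hV : forall q, {within dom S q, continuous (value S q)}) :
  [/\ forall q x, dom S q x -> value S q x \is a fin_num,
      viscosity_solution (S := S) (fun q x => fine (value S q x))
    & forall W : forall q, 'rV[R]_(sdim S q) -> R,
        viscosity_solution (S := S) W ->
        forall q x, dom S q x -> W q x = fine (value S q x)].
Proof.
have sol := value_viscosity_solution hS hV.
split; first by move=> q x dx; rewrite (fvalueE hS dx).
  exact: sol.
move=> W [[B1 hB1] cW subW supW] q x dx; have [[B2 hB2] cV subV supV] := sol.
have b1 q' x' : dom S q' x' -> `|W q' x'| <= Num.max B1 B2.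
  by move=> d; apply: le_trans (hB1 q' x' d) _; rewrite le_max lexx.
have b2 q' x' : dom S q' x' -> `|@fvalue R U V1 S q' x'| <= Num.max B1 B2.
  by move=> d; apply: le_trans (hB2 q' x' d) _; rewrite le_max lexx orbT.
apply/eqP; rewrite eq_le; apply/andP; split.
  exact: (comparison hS b1 b2 cW cV subW supV).
exact: (comparison hS b2 b1 cV cW subV supW).
Qed.
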